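(* Let $f$ be a smooth function with rational asymmetric logarithmic singularity at $x_1$ (defined in the context). For $\alpha\in[0,1)$ irrational, $q\in\mathbb{Q}$ and $N\in\mathbb{N}$, let $g(N)=\min_{n\le N}\|n\alpha+q-x_1\|$ and $A_N=(x_1-g(N),x_1+g(N))$ (taken modulo $1$). Then for almost every $\alpha\in[0,1)$ and every $0<r<1$ there exists $C(r)=C(r,f,q)>0$ such that both sets $$\Big\{N: S_N(f,\alpha,q)\ge C(r)\sup_{x\in[0,1)\setminus A_N}|f(x)|\sum_{i=1}^{K(N)}a_i+N\Big|\int_{A_N}f(x)\,dx\Big|\Big\},$$ $$\Big\{N: S_N(f,\alpha,q)\le -C(r)\sup_{x\in[0,1)\setminus A_N}|f(x)|\sum_{i=1}^{K(N)}a_i-N\Big|\int_{A_N}f(x)\,dx\Big|\Big\}$$ have upper density at least $r$.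
   Context: $\{x\}$ is the fractional part and $\|x\|$ the distance to the nearest integer. A $1$-periodic $f$ with $\int_0^1 f=0$ is a smooth function with rational logarithmic singularity at $x_1\in\mathbb{Q}$ if $f(x)=c_1\log\|x-x_1\|+c_2\log\{x-x_1\}+t(x)$ for $x\not\equiv x_1\pmod1$ and $f(x)=t(x)$ otherwise, with constants $c_1,c_2$ and $t$ $1$-periodic of bounded variation on $[0,1)$; it is asymmetric if $c_2\ne0$. For $\alpha=[a_0;a_1,\dots]$ with convergent denominators $q_0=1,q_1=a_1,q_{k+1}=a_{k+1}q_k+q_{k-1}$, $K(N)$ is the integer with $q_{K-1}\le N<q_K$. $S_N(f,\alpha,q):=\sum_{n=1}^N f(n\alpha+q)-N\int_0^1 f$. The upper density of $A\subseteq\mathbb{N}$ is $\limsup_{M\to\infty}|\{N\le M:N\in A\}|/M$. *)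

(* Defs.v *)
From HB Require Import structures.
From mathcomp Require Import all_boot all_order all_algebra.
From mathcomp Require Import all_classical all_reals all_analysis.
Set Implicit Arguments. Unset Strict Implicit. Unset Printing Implicit Defensive.
Import Order.TTheory GRing.Theory Num.Theory.
Import numFieldNormedType.Exports.
Local Open Scope classical_set_scope.
Local Open Scope ring_scope.

Section Defs.
Variable R : realType.

Definition frac (x : R) : R := x - (Num.floor x)%:~R.
Definition dnint (x : R) : R := Num.min (frac x) (1 - frac x).

Definition one_periodic (f : R -> R) := forall x, f (x + 1) = f x.


Definition BV_01 (t : R -> R) :=
  exists M : R, forall b : R, 0 <= b < 1 ->
    forall v, variations 0 b t v -> v <= M.

Definition log_sing_fun (f : R -> R) (x1 : rat) (c1 c2 : R) (t : R -> R) :=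
  [/\ one_periodic f,
      (\int[lebesgue_measure]_(x in `[0%R, 1%R[%classic) (f x)%:E = 0)%E,
      one_periodic t, BV_01 t &
      forall x : R,
        (frac (x - ratr x1) != 0 ->
           f x = c1 * ln (dnint (x - ratr x1)) + c2 * ln (frac (x - ratr x1)) + t x)
        /\ (frac (x - ratr x1) = 0 -> f x = t x)].

Definition asym_log_sing (f : R -> R) (x1 : rat) :=
  exists c1 c2 t, log_sing_fun f x1 c1 c2 t /\ c2 != 0.

(* continued fraction expansion alpha = [a_0; a_1, ...]:
   complete quotients x_0 = alpha, x_{k+1} = 1/{x_k}; a_k = floor x_k *)
Fixpoint cfx (alpha : R) (k : nat) : R :=
  if k is k'.+1 then (frac (cfx alpha k'))^-1 else alpha.
Definition cfa (alpha : R) (k : nat) : nat := `|Num.floor (cfx alpha k)|%N.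

(* (q_{k-1}, q_k) with q_{-1} = 0, q_0 = 1, q_{k+1} = a_{k+1} q_k + q_{k-1} *)
Fixpoint cfq2 (alpha : R) (k : nat) : nat * nat :=
  if k is k'.+1 then
    let p := cfq2 alpha k' in (p.2, cfa alpha k'.+1 * p.2 + p.1)%N
  else (0, 1)%N.
Definition cfq (alpha : R) (k : nat) : nat := (cfq2 alpha k).2.
Definition cfq_prev (alpha : R) (k : nat) : nat := (cfq2 alpha k).1.

Definition Kof (alpha : R) (N : nat) : nat :=
  xget 0%N [set K | (cfq_prev alpha K <= N < cfq alpha K)%N].

Definition SN (f : R -> R) (alpha q : R) (N : nat) : R :=
  \sum_(1 <= n < N.+1) f (n%:R * alpha + q)
  - N%:R * Rintegral lebesgue_measure `[0%R, 1%R[%classic f.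

Definition gmin (alpha q x1 : R) (N : nat) : R :=
  \big[Num.min/1]_(1 <= n < N.+1) dnint (n%:R * alpha + q - x1).

(* A_N = (x1 - g(N), x1 + g(N)) taken modulo 1, as a subset of R *)
Definition AN (alpha q x1 : R) (N : nat) : set R :=
  [set x | dnint (x - x1) < gmin alpha q x1 N].

Definition count_upto (A : set nat) (M : nat) : nat :=
  (\sum_(1 <= N < M.+1) (asbool (A N) : nat))%N.
Definition upper_density (A : set nat) : \bar R :=
  limn_esup (fun M => ((count_upto A M)%:R / M%:R : R)%:E).

End Defs.

(* Main.v *)
From Pilot Require Import Defs.
From HB Require Import structures.
From mathcomp Require Import all_boot all_order all_algebra.
From mathcomp Require Import all_classical all_reals all_analysis.
From mathcomp Require Import measurable_realfun ring lra zify.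
Set Implicit Arguments. Unset Strict Implicit. Unset Printing Implicit Defensive.
Import Order.TTheory GRing.Theory Num.Theory.
Import numFieldNormedType.Exports.
Local Open Scope classical_set_scope.
Local Open Scope ring_scope.

(* Write f = A ln{x - x1} + B ln(1 - {x - x1}) + t' with A - B = c2 and t' a difference of bounded monotone
   functions on [0, 1).  For almost every alpha there are infinitely many K of either parity such that q_K is
   a multiple of the denominator v of q - x1, a_{K+1} is much larger than a_1 + ... + a_K, and ln a_{K+1} is
   much smaller than ln q_K.  For N between two small multiples of q_{K+1}, split the orbit into blocks of
   length q_K.  Since v divides q_K, the singularity lies on the lattice of the rotation by p_K/q_K, so in each
   block one orbit point falls next to x1, always on the side given by the parity of K, and all others avoid
   it.  By Stirling's formula each block contributes -(ln q_K)/2 to one of the two logarithmic sums (centred)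
   and +(ln q_K)/2 to the other, that is, +-c2 (ln q_K)/2 to S_N(f).  The total drift has order
   a_{K+1} ln q_K, whereas the last incomplete block, t', N times the integral over A_N, and
   C sup|f| (a_1 + ... + a_{K+1}) are smaller: the first two by Denjoy-Koksma and Ostrowski expansions, the
   others since 1/((a_{K+1} + 2) q_K^2) <= g(N) <= 1/q_{K+1}.  Choosing the parity of K fixes the sign. *)

(** * Continued fractions and cylinder sets *)

(** For [N] a fixed fraction of q_(K+1), the drift and sup|f| (a_1 + ... + a_(K+1)) have the same
    order a_(K+1) ln q_K, so a large [K] cannot separate them: C(r) itself must be small. The window
    of good [N] is e X <= N < X with X = delta q_(K+1) and e = (1 - r) / 2. At its left end only
    about e delta a_(K+1) blocks are complete while the digit sum is already full, so C(r) is
    proportional to 1 - r. The factor delta, proportional to |c2|, is there because the slow motion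
    of the orbit off the lattice costs up to delta ln q_K per block. All other errors are beaten by
    the free parameter [L] of a good index, chosen after r, f and q. The obstacle is the existence
    of good indices. Digits have infinite mean, a_1 + ... + a_K is typically of order K ln K, and a
    digit exceeds [L] times this with probability of order 1 / (K ln K), which barely diverges.
    Hence divisibility, parity and the upper bound on a_(K+1) may cost only a constant factor. The
    upper bound is imposed because the orbit point closest to x1 can add ln a_(K+1) in every
    block. *)

Section ContinuedFractions.
Variable R : realType.
Implicit Types (x y z : R) (w : seq nat).

Local Notation irr := (@irrational R).
Local Notation frac := (@Pilot.Defs.frac R).

Lemma frac_ge0 x : 0 <= frac x.
Proof. by rewrite /frac subr_ge0 floor_le. Qed.

Lemma frac_lt1 x : frac x < 1.
Proof. by rewrite /frac ltrBlDl -intrD1 floorD1_gt. Qed.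

Lemma frac_eq (k : int) x y : x = k%:~R + y -> 0 <= y < 1 -> frac x = y.
Proof.
move=> -> /andP[y0 y1]; rewrite /frac (@floor_def _ _ k); first by rewrite addrAC subrr add0r.
by rewrite lerDl y0 intrD1 ltrD2l.
Qed.

Lemma frac_addz (k : int) x : frac (x + k%:~R) = frac x.
Proof.
apply: (@frac_eq (k + Num.floor x)); last by rewrite frac_ge0 frac_lt1.
by rewrite /frac intrD; ring.
Qed.

Lemma floorE x : x = (Num.floor x)%:~R + frac x.
Proof. by rewrite /frac; ring. Qed.

Lemma irr_addz (k : int) x : irr x -> irr (k%:~R + x).
Proof.
move=> ix [q _ qx]; apply: ix; exists (q - k%:~R) => //.
by rewrite rmorphB/= ratr_int qx; ring.
Qed.

Lemma irr_inv x : irr x -> irr x^-1.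
Proof.
by move=> ix [q _ qx]; apply: ix; exists q^-1 => //; rewrite fmorphV/= qx invrK.
Qed.

Lemma irr_frac x : irr x -> irr (frac x).
Proof.
by move=> ix; rewrite /frac addrC -mulrNz; apply: irr_addz.
Qed.

Lemma irr_neq (q : rat) x : irr x -> x != ratr q.
Proof. by move=> ix; apply/eqP => xq; apply: ix; exists q. Qed.

Lemma irr_neq0 x : irr x -> x != 0.
Proof. by move=> /(irr_neq 0); rewrite rmorph0. Qed.

Lemma irr_neq_nat (n : nat) x : irr x -> x != n%:R.
Proof. by move=> /(irr_neq n%:R); rewrite rmorph_nat. Qed.

Lemma irr_frac_gt0 x : irr x -> 0 < frac x.
Proof. by move=> ix; rewrite lt_neqAle frac_ge0 andbT eq_sym irr_neq0//; exact: irr_frac. Qed.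

Lemma irr_frac_inv x : 1 < x -> frac x^-1 = x^-1.
Proof.
move=> x1; apply: (@frac_eq 0); first by rewrite add0r.
have x0 : 0 < x by lra.
by rewrite invr_ge0 ltW//= invf_lt1.
Qed.

(* [wden (digits al k) = (q_{k-1}, q_k)] and [wnum (digits al k) = (p_{k-1}, p_k)] *)
Definition conv_step (s : nat * nat) (a : nat) := (s.2, a * s.2 + s.1)%N.
Definition wden w := foldl conv_step (0, 1)%N w.
Definition wnum w := foldl conv_step (1, 0)%N w.
Definition digits (a : R) k := [seq cfa a i | i <- iota 1 k].
Arguments digits : simpl never.
(** The number [0; w_1, ..., w_n, x] whose last entry is a real complete quotient; starting the fold
    at [x^-1] makes the empty word give [0; x]. *)
Definition cfword w x : R := foldr (fun a y => (a%:R + y)^-1) x^-1 w.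

Lemma wden_rcons w c : wden (rcons w c) = conv_step (wden w) c.
Proof. by rewrite /wden foldl_rcons. Qed.

Lemma wnum_rcons w c : wnum (rcons w c) = conv_step (wnum w) c.
Proof. by rewrite /wnum foldl_rcons. Qed.

Lemma size_digits (a : R) k : size (digits a k) = k.
Proof. by rewrite size_map size_iota. Qed.

Lemma digitsS (a : R) k : digits a k.+1 = rcons (digits a k) (cfa a k.+1).
Proof. by rewrite /digits -(addn1 k) iotaD map_cat cats1 add1n addn1. Qed.

Lemma cfq2E (a : R) k : cfq2 a k = wden (digits a k).
Proof. by elim: k => // k IH; rewrite digitsS wden_rcons -IH. Qed.

Lemma cfqE (a : R) k : cfq a k = (wden (digits a k)).2.
Proof. by rewrite /cfq cfq2E. Qed.

Lemma cfq_prevE (a : R) k : cfq_prev a k = (wden (digits a k)).1.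
Proof. by rewrite /cfq_prev cfq2E. Qed.

Lemma cfq_prevS (a : R) k : cfq_prev a k.+1 = cfq a k.
Proof. by []. Qed.

Lemma cfqS (a : R) k : cfq a k.+1 = (cfa a k.+1 * cfq a k + cfq_prev a k)%N.
Proof. by []. Qed.

Lemma cfword_rcons w c x : cfword (rcons w c) x = cfword w (c%:R + x^-1).
Proof. by rewrite /cfword foldr_rcons. Qed.

Lemma wden_le w : all (leq 1) w -> ((wden w).1 <= (wden w).2)%N /\ (0 < (wden w).2)%N.
Proof.
elim/last_ind: w => // w c IH; rewrite all_rcons => /andP[c0 /IH[h1 h2]].
rewrite wden_rcons /=; split; nia.
Qed.

(** Appending a digit multiplies the matrix of two consecutive convergents by a matrix of
    determinant -1. *)
Lemma wdet w : ((wnum w).2%:R * (wden w).1%:R - (wnum w).1%:R * (wden w).2%:R : R)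
  = (-1) ^+ (size w).+1.
Proof.
elim/last_ind: w => [|w c IH]; first by rewrite /= mul0r mul1r sub0r.
rewrite size_rcons exprS -IH wnum_rcons wden_rcons /= !natrD !natrM; ring.
Qed.

Lemma cfwordE w x : all (leq 1) w -> 0 < x ->
  cfword w x = ((wnum w).2%:R * x + (wnum w).1%:R) / ((wden w).2%:R * x + (wden w).1%:R).
Proof.
elim/last_ind: w x => [|w c IH] x.
  by move=> _ x0; rewrite /cfword /= mul0r add0r mul1r addr0 mul1r.
rewrite all_rcons => /andP[c0 w0] x0; rewrite cfword_rcons IH//; last first.
  by rewrite ltr_wpDl ?invr_gt0 ?ler0n.
have [_ q0] := wden_le w0.
have q0' : 0 < (wden w).2%:R :> R by rewrite ltr0n.
have q1 : 0 <= (wden w).1%:R :> R by rewrite ler0n.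
have c0' : 0 < c%:R :> R by rewrite ltr0n.
rewrite wnum_rcons wden_rcons /= !natrD !natrM; field.
rewrite (gt_eqF x0) /=.
have cq : 0 <= c%:R * (wden w).2%:R :> R by rewrite mulr_ge0 ?ler0n.
have := mulr_ge0 (addr_ge0 cq q1) (ltW x0).
by rewrite andbT => h; rewrite lt0r_neq0// ltr_wpDl.
Qed.

Lemma cfx_irr al k : irr al -> irr (cfx al k).
Proof. by move=> ial; elim: k => //= k IH; exact/irr_inv/irr_frac. Qed.

Lemma cfx_gt1 al k : irr al -> 1 < cfx al k.+1.
Proof.
move=> ial /=; have ix := @cfx_irr al k ial.
by rewrite invf_gt1 ?irr_frac_gt0// frac_lt1.
Qed.

Lemma cfaE al k : irr al -> cfx al k.+1 = (cfa al k.+1)%:R + frac (cfx al k.+1).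
Proof.
move=> ial; have x1 := @cfx_gt1 al k ial.
rewrite {1}(floorE (cfx al k.+1)); congr (_ + _); rewrite /cfa.
have : 0 <= Num.floor (cfx al k.+1) by rewrite floor_ge0; lra.
by case: (Num.floor _).
Qed.

Lemma cfa_gt0 al k : irr al -> (0 < cfa al k.+1)%N.
Proof.
move=> ial; have := @cfaE al k ial; have := @cfx_gt1 al k ial.
have := frac_lt1 (cfx al k.+1); case: (cfa _ _) => // ; rewrite mulr0n; lra.
Qed.

Lemma digits_gt0 al k : irr al -> all (leq 1) (digits al k).
Proof.
move=> ial; elim: k => // k IH; rewrite digitsS all_rcons IH andbT.
exact: cfa_gt0.
Qed.

Lemma cfwordK al k : irr al -> 0 <= al < 1 ->
  cfword (digits al k) (cfx al k.+1) = al.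
Proof.
move=> ial al01; elim: k => [|k IH].
  by rewrite /cfword /= invrK (@frac_eq 0 al al) ?add0r.
rewrite digitsS cfword_rcons -[RHS]IH; congr cfword.
by rewrite [RHS]cfaE//; congr (_ + _) => /=; rewrite invrK.
Qed.

(** The last digit is absorbed into the complete quotient [c + x^-1], whose floor and fractional
    part give it back. With [cfwordK] this parametrizes the irrationals with first digits [w] by
    their next complete quotient. *)
Lemma digits_cfword w x : all (leq 1) w -> 1 < x -> irr x ->
  [/\ 0 <= cfword w x < 1, irr (cfword w x), digits (cfword w x) (size w) = w
   & cfx (cfword w x) (size w).+1 = x].
Proof.
elim/last_ind: w x => [|w c IH] x.
  move=> _ x1 ix; have x0 : 0 < x by lra.
  split=> //; rewrite /cfword /=.
  - by rewrite invr_ge0 ltW//= invf_lt1.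
  - exact: irr_inv.
  - by rewrite irr_frac_inv// invrK.
rewrite all_rcons => /andP[c0 w0] x1 ix; rewrite cfword_rcons size_rcons.
have c1 : 1 <= c%:R :> R by rewrite ler1n.
have x0 : 0 < x^-1 by rewrite invr_gt0; lra.
have xi1 : x^-1 < 1 by rewrite invf_lt1; lra.
have iy : irr (c%:R + x^-1) by apply: (@irr_addz c); exact: irr_inv.
have [|h1 h2 h3 h4] := IH _ w0 _ iy; first by lra.
have fy : frac (c%:R + x^-1) = x^-1.
  by apply: (@frac_eq c) => //; rewrite ltW.
split => //.
- rewrite digitsS h3; congr rcons; rewrite /cfa h4.
  have <- : (c : int) = Num.floor (c%:R + x^-1); last by [].
  by apply/esym/floor_def; rewrite intrD1 /= ltrD2l xi1 lerDl ltW.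
- by move: h4 => /= ->; rewrite fy invrK.
Qed.

(** The bound [s] on the next complete quotient lets one formula measure both the cylinder of [w]
    ([s = 1]) and its part where the next digit is at least [s]. *)
Definition cylinder w (s : nat) : set R :=
  [set al | [/\ 0 <= al < 1, irr al, digits al (size w) = w
              & s%:R <= cfx al (size w).+1]].

(** The relation al = (p x + p') / (q x + q') has determinant [e] and inverts to x = - (q' al - p')
    / (q al - p). Thus x > s turns into two linear inequalities in [al], oriented by the sign [e];
    irrationality excludes x = s. *)
Lemma cylinderP w s al : all (leq 1) w -> (0 < s)%N ->
  let e := (-1) ^+ (size w).+1 in
  let p := (wnum w).2%:R in let p' := (wnum w).1%:R in
  let q := (wden w).2%:R in let q' := (wden w).1%:R in
  cylinder w s al <-> [/\ irr al, e * (q * al - p) < 0 &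
     0 < e * ((q * s%:R + q') * al - (p * s%:R + p'))].
Proof.
move=> w0 s0 e p p' q q'.
have [_ q0] := wden_le w0.
have qgt0 : 0 < q by rewrite /q ltr0n.
have q'ge0 : 0 <= q' by rewrite /q' ler0n.
have s1 : 1 <= s%:R :> R by rewrite ler1n.
have det : p * q' - p' * q = e := wdet w.
have e2 : e * e = 1 by rewrite /e -expr2 sqrr_sign.
split=> [[al01 ial dal sx]|[ial hX hY]].
  set x := cfx al (size w).+1 in sx.
  have x1 : 1 < x by apply: cfx_gt1.
  have sx' : s%:R < x by rewrite lt_neqAle sx andbT eq_sym irr_neq_nat//; exact: cfx_irr.
  have D0 : 0 < q * x + q' by rewrite ltr_pwDl// mulr_gt0//; lra.
  have alE : al * (q * x + q') = p * x + p'.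
    have := @cfwordK al (size w) ial al01; rewrite dal cfwordE//; last by rewrite -/x; lra.
    by move=> {1}<-; rewrite -mulrA mulVf ?mulr1// gt_eqF.
  split=> //.
  - rewrite -(pmulr_llt0 _ D0).
    have -> : e * (q * al - p) * (q * x + q') = - (e * (p * q' - p' * q)).
      have -> : e * (q * al - p) * (q * x + q') = e * (q * (al * (q * x + q')) - p * (q * x + q')) by ring.
      by rewrite alE; ring.
    by rewrite det e2; lra.
  - rewrite -(pmulr_lgt0 _ D0).
    have -> : e * ((q * s%:R + q') * al - (p * s%:R + p')) * (q * x + q')
       = e * (p * q' - p' * q) * (x - s%:R).
      transitivity (e * ((q * s%:R + q') * (al * (q * x + q')) - (p * s%:R + p') * (q * x + q'))); first by ring.
      by rewrite alE; ring.
    by rewrite det e2; lra.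
pose X := q * al - p.
have X0 : X != 0 by apply: contraTneq hX => hX; rewrite -/X hX mulr0 ltxx.
have Xinv : X^-1 = e * (e * X)^-1.
  by rewrite invfM mulrA divff ?mul1r// /e signr_eq0.
have iX : (e * X)^-1 < 0 by rewrite invr_lt0.
pose x := - (q' * al - p') / X.
have xX : x * X = - (q' * al - p') by rewrite /x divfK.
have eX : e / X * X = e by rewrite divfK.
have DE : q * x + q' = - (e / X).
  apply: (mulIf X0); rewrite mulNr eX -det.
  transitivity (q * (x * X) + q' * X); first by ring.
  by rewrite xX /X; ring.
have alE : al = (p * x + p') / (q * x + q').
  have D0 : q * x + q' != 0.
    by rewrite DE oppr_eq0 mulf_eq0 invr_eq0 negb_or X0 signr_eq0.
  apply: (mulIf D0); rewrite divfK// DE.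
  apply: (mulIf X0); transitivity (- (e / X * X) * al); first by ring.
  transitivity (p * (x * X) + p' * X); last by ring.
  by rewrite eX xX -det /X; ring.
have xs : s%:R < x.
  rewrite -subr_gt0.
  have -> : x - s%:R = - ((e * ((q * s%:R + q') * al - (p * s%:R + p'))) * (e * X)^-1).
    apply: (mulIf X0).
    have h : (e * X)^-1 * X = e.
      have e0 : e != 0 by rewrite /e signr_eq0.
      by rewrite invfM -mulrA mulVf// mulr1; apply: (mulIf e0); rewrite mulVf.
    rewrite mulNr -(mulrA _ _ X) h mulrAC e2 mul1r.
    transitivity (x * X - s%:R * X); first by ring.
    by rewrite xX /X; ring.
  by rewrite oppr_gt0 pmulr_rlt0.
have ix : irr x.
  move=> [r _ rx]; apply: ial.
  exists (((wnum w).2%:R * r + (wnum w).1%:R) / ((wden w).2%:R * r + (wden w).1%:R)) => //.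
  by rewrite alE fmorph_div/= !rmorphD/= !rmorphM/= !ratr_nat rx.
have x1 : 1 < x by lra.
have [h1 h2 h3 h4] := digits_cfword w0 x1 ix.
have alE2 : cfword w x = al by rewrite cfwordE//; lra.
by rewrite alE2 in h1 h2 h3 h4; split=> //; rewrite h4 ltW.
Qed.

End ContinuedFractions.

Section Cylinders.
Variable R : realType.
Local Notation irr := (@irrational R).
Local Notation frac := (@Pilot.Defs.frac R).
Local Notation mu := (@lebesgue_measure R).
Implicit Types (al x y : R) (w : seq nat) (A B : set R).

Lemma countable_rational : countable (@rational R).
Proof. exact/(card_le_trans (card_image_le _ _))/countableP. Qed.

Lemma measurable_irr : measurable irr.
Proof.
apply: measurableC; apply: countable_measurable; first exact: measurable_set1.
exact: countable_rational.
Qed.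

Lemma measure_irr_itv (a b : R) : a <= b -> mu (irr `&` `]a, b[) = (b - a)%:E.
Proof.
move=> ab.
have mi : measurable (`]a, b[%classic : set R) by exact: measurable_itv.
have mr : measurable (@rational R).
  by rewrite -[rational]setCK; apply: measurableC; exact: measurable_irr.
have : mu `]a, b[ = (b - a)%:E.
  rewrite lebesgue_measure_itv/= lte_fin; case: ltgtP ab => // -> _.
  by rewrite subrr.
move=> <-; rewrite (@measureDI _ _ _ mu `]a, b[%classic rational)// setDE setIC.
rewrite [X in (_ + X)%E](_ : _ = 0%E) ?adde0//.
apply/eqP; rewrite eq_le measure_ge0 andbT.
rewrite -(countable_lebesgue_measure0 countable_rational).
by apply: le_measure; rewrite ?inE//; exact: measurableI.
Qed.

(** The endpoints are the values of the Moebius map at x = s and at x = infinity; the sign [e]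
    decides which of them is on the left. *)
Lemma cylinder_itv w s : all (leq 1) w -> (0 < s)%N ->
  exists a b : R, [/\ a <= b, cylinder w s = irr `&` `]a, b[ &
   b - a = ((wden w).2%:R * ((wden w).2%:R * s%:R + (wden w).1%:R))^-1].
Proof.
move=> w0 s0; have [_ q0] := wden_le w0.
have H al := @cylinderP R w s al w0 s0; move: H => /=.
have := wdet R w; set e := (-1) ^+ (size w).+1.
set p := (wnum w).2%:R; set p' := (wnum w).1%:R.
set q := (wden w).2%:R; set q' := (wden w).1%:R => det H.
have qgt0 : 0 < q by rewrite /q ltr0n.
have q'ge0 : 0 <= q' by rewrite /q' ler0n.
have s1 : 1 <= s%:R :> R by rewrite ler1n.
have d0 : 0 < q * s%:R + q' by rewrite ltr_pwDl// mulr_gt0//; lra.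
have dE : (p * s%:R + p') / (q * s%:R + q') - p / q = - e / (q * (q * s%:R + q')).
  by rewrite -det; field; rewrite !gt_eqF.
have i0 : 0 < (q * (q * s%:R + q'))^-1 by rewrite invr_gt0 mulr_gt0.
have [e1|e1] : e = 1 \/ e = -1.
  by rewrite /e -signr_odd; case: odd; [right|left].
- exists ((p * s%:R + p') / (q * s%:R + q')), (p / q); split.
  + by move: dE; rewrite e1 mulN1r; lra.
  + apply/seteqP; split=> al /=; rewrite H e1 !mul1r ?in_itv/=.
      by move=> [h1 h2 h3]; split=> //; rewrite ltr_pdivrMr// ltr_pdivlMr//; lra.
    by move=> [h1]; rewrite ltr_pdivrMr// ltr_pdivlMr// => /andP[h2 h3]; split=> //; lra.
  + by move: dE; rewrite e1 mulN1r; lra.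
- exists (p / q), ((p * s%:R + p') / (q * s%:R + q')); split.
  + by move: dE; rewrite e1 opprK mul1r; lra.
  + apply/seteqP; split=> al /=; rewrite H e1 !mulN1r ?in_itv/=.
      by move=> [h1 h2 h3]; split=> //; rewrite ltr_pdivrMr// ltr_pdivlMr//; lra.
    by move=> [h1]; rewrite ltr_pdivrMr// ltr_pdivlMr// => /andP[h2 h3]; split=> //; lra.
  + by move: dE; rewrite e1 opprK mul1r; lra.
Qed.

Lemma measurable_cylinder w s : all (leq 1) w -> (0 < s)%N -> measurable (@cylinder R w s).
Proof.
move=> w0 s0; have [a [b [_ -> _]]] := cylinder_itv w0 s0.
by apply: measurableI; [exact: measurable_irr|exact: measurable_itv].
Qed.

Definition cylinder_size w s : R :=
  ((wden w).2%:R * ((wden w).2%:R * s%:R + (wden w).1%:R))^-1.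

Lemma cylinder_measure w s : all (leq 1) w -> (0 < s)%N ->
  mu (cylinder w s) = (cylinder_size w s)%:E.
Proof.
move=> w0 s0; have [a [b [ab -> abE]]] := cylinder_itv w0 s0.
by rewrite measure_irr_itv// abE.
Qed.

Lemma cylinder_size_ge0 w s : 0 <= cylinder_size w s.
Proof. by rewrite invr_ge0 mulr_ge0 ?addr_ge0 ?mulr_ge0. Qed.

(** Together with [cylinder_size_ge]: given any first digits, the next one is at least [s] with
    conditional probability between 1/s and 2/s. This uniformity in [w] replaces independence of the
    digits. *)
Lemma cylinder_size_le w s : all (leq 1) w -> (0 < s)%N ->
  cylinder_size w s <= 2 / s%:R * cylinder_size w 1.
Proof.
move=> w0 s0; have [q1 q0] := wden_le w0; rewrite /cylinder_size mulr1.
have qgt0 : 1 <= (wden w).2%:R :> R by rewrite ler1n.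
have q'ge0 : 0 <= (wden w).1%:R :> R by rewrite ler0n.
have q'le : (wden w).1%:R <= (wden w).2%:R :> R by rewrite ler_nat.
have s1 : 1 <= s%:R :> R by rewrite ler1n.
move: qgt0 q'ge0 q'le s1.
move: (_.2%:R) (_.1%:R) (s%:R) => q q' t ? ? ? ?.
rewrite -(invf_div t) -invfM lef_pV2 ?posrE.
- have : 0 <= t * (q * (q - q')) by rewrite !mulr_ge0//; lra.
  have : 0 <= q * q' by nra.
  nra.
- by apply: mulr_gt0; nra.
- by apply: mulr_gt0; nra.
Qed.

Lemma cylinder_size_ge w s : all (leq 1) w -> (0 < s)%N ->
  s%:R^-1 * cylinder_size w 1 <= cylinder_size w s.
Proof.
move=> w0 s0; have [q1 q0] := wden_le w0; rewrite /cylinder_size mulr1.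
have qgt0 : 1 <= (wden w).2%:R :> R by rewrite ler1n.
have q'ge0 : 0 <= (wden w).1%:R :> R by rewrite ler0n.
have s1 : 1 <= s%:R :> R by rewrite ler1n.
move: qgt0 q'ge0 s1.
move: (_.2%:R) (_.1%:R) (s%:R) => q q' t ? ? ?.
have h1 : 0 < q * (q + q') by nra.
have h2 : 0 < q * (q * t + q') by nra.
rewrite -invfM lef_pV2 ?posrE//; last by apply: mulr_gt0; lra.
have : 0 <= (t - 1) * (q * q') by rewrite !mulr_ge0//; lra.
nra.
Qed.

(** The price of prescribing one digit [j] depends on [j] only. The digits prescribed later are
    bounded in terms of [v], so they cost a constant factor. *)
Lemma cylinder_size_rcons w j : all (leq 1) w -> (0 < j)%N ->
  ((j.+1)%:R * (j.+2)%:R)^-1 * cylinder_size w 1 <= cylinder_size (rcons w j) 1.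
Proof.
move=> w0 s0; have [q1 q0] := wden_le w0; rewrite /cylinder_size !mulr1.
rewrite wden_rcons /= natrD natrM -addn2 -[j.+1]addn1 !natrD.
have qgt0 : 1 <= (wden w).2%:R :> R by rewrite ler1n.
have q'ge0 : 0 <= (wden w).1%:R :> R by rewrite ler0n.
have q'le : (wden w).1%:R <= (wden w).2%:R :> R by rewrite ler_nat.
have s1 : 1 <= j%:R :> R by rewrite ler1n.
move: qgt0 q'ge0 q'le s1.
move: (_.2%:R) (_.1%:R) (j%:R) => q q' t ? ? ? ?.
have h1 : 0 < q * (q + q') by nra.
have h0 : 0 < t * q + q' by nra.
have h2 : 0 < (t * q + q') * (t * q + q' + q) by nra.
have h3 : 0 < (t + 1) * (t + 2) by nra.
rewrite -invfM lef_pV2 ?posrE//; last exact: mulr_gt0.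
have h4 : (t * q + q') * (t * q + q' + q) <= ((t + 1) * q) * ((t + 2) * q).
  by apply: ler_pM; nra.
apply: le_trans h4 _; rewrite -subr_ge0.
have -> : (t + 1) * (t + 2) * (q * (q + q')) - (t + 1) * q * ((t + 2) * q) =
  (t + 1) * (t + 2) * (q * q') by ring.
by apply: mulr_ge0; nra.
Qed.

Definition digit_event k (W : set (seq nat)) : set R :=
  [set al | [/\ 0 <= al < 1, irr al & W (digits al k)]].

Lemma digit_event1 k w : digit_event k [set w] =
  if all (leq 1) w && (size w == k) then cylinder w 1 else set0.
Proof.
apply/seteqP; split=> al.
  move=> [al01 ial /= dw]; rewrite -dw digits_gt0// size_digits eqxx /=.
  by split; rewrite ?size_digits//; apply/ltW/cfx_gt1.
case: ifPn => // /andP[w0 /eqP wk] [al01 ial dw _]; split => //=.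
by rewrite -wk.
Qed.

Lemma measurable_digit_event k W : measurable (digit_event k W).
Proof.
have -> : digit_event k W = \bigcup_w digit_event k ([set w] `&` W).
  apply/seteqP; split=> al; first by move=> [? ? ?]; exists (digits al k).
  by move=> [w _ [? ? /= [dw Ww]]]; split=> //; rewrite dw.
apply: countable_bigcupT_measurable => [|w]; first exact: countableP.
have [Ww|nWw] := pselect (W w).
  rewrite (_ : _ `&` _ = [set w]); last by apply/setIidl => _ ->.
  rewrite digit_event1; case: ifP => // /andP[w0 _].
  exact: measurable_cylinder.
rewrite (_ : digit_event _ _ = set0)//.
by apply/seteqP; split=> al // [_ _ [/= dw Ww]]; apply: nWw; rewrite -dw.
Qed.

(* summing over the fibers of [digits _ k], which are cylinders *)
Lemma digit_event_le k W A B (c : R) : 0 <= c ->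
  measurable A -> measurable B -> A `<=` digit_event k W ->
  (forall w, W w -> all (leq 1) w -> size w = k ->
     (mu (A `&` cylinder w 1) <= c%:E * mu (B `&` cylinder w 1))%E) ->
  (mu A <= c%:E * mu B)%E.
Proof.
move=> c0 mA mB AW H.
(* Words are enumerated by their codes; the test [pickle w == n] keeps only the canonical code of
   each word, which makes the sets disjoint. *)
pose F (n : nat) : set R := if (unpickle n : option (seq nat)) is Some w then
  (if pickle w == n then digit_event k [set w] else set0) else set0.
have mF n : measurable (F n).
  by rewrite /F; case: unpickle => // w; case: ifP => // _; exact: measurable_digit_event.
have tF : trivIset setT F.
  have K n al : F n al -> n = pickle (digits al k).
    by rewrite /F; case: unpickle => [w|] //; case: ifP => [/eqP <- [_ _ /= ->]|_ []].
  by move=> i j _ _ [al [/K -> /K ->]].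
have E X : measurable X -> X `<=` digit_event k setT -> mu X = (\sum_(0 <= n <oo) mu (X `&` F n))%E.
  move=> mX XW; rewrite {1}(_ : X = \bigcup_n (X `&` F n)).
    rewrite measure_bigcup; [|move=> n _; apply: measurableI; [exact: mX|exact: mF]|exact: trivIset_setIl].
    by apply: eq_eseriesl => n; rewrite in_setT.
  apply/seteqP; split=> [al Xal|al [n _ []]//].
  have [al01 ial _] := XW _ Xal.
  exists (pickle (digits al k)) => //; split=> //.
  by rewrite /F pickleK eqxx.
have BF n : (mu (A `&` F n) <= c%:E * mu (B `&` digit_event k setT `&` F n))%E.
  rewrite /F; case: unpickle => [w|]; last by rewrite !setI0 measure0 mule0.
  case: ifP => [_|]; last by rewrite !setI0 measure0 mule0.
  rewrite digit_event1; case: ifPn => [/andP[w0 /eqP wk]|]; last by rewrite !setI0 measure0 mule0.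
  have [Ww|nWw] := pselect (W w); last first.
    rewrite (_ : A `&` _ = set0) ?measure0; first by apply: mule_ge0; rewrite ?lee_fin.
    apply/seteqP; split=> al // [/AW[_ _ Wal]] [_ _ dal _].
    by apply: nWw; rewrite -dal wk.
  rewrite -setIA (_ : digit_event k setT `&` cylinder w 1 = cylinder w 1); first exact: H.
  by apply/setIidr => al [? ? ? ?]; split.
have mD := @measurable_digit_event k setT.
have mBD : measurable (B `&` digit_event k setT) by exact: measurableI.
rewrite (E A)//; last by move=> al /AW[].
apply: (@le_trans _ _ (c%:E * mu (B `&` digit_event k setT))%E); last first.
  by apply: lee_pmul => //; rewrite ?lee_fin//; apply: le_measure; rewrite ?inE//.
rewrite (E (B `&` _))//.
rewrite -nneseriesZl//.
by apply: lee_nneseries => // n _; exact: BF.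
Qed.

End Cylinders.

(** * Good indices of almost every number *)

Lemma coprime_wden w : coprime (wden w).1 (wden w).2.
Proof.
elim/last_ind: w => // w c; rewrite wden_rcons /= => h.
by rewrite /coprime gcdnMDl gcdnC.
Qed.

(* The first digit makes the next denominator prime to [v], the second then kills it mod [v]. *)
Lemma two_digits_dvd (v q' q : nat) : (0 < v)%N -> coprime q' q ->
  exists j1 j2 : nat, [/\ (0 < j1 <= v)%N, (0 < j2 <= 2 * v)%N &
    (v %| j2 * (j1 * q + q') + q)%N].
Proof.
move=> v0 cop.
have [j1 [/andP[j10 j1v] cv]] : exists j1, (0 < j1 <= v)%N /\ coprime v (j1 * q + q').
  have [q'0|q'0] := posnP q'.
    exists 1%N; rewrite v0; split => //; move: cop.
    by rewrite q'0 /coprime gcd0n mul1n addn0 => /eqP ->; rewrite gcdn1.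
  (* The part of [v] prime to q': each prime factor of [v] divides exactly one of q' and [j1]. If it
     divides q', it divides neither [j1] nor [q], as q' and [q] are coprime. In both cases it does
     not divide [j1 * q + q']. *)
  exists (v`_(\pi(q')^'))%N; rewrite part_gt0/= dvdn_leq ?dvdn_part//; split => //.
  set J := (v`_(\pi(q')^'))%N.
  apply/eqP; apply/eqP; rewrite -[_ == _]negbK; apply/negP => g1.
  have g0 : (0 < gcdn v (J * q + q'))%N by rewrite gcdn_gt0 v0.
  have pp : prime (pdiv (gcdn v (J * q + q'))) by apply: pdiv_prime; lia.
  have := pdiv_dvd (gcdn v (J * q + q')).
  move: (pdiv _) pp => p pp; rewrite dvdn_gcd => /andP[pv].
  have [pq'|pq'] := boolP (p %| q')%N.
    rewrite dvdn_addl// Euclid_dvdM// => /orP[pj|pq].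
      have /(pnatP _ (part_gt0 _ _)) /(_ p pp pj) := part_pnat (\pi(q')^')%N v.
      by rewrite inE /= mem_primes pp q'0 pq'.
    have : (p %| gcdn q' q)%N by rewrite dvdn_gcd pq' pq.
    by move: cop => /eqP ->; rewrite dvdn1 => /eqP p1; rewrite p1 in pp.
  have : (p %| J)%N.
    move: pv; rewrite -{1}(partnC (\pi(q')) v0) Euclid_dvdM// => /orP[pj|//].
    have /(pnatP _ (part_gt0 _ _)) /(_ p pp pj) := part_pnat (\pi(q')) v.
    by rewrite mem_primes => /and3P[_ _ h]; rewrite h in pq'.
  by move=> h; rewrite dvdn_addr ?dvdn_mulr// (negbTE pq').
(* Since [v] divides 1 + a (j1 q + q'), every digit congruent to a q modulo [v] works; adding [v] to
   the remainder makes it positive. *)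
have [a av ha] := Bezoutl (j1 * q + q') v0.
exists j1, ((a * q) %% v + v)%N; split; first by rewrite j10.
  by have := ltn_pmod (a * q) v0; lia.
rewrite mulnDl -addnA addnCA dvdn_addr ?dvdn_mulr//.
rewrite /dvdn -modnDml modnMml modnDml -/(dvdn _ _).
rewrite (_ : _ + _ = q * (1 + a * (j1 * q + q')))%N; last by lia.
by move: ha; rewrite (eqP cv) => ha; rewrite dvdn_mull.
Qed.

(** An explicit form of polynomial against exponential growth, obtained by raising n <= a 2^(n/a) to
    the power [a]. *)
Lemma expn_le_exp2 (a n : nat) : (0 < a)%N -> (n ^ a <= a ^ a * 2 ^ n)%N.
Proof.
move=> a0; have h : (n <= a * 2 ^ (n %/ a))%N.
  have h1 := ltn_expl (n %/ a) (isT : (1 < 2)%N).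
  by rewrite {1}(divn_eq n a); have := ltn_pmod n a0; nia.
apply: (@leq_trans ((a * 2 ^ (n %/ a)) ^ a)); first by rewrite leq_exp2r.
by rewrite expnMn leq_mul2l -expnM leq_exp2l// leq_trunc_div orbT.
Qed.

(** * Tail estimates for digits and for their sums *)

Section DigitSums.
Variable R : realType.
Local Notation irr := (@irrational R).
Local Notation mu := (@lebesgue_measure R).
Implicit Types (al x y : R) (w : seq nat) (A B : set R).

Lemma leq_cfa al k T : irr al -> (T <= cfa al k.+1)%N = (T%:R <= cfx al k.+1).
Proof.
move=> ial; rewrite (@cfaE _ al k ial).
have := frac_lt1 (cfx al k.+1); have := frac_ge0 (cfx al k.+1).
move: (Pilot.Defs.frac _) => f f0 f1.
apply/idP/idP; first by rewrite -(ler_nat R); lra.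
by move=> h; rewrite -ltnS -(ltr_nat R) -[(cfa _ _).+1]addn1 natrD; lra.
Qed.

Lemma digit_eventT_le1 k : (mu (digit_event k setT) <= 1)%E.
Proof.
have <- : mu (`[0, 1[%classic : set R) = 1%E.
  by rewrite lebesgue_measure_itv/= lte_fin ltr01 oppr0 adde0.
apply: le_measure; rewrite ?inE; [exact: measurable_digit_event|exact: measurable_itv|].
by move=> al [h _ _] /=; rewrite in_itv.
Qed.

Lemma measure_cfa_ge k T : (0 < T)%N ->
  (mu (digit_event k.+1 [set w | (T <= last 0%N w)%N]) <= (2 / T%:R)%:E)%E.
Proof.
move=> T0; have c0 : 0 <= 2 / T%:R :> R by rewrite divr_ge0.
apply: (@le_trans _ _ ((2 / T%:R)%:E * mu (digit_event k setT))%E); last first.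
  by rewrite -[leRHS]mule1 lee_pmul2l ?lte_fin ?fin_numE// ?digit_eventT_le1// divr_gt0// ltr0n.
apply: (@digit_event_le _ k setT) => //.
- exact: measurable_digit_event.
- exact: measurable_digit_event.
- by move=> al [? ? _].
move=> w _ w0 wk.
rewrite (_ : _ `&` cylinder w 1 = cylinder w T); last first.
  apply/seteqP; split=> al.
    by move=> [[al01 ial]]; rewrite /mkset digitsS last_rcons => h [_ _ dw _]; split=> //; rewrite wk -leq_cfa.
  move=> [al01 ial dw]; rewrite wk -leq_cfa// => h; split; split => //.
    by rewrite digitsS /= last_rcons.
  by rewrite wk; apply/ltW/cfx_gt1.
rewrite (_ : _ `&` cylinder w 1 = cylinder w 1); last by apply/setIidr => al [].
by rewrite !cylinder_measure// -EFinM lee_fin cylinder_size_le.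
Qed.

(** Markov's inequality for the number of events [E i] that occur. *)
Lemma sum_indic_markov (I : Type) (s : seq I) (E : I -> set R) (l : R) (Z : set R) :
  0 <= l -> (forall i, measurable (E i)) -> measurable Z ->
  (forall x, Z x -> l <= \sum_(i <- s) \1_(E i) x) ->
  (l%:E * mu Z <= \sum_(i <- s) mu (E i))%E.
Proof.
move=> l0 mE mZ H.
have -> : (\sum_(i <- s) mu (E i) = \int[mu]_(x in setT) (\sum_(i <- s) (\1_(E i) x)%:E))%E.
  rewrite ge0_integral_sum//.
    by apply: eq_bigr => i _; rewrite integral_indic ?setIT//; exact: mE.
  by move=> i; apply/measurable_EFinP/measurable_indic; exact: mE.
have mS : measurable_fun (setT : set R) (fun x => \sum_(i <- s) (\1_(E i) x : R)%:E)%E.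
  by apply: emeasurable_sum => i; apply/measurable_EFinP/measurable_indic; exact: mE.
have S0 x : (0 <= \sum_(i <- s) (\1_(E i) x : R)%:E)%E by apply: sume_ge0 => i _; rewrite lee_fin.
rewrite -(integral_cst mu mZ).
apply: (@le_trans _ _ (\int[mu]_(x in Z) (\sum_(i <- s) (\1_(E i) x)%:E))%E).
  apply: ge0_le_integral => //.
  - exact: measurable_funTS.
  - by move=> x Zx; rewrite /= sumEFin lee_fin; exact: H.
by apply: ge0_subset_integral => //; exact: measurableT.
Qed.

Lemma harmonic_sum_le (M : nat) : (0 < M)%N ->
  \sum_(0 <= j < M) (j.+1%:R)^-1 <= 1 + ln M%:R :> R.
Proof.
elim: M => // -[|M] IH _; first by rewrite big_nat1 invr1 ln1 addr0.
rewrite big_nat_recr//=.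
suff h : (M.+2%:R)^-1 <= ln M.+2%:R - ln M.+1%:R :> R.
  by apply: (le_trans (lerD (IH isT) h)); rewrite addrCA addrK addrC.
have p1 : 0 < M.+1%:R :> R by rewrite ltr0n.
have p2 : 0 < M.+2%:R :> R by rewrite ltr0n.
have i1 : (M.+2%:R)^-1 < 1 :> R by rewrite invf_lt1// ltr1n.
have h : -1 < - (M.+2%:R)^-1 :> R by rewrite ltrN2.
have := le_ln1Dx h.
have -> : 1 + - (M.+2%:R)^-1 = M.+1%:R / M.+2%:R :> R.
  by move: p2; rewrite -[M.+2]addn1 natrD => p2; field; rewrite gt_eqF.
by rewrite ln_div ?posrE// -lerN2 opprK opprB.
Qed.

Lemma sumn_digits al k (f : nat -> nat) :
  sumn (map f (digits al k)) = (\sum_(0 <= i < k) f (cfa al i.+1))%N.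
Proof.
elim: k => [|k IH]; first by rewrite big_geq.
by rewrite digitsS map_rcons sumn_rcons IH big_nat_recr.
Qed.

Definition ge_event i j := digit_event (R := R) i.+1 [set w | (j <= last 0%N w)%N].

Lemma ge_event_indic al i j : 0 <= al < 1 -> irr al ->
  \1_(ge_event i j) al = (j <= cfa al i.+1)%N%:R :> R.
Proof.
move=> al01 ial; rewrite indicE; congr (_%:R); congr nat_of_bool.
apply/idP/idP; rewrite inE /ge_event /digit_event /mkset digitsS last_rcons; first by case.
by [].
Qed.

Lemma sum_minn (M a : nat) : (\sum_(0 <= j < M) (j.+1 <= a) = minn M a)%N.
Proof.
elim: M => [|M IH]; first by rewrite big_geq// min0n.
by rewrite big_nat_recr//= IH; case: leqP => /=; lia.
Qed.

(** As digits have infinite mean, they are cut off at [M]. The first term bounds the probability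
    that some digit reaches [M]; the second is Markov's inequality for the truncated sum, since the
    mean of min(M, a) is the sum of P(a >= j) over j <= M, at most 2 (1 + ln M). *)
Lemma digit_sum_tail k M S : (0 < M)%N -> (0 < S)%N ->
  (mu (digit_event k [set w | (S <= sumn w)%N]) <=
    (k%:R * (2 / M%:R) + k%:R * (2 * (1 + ln M%:R)) / S%:R)%:E)%E.
Proof.
move=> M0 S0.
have S0' : 0 < S%:R :> R by rewrite ltr0n.
pose Z1 : set R := digit_event k [set w | has (leq M) w].
pose Z2 : set R := digit_event k [set w | (S <= sumn (map (minn M) w))%N].
have mZ1 : measurable Z1 by exact: measurable_digit_event.
have mZ2 : measurable Z2 by exact: measurable_digit_event.
apply: (@le_trans _ _ (mu (Z1 `|` Z2))).
  apply: le_measure; rewrite ?inE; [exact: measurable_digit_event|exact: measurableU|].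
  move=> al [al01 ial /= Sw]; have [h|h] := boolP (has (leq M) (digits al k)); first by left.
  right; split => //=; rewrite (_ : map _ _ = digits al k)//.
  rewrite -[RHS]map_id; apply/eq_in_map => a ain; apply/minn_idPr.
  by move: h => /hasPn /(_ _ ain); rewrite -ltnNge => /ltnW.
apply: (@le_trans _ _ (mu Z1 + mu Z2)%E).
  by apply: measureU2; [exact: mZ1|exact: mZ2].
rewrite EFinD; apply: leeD.
- have := @sum_indic_markov nat (index_iota 0 k) (fun i => ge_event i M) 1 Z1.
  rewrite mul1e => /(_ ler01) h; apply: (le_trans (h _ _ _)) => //.
  + by move=> i; exact: measurable_digit_event.
  + move=> al [al01 ial /= /(has_nthP 0%N)[i]]; rewrite size_digits => ik.
    rewrite (nth_map 0%N) ?size_iota// nth_iota// add1n => Mi.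
    rewrite (bigD1_seq i) ?iota_uniq ?mem_index_iota//= ge_event_indic// Mi lerDl.
    by apply: sumr_ge0 => j _; rewrite indicE.
  + apply: (@le_trans _ _ (\sum_(0 <= i < k) (2 / M%:R)%:E)%E).
      by apply: lee_sum => i _; exact: measure_cfa_ge.
    by rewrite sumEFin sumr_const_nat subn0 -[_ *+ k]mulr_natl.
- have := @sum_indic_markov (nat * nat)%type [seq (i, j) | i <- index_iota 0 k, j <- index_iota 0 M]
     (fun ij => ge_event ij.1 ij.2.+1) S%:R Z2 (ltW S0').
  rewrite big_allpairs => h.
  have {}h : (S%:R%:E * mu Z2 <= (k%:R * (2 * (1 + ln M%:R)))%:E)%E.
    apply: (le_trans (h _ _ _)) => //.
    + by move=> i; exact: measurable_digit_event.
    + move=> al [al01 ial /= Sw]; rewrite big_allpairs.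
      apply: (@le_trans _ _ (sumn (map (minn M) (digits al k)))%:R); first by rewrite ler_nat.
      rewrite sumn_digits natr_sum; apply: ler_sum => i _.
      rewrite -sum_minn natr_sum; apply: ler_sum => j _.
      by rewrite ge_event_indic.
    + apply: (@le_trans _ _ (\sum_(0 <= i < k) (2 * (1 + ln M%:R))%:E)%E); last first.
        by rewrite sumEFin sumr_const_nat subn0 -[_ *+ k]mulr_natl.
      apply: lee_sum => i _.
      apply: (@le_trans _ _ (\sum_(0 <= j < M) (2 / j.+1%:R)%:E)%E).
        by apply: lee_sum => j _; exact: measure_cfa_ge.
      rewrite sumEFin lee_fin -mulr_sumr ler_pM2l//; exact: harmonic_sum_le.
  by rewrite EFinM lee_pdivlMr// muleC.
Qed.

End DigitSums.

Section NextDigits.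
Variable R : realType.
Local Notation irr := (@irrational R).
Local Notation mu := (@lebesgue_measure R).
Implicit Types (al x y : R) (w : seq nat) (A B : set R).

Lemma cylinder_size_rcons_le V w j : all (leq 1) w -> (0 < j <= V)%N ->
  cylinder_size R w 1 <= (V.+1 * V.+2)%:R * cylinder_size R (rcons w j) 1.
Proof.
move=> w0 /andP[j0 jV].
have p : 0 < (V.+1 * V.+2)%:R :> R by rewrite ltr0n.
rewrite -ler_pdivrMl//; apply: le_trans (cylinder_size_rcons R w0 j0).
apply: ler_wpM2r; first exact: cylinder_size_ge0.
by rewrite -natrM lef_pV2 ?posrE ?ltr0n// ler_nat leq_mul.
Qed.

(** Conditional on any word of [W], two prescribed digits up to [V] cost a constant factor and a
    digit in [T, 4T) costs 2 T. The prescribed digits may depend on the word, because the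
    denominators do. *)
Lemma digits_next_measure V k (W : set (seq nat)) (j1 j2 : seq nat -> nat) T :
  (forall w, all (leq 1) w -> (0 < j1 w <= V)%N /\ (0 < j2 w <= V)%N) ->
  (0 < T)%N ->
  let B := [set al | digit_event k W al /\
    [/\ cfa al k.+1 = j1 (digits al k), cfa al k.+2 = j2 (digits al k)
      & (T <= cfa al k.+3 < 4 * T)%N]] in
  measurable B /\
  (mu (digit_event k W) <= (2 * T%:R * (V.+1 * V.+2)%:R ^+ 2)%:E * mu B)%E.
Proof.
move=> Hj T0 B.
have T0' : 0 < T%:R :> R by rewrite ltr0n.
have mB : measurable B.
  rewrite (_ : B = digit_event k.+3 [set w | [/\ W (take k w), nth 0%N w k = j1 (take k w),
    nth 0%N w k.+1 = j2 (take k w) & (T <= nth 0%N w k.+2 < 4 * T)%N]]).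
    exact: measurable_digit_event.
  have dE al : [/\ take k (digits al k.+3) = digits al k,
      nth 0%N (digits al k.+3) k = cfa al k.+1,
      nth 0%N (digits al k.+3) k.+1 = cfa al k.+2 &
      nth 0%N (digits al k.+3) k.+2 = cfa al k.+3].
    rewrite !digitsS; split.
    - by rewrite -!cats1 -!catA take_size_cat// size_digits.
    - by rewrite !nth_rcons !size_rcons size_digits ltnn eqxx ltnS ltnW//= ltnS leqnn.
    - by rewrite !nth_rcons !size_rcons size_digits !ltnn eqxx ltnS leqnn.
    - by rewrite !nth_rcons !size_rcons size_digits !ltnn eqxx.
  apply/seteqP; split=> al; have [e1 e2 e3 e4] := dE al; rewrite /B /digit_event /mkset e1 e2 e3 e4.
    by move=> [[h1 h2 h3] [h4 h5 h6]].
  by move=> [h1 h2 [h3 h4 h5 h6]].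
split => //; apply: (@digit_event_le _ k W) => //.
- exact: measurable_digit_event.
move=> w Ww w0 wk.
rewrite (_ : digit_event k W `&` _ = cylinder w 1); last first.
  by apply/setIidr => al [? ? dw _]; split; rewrite //= -wk dw.
have [j10 j20] := Hj w w0.
pose w1 := rcons w (j1 w); pose w2 := rcons w1 (j2 w).
have w10 : all (leq 1) w1 by rewrite all_rcons w0 andbT; lia.
have w20 : all (leq 1) w2 by rewrite all_rcons w10 andbT; lia.
have s1 : size w1 = k.+1 by rewrite size_rcons wk.
have s2 : size w2 = k.+2 by rewrite size_rcons s1.
have T40 : (0 < 4 * T)%N by lia.
have c41 : @cylinder R w2 (4 * T) `<=` cylinder w2 T.
  move=> al [? ? ? h]; split=> //; apply: le_trans h; rewrite ler_nat; lia.
have sub : cylinder w2 T `\` cylinder w2 (4 * T) `<=` B `&` cylinder w 1.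
  move=> al [[al01 ial dal h1] h2].
  have dk : digits al k = w /\ cfa al k.+1 = j1 w /\ cfa al k.+2 = j2 w.
    move: dal; rewrite s2 !digitsS /w2 /w1 => /rcons_inj[/rcons_inj[? ?] ?] //.
  have [d1 [d2 d3]] := dk.
  split.
    split; first by split => //=; rewrite d1.
    rewrite d1; split => //; rewrite s2 in h1; rewrite leq_cfa// h1 /=.
    rewrite ltnNge; apply/negP; rewrite leq_cfa// => h3; apply: h2; split => //.
    by rewrite s2.
  by split; rewrite ?wk//; apply/ltW/cfx_gt1.
have mc1 := @measurable_cylinder R w2 T w20 T0.
have mc4 := @measurable_cylinder R w2 (4 * T) w20 T40.
have mcw := @measurable_cylinder R w 1 w0 isT.
(* The factor 4 leaves a positive share: the digit is at least T with probability at least 1/T, and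
   at least 4T with probability at most 2/(4T), so 1/(2T) remains. *)
have D : ((cylinder_size R w2 1 / (2 * T%:R))%:E <= mu (B `&` cylinder w 1))%E.
  apply: (@le_trans _ _ (mu (cylinder w2 T `\` cylinder w2 (4 * T)))); last first.
    apply: le_measure; rewrite ?inE//; [exact: measurableD|exact: measurableI].
  have : (mu (cylinder w2 T) = mu (cylinder w2 T `\` cylinder w2 (4 * T)) + mu (cylinder w2 (4 * T)))%E.
    by rewrite -[in X in (_ + X)%E](setIidr c41); apply: measureDI; [exact: mc1|exact: mc4].
  rewrite !cylinder_measure//.
  have : (mu (cylinder w2 T `\` cylinder w2 (4 * T)) <= mu (cylinder w2 T))%E.
    by apply: le_measure; rewrite ?inE//; exact: measurableD.
  rewrite cylinder_measure//.
  have := measure_ge0 mu (cylinder w2 T `\` cylinder w2 (4 * T)).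
  case: (mu _) => // r _ _; rewrite -EFinD => -[e]; rewrite lee_fin.
  have h1 := @cylinder_size_ge R w2 T w20 T0.
  have h2 := @cylinder_size_le R w2 (4 * T) w20 T40.
  have c0 := cylinder_size_ge0 R w2 1.
  have <- : (T%:R)^-1 * cylinder_size R w2 1 - 2 / (4 * T)%:R * cylinder_size R w2 1
     = cylinder_size R w2 1 / (2 * T%:R).
    by rewrite natrM; field; rewrite gt_eqF.
  lra.
rewrite cylinder_measure//.
apply: (@le_trans _ _ ((2 * T%:R * (V.+1 * V.+2)%:R ^+ 2)%:E * (cylinder_size R w2 1 / (2 * T%:R))%:E)%E); last first.
  apply: lee_pmul => //.
  by rewrite lee_fin divr_ge0 ?cylinder_size_ge0// mulr_ge0// ltW.
rewrite -EFinM lee_fin.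
have -> : 2 * T%:R * (V.+1 * V.+2)%:R ^+ 2 * (cylinder_size R w2 1 / (2 * T%:R))
  = (V.+1 * V.+2)%:R * ((V.+1 * V.+2)%:R * cylinder_size R w2 1).
  by field; rewrite gt_eqF.
apply: (le_trans (cylinder_size_rcons_le w0 j10)).
by apply: ler_wpM2l => //; exact: cylinder_size_rcons_le.
Qed.

End NextDigits.

(** * Divergence of the sum of 1/(i ln i) and growth of the denominators *)

Section Divergence.
Variable R : realType.
Local Notation irr := (@irrational R).
Local Notation mu := (@lebesgue_measure R).
Implicit Types (al x y : R) (w : seq nat) (A B : set R).

Lemma ln2_ge : 2^-1 <= ln 2 :> R.
Proof.
have h : -1 < - 2^-1 :> R by lra.
have := le_ln1Dx h.
have -> : 1 + - 2^-1 = 2^-1 :> R by lra.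
rewrite lnV ?posrE//; lra.
Qed.

Lemma ln_nat_gt0 n : (1 < n)%N -> 0 < ln n%:R :> R.
Proof. by move=> n1; apply: ln_gt0; rewrite ltr1n. Qed.

Lemma ln_le_id (x : R) : 0 < x -> ln x <= x.
Proof.
move=> x0; have h : -1 < x - 1 by lra.
by have := le_ln1Dx h; rewrite addrC subrK; lra.
Qed.

Lemma nlnn_ge1 n : (1 < n)%N -> 1 <= n%:R * ln n%:R :> R.
Proof.
move=> n1; have n2 : 2 <= n%:R :> R by rewrite ler_nat.
have h : ln 2 <= ln n%:R :> R by rewrite ler_ln ?posrE//; lra.
have := ln2_ge; nra.
Qed.

(** Telescoping ln ln; the shift of the index by 2 keeps the inner logarithm positive. *)
Lemma loglog_unbounded (i0 : nat) (X : R) : exists2 m : nat, (i0 <= m)%N &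
  X <= \sum_(i0 <= i < m) (i.+2%:R * ln i.+2%:R)^-1.
Proof.
pose g (n : nat) : R := ln (ln n.+2%:R).
have step i : g i.+1 - g i <= (i.+2%:R * ln i.+2%:R)^-1.
  have l0 : 0 < ln i.+2%:R :> R by exact: ln_nat_gt0.
  have l1 : 0 < ln i.+3%:R :> R by exact: ln_nat_gt0.
  have n0 : 0 < i.+2%:R :> R by rewrite ltr0n.
  rewrite /g -ln_div ?posrE//.
  have lE : ln i.+3%:R = ln i.+2%:R + ln (1 + (i.+2%:R)^-1) :> R.
    rewrite -lnM ?posrE ?addr_gt0 ?invr_gt0//; congr ln.
    by rewrite mulrDr mulr1 divff ?gt_eqF// natr1.
  have h1 : ln (1 + (i.+2%:R)^-1) <= (i.+2%:R)^-1 :> R.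
    by apply: le_ln1Dx; apply: (@lt_trans _ _ 0); rewrite ?invr_gt0// ltrN10.
  have h2 : ln i.+3%:R / ln i.+2%:R = 1 + ln (1 + (i.+2%:R)^-1) / ln i.+2%:R :> R.
    by rewrite lE mulrDl divff ?gt_eqF.
  have h3 : 0 <= ln (1 + (i.+2%:R)^-1) :> R.
    by apply: ln_ge0; rewrite lerDl invr_ge0 ltW.
  rewrite h2; apply: (@le_trans _ _ (ln (1 + (i.+2%:R)^-1) / ln i.+2%:R)).
    by apply: le_ln1Dx; apply: (@lt_le_trans _ _ 0); rewrite ?ltrN10// divr_ge0// ltW.
  by rewrite invfM ler_wpM2r// invr_ge0 ltW.
have tele m : (i0 <= m)%N -> g m - g i0 <= \sum_(i0 <= i < m) (i.+2%:R * ln i.+2%:R)^-1.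
  elim: m => [|m IH]; first by rewrite leqn0 => /eqP ->; rewrite big_geq// subrr.
  rewrite leq_eqVlt => /orP[/eqP ->|]; first by rewrite big_geq// subrr.
  rewrite ltnS => im; rewrite big_nat_recr//=.
  by apply: le_trans (lerD (IH im) (step m)); lra.
pose Y := expR (expR (X + g i0)).
exists (maxn i0 (Num.truncn Y).+1); first exact: leq_maxl.
apply: le_trans (tele _ (leq_maxl _ _)).
set m := maxn _ _.
have mY : Y <= m.+2%:R.
  have : Y < (Num.truncn Y).+1%:R by apply: truncnS_gt.
  have : ((Num.truncn Y).+1%:R <= m.+2%:R :> R) by rewrite ler_nat; have := leq_maxr i0 (Num.truncn Y).+1; rewrite -/m; lia.
  lra.
have h1 : expR (X + g i0) <= ln m.+2%:R.
  by rewrite -[leLHS]expRK ler_ln ?posrE ?expR_gt0.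
have h2 : X + g i0 <= g m.
  by rewrite -[leLHS]expRK ler_ln ?posrE ?expR_gt0//; exact: ln_nat_gt0.
lra.
Qed.

(** Plays the part of the second Borel-Cantelli lemma for dependent stages: [u i] is the measure
    left after stage [i], with limit at least [U]. If U > eta, each stage removes a fixed multiple
    of 1/(i ln i), in total more than is available. *)
Lemma limit_le_of_divergence (u : nat -> R) (U eta c : R) (i0 : nat) : 0 < c ->
  (forall i, 0 <= u i <= 1) -> (forall i, U <= u i) ->
  (forall i, (i0 <= i)%N ->
     u i - eta <= c * (i.+2%:R * ln i.+2%:R) * (u i - u i.+1)) ->
  U <= eta.
Proof.
move=> c0 u01 Uu H; rewrite leNgt; apply/negP => Ueta.
(* This threshold makes the total loss at least 2, while [u] stays in [0, 1]. *)
have [m im hm] := loglog_unbounded i0 (2 * c / (U - eta)).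
have dU : 0 < U - eta by lra.
have st i : (i0 <= i)%N -> (U - eta) / c * (i.+2%:R * ln i.+2%:R)^-1 <= u i - u i.+1.
  move=> ii; have n0 := @nlnn_ge1 i.+2 isT.
  have := H i ii; have := Uu i; move: n0; set n := _ * ln _ => n0 h1 h2.
  rewrite -mulrA -invfM ler_pdivrMr; last by rewrite mulr_gt0//; lra.
  by rewrite mulrC; lra.
have : \sum_(i0 <= i < m) ((U - eta) / c * (i.+2%:R * ln i.+2%:R)^-1) <= u i0 - u m.
  elim: m im {hm} => [|m IH]; first by rewrite leqn0 => /eqP ->; rewrite big_geq// subrr.
  rewrite leq_eqVlt => /orP[/eqP ->|]; first by rewrite big_geq// subrr.
  rewrite ltnS => im; rewrite big_nat_recr//=.
  by apply: (le_trans (lerD (IH im) (st m im))); lra.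
rewrite -mulr_sumr => h.
have : (U - eta) / c * (2 * c / (U - eta)) <= u i0 - u m.
  by apply: le_trans h; rewrite ler_wpM2l// divr_ge0// ltW.
have -> : (U - eta) / c * (2 * c / (U - eta)) = 2 by field; rewrite !gt_eqF.
by have /andP[] := u01 i0; have /andP[] := u01 m; lra.
Qed.

Lemma cfq_le al k : irr al -> (cfq al k <= cfq al k.+1)%N.
Proof. by move=> ial; rewrite cfqS; have := @cfa_gt0 _ al k ial; nia. Qed.

Lemma cfq_gt0 al k : irr al -> (0 < cfq al k)%N.
Proof. by move=> ial; elim: k => // k IH; exact: leq_trans (cfq_le _ ial). Qed.

Lemma cfq_exp2 al i : irr al -> (2 ^ i <= cfq al i.*2)%N.
Proof.
move=> ial; elim: i => // i IH; rewrite doubleS cfqS cfq_prevS expnS.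
have := @cfa_gt0 _ al i.*2.+1 ial; have := @cfq_le al i.*2 ial.
have := @cfq_le al i.*2.+1 ial; nia.
Qed.

Lemma cfq_homo al i j : irr al -> (i <= j)%N -> (cfq al i <= cfq al j)%N.
Proof.
move=> ial; elim: j => [|j IH]; first by rewrite leqn0 => /eqP ->.
rewrite leq_eqVlt => /orP[/eqP -> //|]; rewrite ltnS => /IH h.
exact: leq_trans h (cfq_le _ ial).
Qed.

End Divergence.

Section GoodIndices.
Variable R : realType.
Local Notation irr := (@irrational R).
Local Notation mu := (@lebesgue_measure R).
Implicit Types (al x y : R) (w : seq nat) (A B : set R).

(** [digit_sum_tail] with cutoff M = m n: both of its terms drop below eta/2 uniformly in [n] once
    [m] and then [D] are large. *)
Lemma digit_sum_tail_nlnn (eta : R) : 0 < eta -> exists2 D : nat, (0 < D)%N &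
  forall k n S : nat, (1 < n)%N -> (k <= 4 * n)%N -> D%:R * (n%:R * ln n%:R) <= S%:R :> R ->
    (mu (digit_event k [set w | (S <= sumn w)%N]) <= eta%:E)%E.
Proof.
move=> eta0.
have [m m0n mE] : exists2 m : nat, (0 < m)%N & 16 / eta <= m%:R.
  by exists (Num.truncn (16 / eta)).+1 => //; apply/ltW/truncnS_gt.
have m0 : 0 < m%:R :> R by rewrite ltr0n.
have lm0 : 0 <= ln m%:R :> R by rewrite ln_ge0// ler1n.
pose X := 16 * (2 * (1 + ln m%:R) + 1) / eta.
have [D D0 DX] : exists2 D : nat, (0 < D)%N & X <= D%:R.
  by exists (Num.truncn X).+1 => //; apply/ltW/truncnS_gt.
exists D => // k n S n1 kn SD.
have nl := nlnn_ge1 R n1.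
have n0 : 0 < n%:R :> R by rewrite ltr0n; lia.
have ln0 := ln_nat_gt0 R n1.
have D1 : 1 <= D%:R :> R by rewrite ler1n.
have S0' : 0 < S%:R :> R by nra.
have S0 : (0 < S)%N by rewrite -(ltr_nat R).
have M0 : (0 < m * n)%N by rewrite muln_gt0 m0n ltnW.
apply: (le_trans (digit_sum_tail R k M0 S0)); rewrite lee_fin.
have kn' : k%:R <= 4 * n%:R :> R by rewrite -natrM ler_nat.
have ln2n : 2^-1 <= ln n%:R :> R.
  by apply: (le_trans (ln2_ge R)); rewrite ler_ln ?posrE// ler_nat.
have e1 : k%:R * (2 / (m * n)%:R) <= eta / 2.
  apply: (@le_trans _ _ (4 * n%:R * (2 / (m * n)%:R))); first by rewrite ler_wpM2r// divr_ge0.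
  have -> : 4 * n%:R * (2 / (m * n)%:R) = 8 / m%:R :> R.
    by rewrite natrM; field; rewrite !gt_eqF.
  have mE' : 16 <= m%:R * eta by rewrite -ler_pdivrMr.
  by rewrite ler_pdivrMr//; lra.
have e2 : k%:R * (2 * (1 + ln (m * n)%:R)) / S%:R <= eta / 2.
  rewrite natrM lnM ?posrE// ler_pdivrMr//.
  have h1 : 1 + (ln m%:R + ln n%:R) <= (2 * (1 + ln m%:R) + 1) * ln n%:R :> R.
    have : 0 <= ln m%:R * (ln n%:R - 2^-1) :> R by rewrite mulr_ge0// subr_ge0.
    lra.
  have h2 : 16 * (2 * (1 + ln m%:R) + 1) <= eta * D%:R.
    by move: DX; rewrite /X ler_pdivrMr// [D%:R * eta]mulrC.
  apply: (@le_trans _ _ (4 * n%:R * (2 * ((2 * (1 + ln m%:R) + 1) * ln n%:R)))).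
    by apply: ler_pM => //; [rewrite mulr_ge0// !addr_ge0// ltW|rewrite ler_pM2l].
  apply: (@le_trans _ _ (eta / 2 * (D%:R * (n%:R * ln n%:R)))); last by rewrite ler_pM2l// divr_gt0.
  have -> : 4 * n%:R * (2 * ((2 * (1 + ln m%:R) + 1) * ln n%:R)) =
    (16 * (2 * (1 + ln m%:R) + 1)) * (n%:R * ln n%:R / 2) :> R by field.
  have -> : eta / 2 * (D%:R * (n%:R * ln n%:R)) = eta * D%:R * (n%:R * ln n%:R / 2) by field.
  by rewrite ler_wpM2r// divr_ge0// mulr_ge0// ltW.
by rewrite [leRHS]splitr lerD.
Qed.

(* [a_{K+1}] dwarfs the sum of all earlier digits, while its logarithm is negligible against [ln q_K]. *)
Definition good_index (v L : nat) (b : bool) al K :=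
  [/\ odd K = b, (v %| cfq al K)%N, (L * sumn (digits al K) <= cfa al K.+1)%N
    & (cfa al K.+1 ^ L <= cfq al K)%N].

(* Stage [i] inspects the digits of index [4i+b+1], [4i+b+2], [4i+b+3]: the first two force [v] to divide
   the next denominator, the third is forced to be of order [i ln i].  Given that no earlier stage succeeded
   and that the digit sum is not abnormally large, this has conditional probability of order [1/(i ln i)],
   and these diverge. *)
Lemma good_index_cover (v L : nat) (b : bool) (K0 : nat) (eta : R) :
  (0 < v)%N -> 0 < eta ->
  exists N : set R, [/\ measurable N, (mu N <= eta%:E)%E &
    forall al, 0 <= al < 1 -> irr al ->
      ~ (exists2 K, (K0 <= K)%N & good_index v L b al K) -> N al].
Proof.
move=> v0 eta0.
have [D D0 HD] := digit_sum_tail_nlnn eta0.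
have /choice[j Hj] : forall w, exists j : nat * nat, all (leq 1) w ->
    [/\ (0 < j.1 <= v)%N, (0 < j.2 <= 2 * v)%N &
     (v %| j.2 * (j.1 * (wden w).2 + (wden w).1) + (wden w).2)%N].
  move=> w; have [w0|] := boolP (all (leq 1) w); last by exists (0, 0)%N.
  by have [j1 [j2 h]] := two_digits_dvd v0 (coprime_wden w); exists (j1, j2).
pose k (i : nat) : nat := (4 * i + b)%N.
pose S (i : nat) : nat := (Num.truncn (D%:R * (i.+2%:R * ln i.+2%:R) : R)).+1.
(* The term 4 v leaves room for the two prescribed digits, at most v and 2 v, so a digit of size
   [T i] exceeds [L] times the sum of all earlier ones. *)
pose T (i : nat) : nat := (L * (S i + 4 * v)).+1.
pose D' : nat := (L * (D + 1 + 4 * v)).+1.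
have SD i : D%:R * (i.+2%:R * ln i.+2%:R) <= (S i)%:R :> R by apply/ltW/truncnS_gt.
have SD' i : (S i)%:R <= D%:R * (i.+2%:R * ln i.+2%:R) + 1 :> R.
  rewrite /S -natr1 lerD2r truncn_le// mulr_ge0// mulr_ge0// ltW//.
  exact: ln_nat_gt0.
have TD i : (T i)%:R <= D'%:R * (i.+2%:R * ln i.+2%:R) :> R.
  have TE1 : (T i)%:R = L%:R * ((S i)%:R + 4 * v%:R) + 1 :> R.
    by rewrite /T -[LHS]natr1 (natrM R L) (natrD R (S i)) (natrM R 4).
  have DE1 : D'%:R = L%:R * (D%:R + 1 + 4 * v%:R) + 1 :> R.
    by rewrite /D' -[LHS]natr1 (natrM R L) (natrD R (D + 1)) (natrD R D) (natrM R 4).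
  have h1 := @nlnn_ge1 R i.+2 isT; have h2 := SD' i.
  rewrite TE1 DE1; move: h1 h2; move: (_ * ln _) ((S i)%:R) => X s h1 h2.
  have L0 : 0 <= L%:R :> R by [].
  have v0' : 0 <= v%:R :> R by [].
  have h3 : s + 4 * v%:R <= (D%:R + 1 + 4 * v%:R) * X :> R.
    have : 0 <= v%:R * (X - 1) by rewrite mulr_ge0// subr_ge0.
    lra.
  have := ler_wpM2l L0 h3; lra.
have TD2 i : (T i <= D' * (i.+2 * i.+2))%N.
  rewrite -(ler_nat R) (le_trans (TD i))// !natrM ler_wpM2l// ler_wpM2l//.
  exact: ln_le_id.
pose a := (2 * L).+1.
pose E := ((4 * D') ^ L * a ^ a)%N.
have TE i : ((4 * T i) ^ L <= E * 2 ^ i.+2)%N.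
  apply: (@leq_trans ((4 * D' * (i.+2 * i.+2)) ^ L)).
    by case: (posnP L) => [->//|L0]; rewrite leq_exp2r// -mulnA leq_mul2l TD2.
  rewrite expnMn /E -mulnA leq_mul2l; apply/orP; right.
  apply: leq_trans (expn_le_exp2 i.+2 (isT : (0 < a)%N)).
  by rewrite mulnn -expnM leq_exp2l// /a.
pose i0 := (maxn K0 (4 * E))%N.
have i0K i : (i0 <= i)%N -> (K0 <= i)%N by rewrite geq_max => /andP[].
(* [T i] grows polynomially whereas q_(4i) >= 2^(2i); this gives the clause a_(K+1)^L <= q_K of
   [good_index]. *)
have TQ i : (i0 <= i)%N -> ((4 * T i) ^ L <= 2 ^ i.*2)%N.
  rewrite geq_max => /andP[_ iE]; apply: (leq_trans (TE i)).
  have h := ltn_expl i (isT : (1 < 2)%N).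
  have -> : (E * 2 ^ i.+2 = 4 * E * 2 ^ i)%N by rewrite !expnS; lia.
  by rewrite -addnn expnD leq_mul2r; apply/orP; right; lia.
pose good i al := [/\ (sumn (digits al (k i)) < S i)%N,
   cfa al (k i).+1 = (j (digits al (k i))).1,
   cfa al (k i).+2 = (j (digits al (k i))).2 &
   (T i <= cfa al (k i).+3 < 4 * T i)%N].
have good_ok i al : irr al -> (i0 <= i)%N -> good i al -> good_index v L b al (k i).+2.
  move=> ial ii [h1 h2 h3 /andP[h4 h5]].
  have [/andP[_ j1] /andP[_ j2] jd] := Hj _ (digits_gt0 (k i) ial).
  split.
  - by rewrite /= negbK oddD oddM /= oddb.
  - by rewrite cfqS cfqS cfq_prevS h2 h3 cfqE cfq_prevE.
  - rewrite !digitsS !sumn_rcons h2 h3; apply: leq_trans h4.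
    by apply: leqW; rewrite leq_mul2l; apply/orP; right; lia.
  - apply: (@leq_trans ((4 * T i) ^ L)).
      by case: (posnP L) => [->//|L0]; rewrite leq_exp2r// ltnW.
    apply: (leq_trans (TQ i ii)); apply: (leq_trans (cfq_exp2 _ ial)).
    by apply: cfq_homo => //; rewrite /k; lia.
pose goodw i w := [/\ (sumn (take (k i) w) < S i)%N,
   nth 0%N w (k i) = (j (take (k i) w)).1,
   nth 0%N w (k i).+1 = (j (take (k i) w)).2 &
   (T i <= nth 0%N w (k i).+2 < 4 * T i)%N].
have goodE i al m : (k i + 3 <= m)%N -> goodw i (digits al m) <-> good i al.
  move=> im.
  have tk : take (k i) (digits al m) = digits al (k i).
    rewrite /digits -map_take take_iota; congr (map _ (iota _ _)).
    by apply/minn_idPl; lia.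
  have nt r : (r < m)%N -> nth 0%N (digits al m) r = cfa al r.+1.
    by move=> rm; rewrite (nth_map 0%N) ?size_iota// nth_iota.
  by rewrite /goodw /good tk !nt//; lia.
have kS i i' : (i < i')%N -> (k i + 3 <= k i')%N by rewrite /k; case: (b); lia.
(* Stage i' reads digits up to index k i' + 3 <= k (i'+1) only, so failure of all stages before [i]
   is an event about the first [k i] digits. *)
pose N i := digit_event (R := R) (k i) [set w | forall i', (i0 <= i' < i)%N -> ~ goodw i' w].
have NE i al : N i al <-> [/\ 0 <= al < 1, irr al & forall i', (i0 <= i' < i)%N -> ~ good i' al].
  split=> -[h1 h2 h3]; split=> // i' ii'; have := h3 i' ii'; have /andP[_ /kS h] := ii'.
    by rewrite /= goodE.
  by rewrite goodE.
have mN i : measurable (N i) by exact: measurable_digit_event.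
have NS i : N i.+1 `<=` N i.
  move=> al /NE[h1 h2 h3]; apply/NE; split=> // i' /andP[a1 a2]; apply: h3.
  by rewrite a1 ltnS ltnW.
pose u i : R := fine (mu (N i)).
have mu1 i : (mu (N i) <= 1)%E.
  apply: (@le_trans _ _ (mu (digit_event (k i) setT))); last exact: digit_eventT_le1.
  apply: le_measure; rewrite ?inE; [exact: mN|exact: measurable_digit_event|].
  by move=> al [].
have uE i : mu (N i) = (u i)%:E.
  rewrite /u fineK// ge0_fin_numE ?measure_ge0//; apply: le_lt_trans (mu1 i) _.
  exact: ltry.
have u01 i : 0 <= u i <= 1.
  by rewrite -!lee_fin -uE measure_ge0 mu1.
pose V := (2 * v)%N.
pose c : R := 2 * D'%:R * (V.+1 * V.+2)%:R ^+ 2.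
have c0 : 0 < c by rewrite !mulr_gt0// ?exprn_gt0// ltr0n// muln_gt0.
(* Outside an event of measure at most [eta] the digit sum is below [S i]; there stage [i] succeeds
   with conditional probability of order 1/(i ln i), and the successful part leaves [N i]. *)
have rec i : (i0 <= i)%N -> u i - eta <= c * (i.+2%:R * ln i.+2%:R) * (u i - u i.+1).
  move=> ii.
  pose W : set (seq nat) := [set w | (forall i', (i0 <= i' < i)%N -> ~ goodw i' w) /\ (sumn w < S i)%N].
  have := @digits_next_measure R V (k i) W (fun w => (j w).1) (fun w => (j w).2) (T i).
  move=> /(_ _ isT) [w w0|].
    by have [? ? _] := Hj w w0; rewrite /V; split; lia.
  set B := (X in measurable X) => mB hB.
  have A_le : (mu (N i) <= mu (digit_event (k i) W) + eta%:E)%E.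
    apply: (@le_trans _ _ (mu (digit_event (k i) W) + mu (digit_event (k i) [set w | (S i <= sumn w)%N]))%E).
      apply: (@le_trans _ _ (mu (digit_event (k i) W `|` digit_event (k i) [set w | (S i <= sumn w)%N]))%E).
        apply: le_measure; rewrite ?inE; [exact: mN|by apply: measurableU; exact: measurable_digit_event|].
        move=> al [h1 h2 h3]; have [h|h] := ltnP (sumn (digits al (k i))) (S i); first by left; split.
        by right; split.
      by apply: measureU2; exact: measurable_digit_event.
    rewrite leeD2l//; apply: (HD _ i.+2) => //; rewrite /k; case: (b); lia.
  have B_le : (mu B <= (u i - u i.+1)%:E)%E.
    rewrite EFinB -!uE leeBrDr ?uE// -!uE.
    rewrite (_ : (_ + _)%E = mu (B `|` N i.+1)).
      apply: le_measure; rewrite ?inE; [by apply: measurableU; [exact: mB|exact: mN]|exact: mN|].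
      by move=> al [[[h1 h2 [h3 h4]] _]|/NS//]; split.
    apply/esym/measureU; [exact: mB|exact: mN|].
    apply/seteqP; split=> // al [[[h1 h2 [h3 h4]] [h5 h6 h7]] /NE[_ _ /(_ i)]].
    by rewrite ii ltnSn => /(_ isT); apply; split.
  have T_le : 2 * (T i)%:R * (V.+1 * V.+2)%:R ^+ 2 <= c * (i.+2%:R * ln i.+2%:R) :> R.
    have h0 : 0 <= 2 * (V.+1 * V.+2)%:R ^+ 2 :> R by rewrite mulr_ge0// exprn_ge0.
    by have := ler_wpM2l h0 (TD i); rewrite /c; lra.
  have : ((u i)%:E <= ((c * (i.+2%:R * ln i.+2%:R)) * (u i - u i.+1) + eta)%:E)%E.
    rewrite -uE; apply: (le_trans A_le); rewrite EFinD leeD2r//.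
    apply: (le_trans hB); rewrite [leRHS]EFinM; apply: lee_pmul => //.
  by rewrite lee_fin; lra.
exists (\bigcap_i N i); split.
- by apply: bigcapT_measurable.
- have mI : measurable (\bigcap_i N i) by exact: bigcapT_measurable.
  have le i : (mu (\bigcap_i N i) <= mu (N i))%E.
    by apply: le_measure; rewrite ?inE; [exact: mI|exact: mN|exact: bigcap_inf].
  have UE : mu (\bigcap_i N i) = (fine (mu (\bigcap_i N i)))%:E.
    rewrite fineK// ge0_fin_numE ?measure_ge0//.
    by apply: le_lt_trans (le 0%N) _; rewrite uE ltry.
  rewrite UE lee_fin; apply: (@limit_le_of_divergence R u _ eta c i0) => // i.
  by rewrite -lee_fin -UE -uE.
- move=> al al01 ial nex i _; apply/NE; split => // i' /andP[ii' _] g; apply: nex.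
  exists (k i').+2; last exact: good_ok.
  by have := i0K _ ii'; rewrite /k; lia.
Qed.

(** The covers of measure 1/(m+1) make each bad set null, and there are countably many triples [L],
    [b], [K0]. One null set therefore serves every [L], hence later every r. *)
Theorem ae_good_index (v : nat) : (0 < v)%N ->
  {ae mu, forall al, 0 <= al < 1 -> irr al ->
    forall (L : nat) (b : bool) (K0 : nat), exists2 K, (K0 <= K)%N & good_index v L b al K}.
Proof.
move=> v0.
pose bad (L : nat) (b : bool) (K0 : nat) : set R := [set al | [/\ 0 <= al < 1, irr al &
  ~ (exists2 K, (K0 <= K)%N & good_index v L b al K)]].
have nb L b K0 : mu.-negligible (bad L b K0).
  have /choice[N HN] : forall m : nat, exists N : set R, [/\ measurable N,
      (mu N <= ((m.+1%:R)^-1)%:E)%E & forall al, 0 <= al < 1 -> irr al ->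
      ~ (exists2 K, (K0 <= K)%N & good_index v L b al K) -> N al].
    by move=> m; apply: good_index_cover => //; rewrite invr_gt0.
  have mN m : measurable (N m) by have [] := HN m.
  have mI : measurable (\bigcap_m N m) by exact: bigcapT_measurable.
  exists (\bigcap_m N m); split => //.
    have h m : (mu (\bigcap_m N m) <= ((m.+1%:R)^-1)%:E)%E.
      have [_ + _] := HN m; apply: le_trans.
      by apply: le_measure; rewrite ?inE; [exact: mI|exact: mN|exact: bigcap_inf].
    have UE : mu (\bigcap_i N i) = (fine (mu (\bigcap_i N i)))%:E.
      rewrite fineK// ge0_fin_numE ?measure_ge0//.
      by apply: le_lt_trans (h 0%N) _; rewrite ltry.
    have r0 : 0 <= fine (mu (\bigcap_i N i)) by rewrite fine_ge0// measure_ge0.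
    rewrite UE; move: h r0; rewrite UE; move: (fine _) => r h r0; congr (_%:E).
    apply/eqP; rewrite eq_le r0 andbT leNgt; apply/negP => rp.
    have := h (Num.truncn r^-1); rewrite lee_fin.
    have : r^-1 < (Num.truncn r^-1).+1%:R by exact: truncnS_gt.
    move: (_.+1%:R) => x rx xr; have x0 : 0 < x by apply: lt_trans rx; rewrite invr_gt0.
    by move: rx; rewrite -(ltf_pV2 _ _) ?posrE ?invr_gt0// invrK ltNge xr.
  by move=> al [h1 h2 h3] m _; have [_ _] := HN m; apply.
have : mu.-negligible (\bigcup_L \bigcup_K0 (bad L true K0 `|` bad L false K0)).
  apply: negligible_bigcup => L; apply: negligible_bigcup => K0.
  exact: negligibleU.
apply: negligibleS => al /=.
move=> h; apply: contrapT => nh; apply: h => al01 ial L b K0.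
apply: contrapT => nK; apply: nh; exists L => //; exists K0 => //.
by case: b nK => nK; [left|right]; split.
Qed.

End GoodIndices.

(** * Denjoy-Koksma and Ostrowski sums *)

Lemma coprime_wnum_wden w : coprime (wnum w).2 (wden w).2.
Proof.
have h (a b c d : nat) : ((a * b)%N = (c * d).+1)%N -> coprime a d.
  move=> e; rewrite /coprime -dvdn1.
  have : (gcdn a d %| (c * d).+1)%N by rewrite -e dvdn_mulr// dvdn_gcdl.
  by rewrite -addn1 dvdn_addr// dvdn_mull// dvdn_gcdr.
suff : ((wnum w).2 * (wden w).1 = ((wnum w).1 * (wden w).2).+1)%N \/
       ((wnum w).1 * (wden w).2 = ((wnum w).2 * (wden w).1).+1)%N.
  case; first exact: h.
  rewrite mulnC [in RHS]mulnC.
  by move=> e; rewrite coprime_sym; exact: (h _ _ _ _ e).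
elim/last_ind: w => [|w c [] IH]; first by right.
  by right; rewrite wnum_rcons wden_rcons /=; nia.
by left; rewrite wnum_rcons wden_rcons /=; nia.
Qed.

Section DenjoyKoksma.
Variable R : realType.
Local Notation irr := (@irrational R).
Local Notation frac := (@Pilot.Defs.frac R).
Implicit Types (al x y : R).

Definition cfnum al k : nat := (wnum (digits al k)).2.
Definition cferr al k : R := al - (cfnum al k)%:R / (cfq al k)%:R.

(** The error equals (-1)^k / (q_k (q_k x + q_(k-1))) with x the next complete quotient, and a_(k+1)
    < x < a_(k+1) + 1 puts q_k x + q_(k-1) between q_(k+1) and q_(k+1) + q_k. *)
Lemma cferr_bound al k : irr al -> 0 <= al < 1 ->
  ((cfq al k)%:R * ((cfq al k.+1)%:R + (cfq al k)%:R))^-1 < (-1) ^+ k * cferr al k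
    < ((cfq al k)%:R * (cfq al k.+1)%:R)^-1.
Proof.
move=> ial al01; have w0 := digits_gt0 k ial.
have x1 := @cfx_gt1 _ al k ial.
have x0 : 0 < cfx al k.+1 by lra.
have alE := @cfwordK _ al k ial al01; rewrite cfwordE// in alE.
have := wdet R (digits al k); rewrite size_digits.
have qE : cfq al k = (wden (digits al k)).2 by rewrite cfqE.
have q0 : 0 < (cfq al k)%:R :> R by rewrite ltr0n cfq_gt0.
have xE := @cfaE _ al k ial.
have f1 := frac_lt1 (cfx al k.+1).
have f0 : 0 < frac (cfx al k.+1) by apply: irr_frac_gt0; exact: cfx_irr.
rewrite /cferr /cfnum cfqS cfq_prevE qE natrD natrM; rewrite qE in q0.
move: q0 alE.
set p := (wnum _).2%:R; set p' := (wnum _).1%:R; set q := (wden _).2%:R; set q' := (wden _).1%:R.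
move=> q0 alE det.
rewrite -[X in X - p / q]alE.
have q'0 : 0 <= q' by rewrite /q'.
have D0 : 0 < q * cfx al k.+1 + q' by rewrite ltr_pwDl// mulr_gt0.
have -> : (p * cfx al k.+1 + p') / (q * cfx al k.+1 + q') - p / q = - (p * q' - p' * q) / (q * (q * cfx al k.+1 + q')).
  by field; rewrite !gt_eqF.
rewrite det exprS mulN1r opprK mulrA -expr2 sqrr_sign mul1r.
move: D0; rewrite xE; move: (frac _) f1 f0 => f f1 f0 D0.
have a1 : 1 <= (cfa al k.+1)%:R :> R by rewrite ler1n cfa_gt0.
move: (_%:R) a1 D0 => a a1 D0.
have h1 : 0 < a * q + q' by nra.
by rewrite !ltf_pV2 ?posrE; [|nra..]; rewrite !ltr_pM2l//; apply/andP; split; nra.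
Qed.

Lemma cferr_abs al k : irr al -> 0 <= al < 1 ->
  `|cferr al k| * ((cfq al k)%:R * (cfq al k.+1)%:R) < 1.
Proof.
move=> ial al01; have /andP[h1 h2] := cferr_bound k ial al01.
have q0 : 0 < (cfq al k)%:R :> R by rewrite ltr0n cfq_gt0.
have q1 : 0 < (cfq al k.+1)%:R :> R by rewrite ltr0n cfq_gt0.
have e0 : 0 < (-1) ^+ k * cferr al k.
  by apply: le_lt_trans h1; rewrite invr_ge0 mulr_ge0 ?addr_ge0// ltW.
have -> : `|cferr al k| = (-1) ^+ k * cferr al k.
  by rewrite -[RHS]gtr0_norm// normrM normrX normrN1 expr1n mul1r.
by rewrite -ltr_pdivlMr ?mulr_gt0// mul1r.
Qed.

(** Since [P] is invertible modulo [q], n P + W runs once through all residues when n runs over [q]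
    consecutive integers. *)
Lemma sum_residues (V : nmodType) (h : nat -> V) (q : nat) (P W : int) (m : nat) :
  (0 < q)%N -> coprimez P q ->
  \sum_(m <= n < m + q) h `|((n%:Z * P + W) %% q%:Z)%Z|%N = \sum_(0 <= r < q) h r.
Proof.
move=> q0 cop; rewrite -{1}[m]add0n big_addn addKn !big_mkord.
have q0' : q%:Z != 0 by rewrite eqz_nat -lt0n.
have lt (i : nat) : (`|(((i + m)%N%:Z * P + W) %% q%:Z)%Z| < q)%N.
  have := modz_ge0 ((i + m)%N%:Z * P + W) q0'.
  have : (((i + m)%N%:Z * P + W) %% q%:Z)%Z < q%:Z by apply: ltz_pmod; rewrite ltz_nat.
  by case: (_ %% _)%Z.
pose s (i : 'I_q) := Ordinal (lt i).
rewrite [RHS](reindex s)//=.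
apply: onW_bij; apply: injF_bij => i j /(congr1 val) /= e.
have {}e : (((i + m)%N%:Z * P + W) == ((j + m)%N%:Z * P + W) %[mod q%:Z])%Z.
  have := modz_ge0 ((i + m)%N%:Z * P + W) q0'.
  have := modz_ge0 ((j + m)%N%:Z * P + W) q0'.
  by move: e; case: (_ %% _)%Z => // a; case: (_ %% _)%Z => // b /= ->.
move: e; rewrite eqz_mod_dvd.
have -> : (i + m)%N%:Z * P + W - ((j + m)%N%:Z * P + W) = (i%:Z - j%:Z) * P.
  by rewrite !PoszD; ring.
rewrite mulrC Gauss_dvdzr; last by rewrite coprimez_sym.
rewrite -eqz_mod_dvd => /eqP; rewrite !modz_nat !modn_small// => -[] e.
exact: val_inj.
Qed.

Lemma coprimez_cfnum al k : coprimez (cfnum al k)%:Z (cfq al k)%:Z.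
Proof. by rewrite /coprimez /gcdz !absz_nat eqz_nat cfqE; exact: coprime_wnum_wden. Qed.

(** With [W] the floor of q x0, the remainder [s] consists of a fractional part and of the
    accumulated error n q |al - p/q| < 1. So an orbit point is less than one cell to the left and
    two cells to the right of its lattice point. *)
Lemma block_points al k x0 : irr al -> 0 <= al < 1 ->
  exists W : int, forall n : nat, (n <= cfq al k)%N -> exists (d : int) (s : R),
    -1 < s < 2 /\
    x0 + n%:R * al = d%:~R +
      (`|((n%:Z * (cfnum al k)%:Z + W) %% (cfq al k)%:Z)%Z|%N%:R + s) / (cfq al k)%:R.
Proof.
move=> ial al01; set q := cfq al k; set p := cfnum al k.
have q0 : (0 < q)%N by exact: cfq_gt0.
have q0' : 0 < q%:R :> R by rewrite ltr0n.
have qz : q%:Z != 0 by rewrite eqz_nat -lt0n.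
exists (Num.floor (q%:R * x0)) => n nq.
set W := Num.floor _; set Z := n%:Z * p%:Z + W.
exists (Z %/ q%:Z)%Z, (frac (q%:R * x0) + n%:R * cferr al k * q%:R); split.
  have := frac_lt1 (q%:R * x0); have := frac_ge0 (q%:R * x0).
  have : `|n%:R * cferr al k * q%:R| < 1.
    rewrite !normrM !normr_nat; apply: le_lt_trans (cferr_abs k ial al01).
    rewrite -/q (_ : _ * (_ * _) = (cfq al k.+1)%:R * `|cferr al k| * q%:R); last by ring.
    by rewrite !ler_wpM2r// ler_nat (leq_trans nq)// cfq_le.
  by rewrite ltr_norml => /andP[]; lra.
have modE : `|(Z %% q%:Z)%Z|%N%:R = Z%:~R - (Z %/ q%:Z)%Z%:~R * q%:R :> R.
  have h : (`|(Z %% q%:Z)%Z|%N%:Z) = (Z %% q%:Z)%Z by rewrite gez0_abs// modz_ge0.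
  rewrite -[LHS]/(`|(Z %% q%:Z)%Z|%N%:Z%:~R) h.
  have e : Z%:~R = (Z %/ q%:Z)%Z%:~R * q%:R + (Z %% q%:Z)%Z%:~R :> R.
    by rewrite {1}(divz_eq Z q%:Z) (rmorphD (intmul 1)) (rmorphM (intmul 1)).
  by rewrite e addrC addKr.
rewrite modE.
have ZE : Z%:~R = n%:R * p%:R + W%:~R :> R by rewrite /Z (rmorphD (intmul 1)) (rmorphM (intmul 1)).
rewrite ZE /cferr -/q -/p {1}(_ : x0 = (W%:~R + frac (q%:R * x0)) / q%:R); last first.
  by rewrite -floorE mulrAC divff ?mul1r// gt_eqF.
by field; rewrite gt_eqF.
Qed.

Lemma frac_lattice (d : int) (q : nat) (t : R) : (0 < q)%N ->
  0 <= t < q%:R -> frac (d%:~R + t / q%:R) = t / q%:R.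
Proof.
move=> q0 /andP[t0 tq]; have q0' : 0 < q%:R :> R by rewrite ltr0n.
by apply: (@frac_eq _ d) => //; rewrite divr_ge0//= ltr_pdivrMr// mul1r.
Qed.

(** By monotonicity each value is compared with a lattice value shifted one cell down or two cells
    up; these shifted values are again lattice values except for at most three residues at the ends,
    each costing [M]. *)
Lemma denjoy_koksma al k x0 (g : R -> R) (M : R) : irr al -> 0 <= al < 1 ->
  (forall x y, 0 <= x -> x <= y -> y < 1 -> g x <= g y) ->
  (forall x, 0 <= x < 1 -> 0 <= g x <= M) ->
  `|\sum_(1 <= n < (cfq al k).+1) g (frac (x0 + n%:R * al))
    - \sum_(0 <= m < cfq al k) g (m%:R / (cfq al k)%:R)| <= 3 * M.
Proof.
move=> ial al01 gm gM.
have [W HW] := @block_points al k x0 ial al01; move: HW.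
have q0 : (0 < cfq al k)%N by exact: cfq_gt0.
have cop := coprimez_cfnum al k.
move: (cfq al k) (cfnum al k) q0 cop => q p q0 cop HW.
have q0' : 0 < q%:R :> R by rewrite ltr0n.
pose r n : nat := `|((n%:Z * p%:Z + W) %% q%:Z)%Z|%N.
have rq n : (r n < q)%N.
  have qz : q%:Z != 0 by rewrite eqz_nat -lt0n.
  have := modz_ge0 (n%:Z * p%:Z + W) qz.
  have : ((n%:Z * p%:Z + W) %% q%:Z)%Z < q%:Z by apply: ltz_pmod; rewrite ltz_nat.
  by rewrite /r; case: (_ %% _)%Z.
have gfr x : 0 <= g (frac x) <= M by apply: gM; rewrite frac_ge0 frac_lt1.
have M0 : 0 <= M by have /andP[] := gfr 0; apply: le_trans.
have gmq m : (m < q)%N -> 0 <= g (m%:R / q%:R) <= M.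
  by move=> mq; apply: gM; rewrite divr_ge0//= ltr_pdivrMr// mul1r ltr_nat.
rewrite ler_norml; apply/andP; split.
(* Lower comparison, one cell down. Residues 0 and q-1 get the trivial bound 0, because their points
   may wrap around modulo 1. *)
- pose l (m : nat) : R := if (m == 0)%N || (q <= m.+1)%N then 0 else g (m.-1%:R / q%:R).
  have lb n : (n <= q)%N -> l (r n) <= g (frac (x0 + n%:R * al)).
    move=> nq; have /andP[g0 _] := gfr (x0 + n%:R * al).
    rewrite /l; case: ifPn => // /norP[rn0 rnq].
    have [d [s [/andP[s1 s2] ->]]] := HW n nq; rewrite -/(r n).
    have rn1 : (r n).-1%:R = (r n)%:R - 1 :> R by rewrite -[1]/(1%:R) -natrB ?subn1// lt0n.
    have h1 : 1 <= (r n)%:R :> R by rewrite ler1n lt0n.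
    have h2 : (r n)%:R + 2 <= q%:R :> R by rewrite -natrD ler_nat; lia.
    rewrite frac_lattice//; last by apply/andP; split; lra.
    apply: gm; rewrite ?divr_ge0 ?ler_pM2r ?invr_gt0 ?ltr_pdivrMr ?mul1r//; lra.
  have S : \sum_(1 <= n < q.+1) g (frac (x0 + n%:R * al)) >= \sum_(0 <= m < q) l m.
    rewrite -(@sum_residues _ l q p%:Z W 1 q0 cop) add1n.
    by apply: ler_sum_nat => n /andP[_ nq]; exact: lb.
  suff : \sum_(0 <= m < q) g (m%:R / q%:R) <= \sum_(0 <= m < q) l m + 3 * M by lra.
  have l0 m : (m < q)%N -> 0 <= l m.
    by rewrite /l => mq; case: ifP => // _; have /andP[] := @gmq m.-1 (leq_ltn_trans (leq_pred _) mq).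
  have [q3|] := ltnP q 3.
    apply: (@le_trans _ _ (3 * M)); last first.
      rewrite lerDr big_nat_cond; apply: sumr_ge0 => m; rewrite andbT => /andP[_]; exact: l0.
    apply: (@le_trans _ _ (\sum_(0 <= m < q) M)).
      by apply: ler_sum_nat => m /andP[_ /gmq/andP[]].
    by rewrite sumr_const_nat subn0 -[_ *+ q]mulr_natl ler_wpM2r// ler_nat ltnW.
  move=> q3; have l0' m : (m < q)%N -> 0 <= l m by exact: l0.
  rewrite (@big_cat_nat _ _ _ (q - 3))//=; last by lia.
  apply: lerD; last first.
    apply: (@le_trans _ _ (\sum_(q - 3 <= m < q) M)).
      by apply: ler_sum_nat => m /andP[_ /gmq/andP[]].
    rewrite sumr_const_nat -[_ *+ _]mulr_natl ler_wpM2r// ler_nat; lia.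
  rewrite [leRHS](@big_cat_nat _ _ _ (q - 2))//=; last by lia.
  rewrite -[leLHS]addr0; apply: lerD; last first.
    by rewrite big_nat_cond; apply: sumr_ge0 => m; rewrite andbT => /andP[_]; exact: l0.
  have -> : (q - 2 = (q - 3).+1)%N by lia.
  rewrite big_nat_recl// -[leLHS]add0r; apply: lerD; first by rewrite l0.
  apply: ler_sum_nat => m /andP[_ mq]; rewrite /l /= leqNgt.
  by have -> : (m.+2 < q)%N by lia.
(* Upper comparison, two cells up. Residue 0 may wrap around to the left and is bounded by [M]; [G]
   continues the lattice values by [M] past the right end. *)
- pose G (m : nat) : R := if (m < q)%N then g (m%:R / q%:R) else M.
  pose u (m : nat) : R := if (m == 0)%N then M else G m.+2.
  have ub n : (n <= q)%N -> g (frac (x0 + n%:R * al)) <= u (r n).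
    move=> nq; have /andP[_ g1] := gfr (x0 + n%:R * al).
    rewrite /u; case: ifPn => // rn0; rewrite /G; case: ifPn => // rnq.
    move: g1; have [d [s [/andP[s1 s2] ->]]] := HW n nq; rewrite -/(r n) => _.
    have h1 : 1 <= (r n)%:R :> R by rewrite ler1n lt0n.
    have h2 : (r n).+2%:R < q%:R :> R by rewrite ltr_nat.
    have h3 : (r n).+2%:R = (r n)%:R + 2 :> R by rewrite -addn2 natrD.
    rewrite frac_lattice//; last by apply/andP; split; lra.
    apply: gm; rewrite ?divr_ge0 ?ler_pM2r ?invr_gt0 ?ltr_pdivrMr ?mul1r//; lra.
  have G0 m : 0 <= G m.
    by rewrite /G; case: ifP => // /gmq/andP[].
  have S : \sum_(1 <= n < q.+1) g (frac (x0 + n%:R * al)) <= \sum_(0 <= m < q) u m.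
    rewrite -(@sum_residues _ u q p%:Z W 1 q0 cop) add1n.
    by apply: ler_sum_nat => n /andP[_ nq]; exact: ub.
  have GE : \sum_(0 <= m < q) g (m%:R / q%:R) = \sum_(0 <= m < q) G m.
    by apply: eq_big_nat => m /andP[_ mq]; rewrite /G mq.
  suff : \sum_(0 <= m < q) u m <= M + (\sum_(0 <= m < q) G m + M + M) by rewrite GE; lra.
  rewrite big_ltn// {1}/u eqxx lerD2l.
  have -> : \sum_(0 <= m < q) G m + M + M = \sum_(0 <= m < q.+2) G m.
    have [Gq Gq1] : G q = M /\ G q.+1 = M by rewrite /G !ltnNge leqnn leqnSn.
    by rewrite !big_nat_recr//= Gq Gq1.
  have -> : \sum_(1 <= m < q) u m = \sum_(3 <= m < q.+2) G m.
    rewrite (big_addn 1 q.+2 2) subn2; apply: eq_big_nat => m /andP[m1 _].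
    by rewrite /u gtn_eqF// addn2.
  rewrite [leRHS](@big_cat_nat _ _ _ 3)//=.
  by rewrite lerDr; apply: sumr_ge0.
Qed.

(* Ostrowski expansion: [N = b_{K-1} q_{K-1} + ... + b_0 q_0] with [b_i <= a_{i+1}] *)
Lemma ostrowski_sum al (g : R -> R) (V : R) (K : nat) : irr al -> 0 <= V ->
  (forall k x0, (k < K)%N -> `|\sum_(1 <= n < (cfq al k).+1) g (x0 + n%:R * al)| <= V) ->
  forall N x0, (N < cfq al K)%N ->
    `|\sum_(1 <= n < N.+1) g (x0 + n%:R * al)| <= V * (sumn (digits al K))%:R.
Proof.
move=> ial V0; elim: K => [|K IH] H N x0.
  by rewrite /cfq /= ltnS leqn0 => /eqP ->; rewrite big_geq// normr0 mulr0.
have {}IH := IH (fun k x0 h => H k x0 (leqW h)).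
have q0 := @cfq_gt0 _ al K ial.
have shift x1 a b : \sum_(1 <= n < (a + b).+1) g (x1 + n%:R * al) =
    \sum_(1 <= n < a.+1) g (x1 + n%:R * al) +
    \sum_(1 <= n < b.+1) g (x1 + a%:R * al + n%:R * al).
  rewrite (@big_cat_nat _ _ _ a.+1)//= ?ltnS ?leq_addr//; congr (_ + _).
  rewrite -{1}[a.+1]addn1 addnC -addnS big_addn addKn.
  by apply: eq_bigr => n _; rewrite natrD; congr g; ring.
have blocks b x1 : `|\sum_(1 <= n < (b * cfq al K).+1) g (x1 + n%:R * al)| <= V * b%:R.
  elim: b => [|b IHb]; first by rewrite mul0n big_geq// normr0 mulr0.
  rewrite mulSnr shift (le_trans (ler_normD _ _))// -natr1 mulrDr mulr1.
  by apply: lerD => //; apply: H.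
move=> NK; rewrite (divn_eq N (cfq al K)) shift (le_trans (ler_normD _ _))//.
rewrite digitsS sumn_rcons addnC natrD mulrDr; apply: lerD; last first.
  by apply: IH; rewrite ltn_mod.
apply: (le_trans (blocks _ _)); rewrite ler_wpM2l// ler_nat.
rewrite -ltnS ltn_divLR//; apply: (leq_trans NK); rewrite cfqS.
have : (cfq_prev al K <= cfq al K)%N by rewrite cfq_prevE cfqE; have [] := wden_le (digits_gt0 K ial).
lia.
Qed.

End DenjoyKoksma.

(** * Stirling's formula and sums over a block *)

Section Logarithm.
Variable R : realType.

Lemma ge1_nondecreasing (f df : R -> R) :
  (forall x : R, 1 <= x -> is_derive x 1 f (df x)) ->
  (forall x : R, 1 <= x -> 0 <= df x) -> forall x : R, 1 <= x -> f 1 <= f x.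
Proof.
move=> fd df0 x x1.
have cont : {within `[(1:R), +oo[, continuous f}.
  by apply: derivable_within_continuous => y; rewrite in_itv/= andbT => y1; have := fd y y1.
apply: (ger0_derive1_ndecry _ _ cont) => // y; rewrite in_itv/= andbT => /ltW y1.
  by have := fd y y1.
by rewrite derive1E; have := fd y y1 => /@derive_val ->; exact: df0.
Qed.

(** This and [ln_le_frac] are sharp to second order at y = 1. At y = (n+1)/n that is what makes the
    increments of the Stirling error summable. *)
Lemma ln_ge_frac (y : R) : 1 <= y -> 2 * (y - 1) / (y + 1) <= ln y.
Proof.
move=> y1.
have H (x : R) : 1 <= x ->
    is_derive x 1 (fun z : R => ln z + 4 * (z + 1)^-1) ((x - 1) ^+ 2 / (x * (x + 1) ^+ 2)).
  move=> x1.
  have x0 : 0 < x by lra.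
  have x10 : x + 1 != 0 by apply: lt0r_neq0; lra.
  have h1 := is_derive1_ln x0.
  have h2 : is_derive x 1 (fun z : R => (z + 1)) 1.
    by apply: is_derive_eq; rewrite addr0.
  have h3 := @is_deriveV R (fun z : R => z + 1) x _ _ x10 h2.
  apply: is_derive_eq; rewrite /= /GRing.scale /=.
  by field; rewrite x10 gt_eqF.
have := @ge1_nondecreasing _ _ H _ y y1; rewrite ln1 => h.
have {}h : 0 + 4 * (1 + 1)^-1 <= ln y + 4 * (y + 1)^-1.
  apply: h => x x1; apply: divr_ge0; first exact: sqr_ge0.
  by apply: mulr_ge0; [lra|exact: sqr_ge0].
have y10 : 0 < y + 1 by lra.
have -> : 2 * (y - 1) / (y + 1) = 2 - 4 * (y + 1)^-1 by field; rewrite gt_eqF.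
have e : 4 * (1 + 1)^-1 = 2 :> R by field.
by move: h; rewrite e; move: (_^-1) => i; lra.
Qed.

Lemma ln_le_frac (y : R) : 1 <= y -> ln y <= (y - y^-1) / 2.
Proof.
move=> y1.
have H (x : R) : 1 <= x ->
    is_derive x 1 (fun z : R => (z + (- z^-1)) + (- (2 * ln z))) ((x^-1 - 1) ^+ 2).
  move=> x1.
  have x0 : 0 < x by lra.
  have xn0 : x != 0 by rewrite gt_eqF.
  have h1 := is_derive1_ln x0.
  have h2 : is_derive x 1 (fun z : R => z) 1 by apply: is_derive_id.
  have h3 := @is_deriveV R (fun z : R => z) x _ _ xn0 h2.
  apply: is_derive_eq; rewrite /= /GRing.scale /=.
  by field.
have := @ge1_nondecreasing _ _ H _ y y1; rewrite ln1 invr1 => h.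
have {}h : 1 + -1 + - (2 * 0) <= y + - y^-1 + - (2 * ln y).
  by apply: h => x x1; exact: sqr_ge0.
by move: h; move: (_^-1) => i; lra.
Qed.

Definition stirling_err (n : nat) : R :=
  ln (n`!)%:R - (n%:R * ln n%:R - n%:R + 2^-1 * ln n%:R).

(** The error starts at 1 and decreases, while the error minus 1/(4n) starts at 3/4 and increases;
    both bounds of [stirling_bound] follow. *)
Lemma stirling_step (n : nat) : (0 < n)%N ->
  stirling_err n.+1 <= stirling_err n /\
  stirling_err n - 4^-1 * (n%:R)^-1 <= stirling_err n.+1 - 4^-1 * (n.+1%:R)^-1.
Proof.
move=> n0; have n0' : 0 < n%:R :> R by rewrite ltr0n.
have nS : n.+1%:R = n%:R + 1 :> R by rewrite natr1.
have fS : ln (n.+1)`!%:R = ln n.+1%:R + ln (n`!)%:R :> R.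
  by rewrite factS natrM lnM ?posrE ?ltr0n ?fact_gt0.
rewrite /stirling_err fS nS.
have lE : ln (n%:R + 1) = ln n%:R + ln ((n%:R + 1) / n%:R) :> R.
  by rewrite -lnM ?posrE ?divr_gt0 ?ltr_wpDr//; congr ln; field; rewrite gt_eqF.
have y1 : 1 <= (n%:R + 1) / n%:R :> R by rewrite ler_pdivlMr// mul1r lerDl.
have hl := ln_ge_frac y1; have hu := ln_le_frac y1.
rewrite lE; move: hl hu; move: (ln (n`!)%:R) (ln n%:R) (ln ((n%:R + 1) / n%:R)) => F l d.
have -> : 2 * ((n%:R + 1) / n%:R - 1) / ((n%:R + 1) / n%:R + 1) = 2 / (2 * n%:R + 1) :> R.
  by field; rewrite !gt_eqF ?addr_gt0 ?mulr_gt0//; lra.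
have -> : ((n%:R + 1) / n%:R - ((n%:R + 1) / n%:R)^-1) / 2 = (2 * n%:R + 1) / (2 * n%:R * (n%:R + 1)) :> R.
  by field; rewrite !gt_eqF ?addr_gt0.
move: n0' => {nS fS lE y1}; move: (n%:R) => x x0 h1 h2.
have h1' : 2 <= d * (2 * x + 1) by rewrite -ler_pdivrMr//; lra.
split; first by lra.
have h3 : d * (x + 2^-1) <= 1 + 4^-1 * x^-1 - 4^-1 * (x + 1)^-1.
  have x10 : 0 < x + 2^-1 by lra.
  apply: (le_trans (ler_wpM2r (ltW x10) h2)).
  rewrite le_eqVlt; apply/orP; left; apply/eqP.
  by field; rewrite !gt_eqF ?addr_gt0.
lra.
Qed.

Lemma stirling_bound (n : nat) : (0 < n)%N -> 0 <= stirling_err n <= 1.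
Proof.
elim: n => // -[|n] IH _.
  by rewrite /stirling_err factS fact0 muln1 ln1; lra.
have /andP[h1 h2] := IH isT; have [h3 h4] := @stirling_step n.+1 isT.
suff [a b] : 3 / 4 + 4^-1 * (n.+2%:R)^-1 <= stirling_err n.+2 /\ stirling_err n.+2 <= 1.
  have : 0 <= (n.+2%:R)^-1 :> R by rewrite invr_ge0.
  by move: a b; move: (n.+2%:R^-1) => i; lra.
split; last by lra.
elim: n.+1 => {n IH h1 h2 h3 h4} [|n IH].
  by rewrite /stirling_err factS fact0 muln1 ln1 invr1; lra.
have [_] := @stirling_step n.+1 isT.
by move: IH; move: (n.+2%:R^-1) (n.+1%:R^-1) => i j; lra.
Qed.

(** The origin of the drift: -n is n times the integral of ln over [0, 1], so the centred lattice
    sum of ln is (ln n)/2 up to a bounded error. *)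
Lemma ln_fact_bounds (n : nat) : (0 < n)%N ->
  - n%:R + 2^-1 * ln n%:R <= \sum_(1 <= m < n.+1) ln (m%:R / n%:R : R) <= - n%:R + 2^-1 * ln n%:R + 1.
Proof.
move=> n0; have n0' : 0 < n%:R :> R by rewrite ltr0n.
have -> : \sum_(1 <= m < n.+1) ln (m%:R / n%:R) = ln (n`!)%:R - n%:R * ln n%:R :> R.
  transitivity (\sum_(1 <= m < n.+1) (ln m%:R - ln n%:R) : R).
    by apply: eq_big_nat => m /andP[m1 _]; rewrite ln_div ?posrE ?ltr0n.
  rewrite sumrB sumr_const_nat subSS subn0 [n%:R * _]mulr_natl; congr (_ - _).
  elim: n {n0 n0'} => [|n IH]; first by rewrite big_geq// fact0 ln1.
  by rewrite big_nat_recr// IH factS natrM lnM ?posrE ?ltr0n ?fact_gt0// addrC.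
have /andP[] := stirling_bound n0; rewrite /stirling_err; lra.
Qed.

End Logarithm.

Section Drift.
Variable R : realType.
Local Notation irr := (@irrational R).
Local Notation frac := (@Pilot.Defs.frac R).

Lemma ln1Bx_ge (t : R) : 0 <= t <= 2^-1 -> - (2 * t) <= ln (1 - t).
Proof.
move=> /andP[t0 t1]; have p : 0 < 1 - t by lra.
have h : -1 < (1 - t)^-1 - 1 by rewrite ltrBrDl subrr invr_gt0.
have := le_ln1Dx h; rewrite addrCA subrr addr0 lnV ?posrE// => h2.
have : (1 - t)^-1 <= 1 + 2 * t.
  by rewrite -[leLHS]mul1r ler_pdivrMr//; nra.
lra.
Qed.

Lemma sum_ln_ratio_rev (Q : nat) :
  \sum_(0 <= r < Q) ln ((Q - r)%:R / Q%:R : R) = \sum_(1 <= m < Q.+1) ln (m%:R / Q%:R).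
Proof.
rewrite big_nat_rev/= add0n [RHS]big_add1/=.
by apply: eq_big_nat => i /andP[_ iQ]; congr (ln (_%:R / _)); lia.
Qed.

Section Block.
Variables (Q : nat) (P W : int) (beta delta : R) (z : nat -> R).
Hypotheses (Q0 : (0 < Q)%N) (cop : coprimez P Q) (beta0 : 0 < beta)
  (delta1 : delta <= 2^-1)
  (zE : forall n, z n = (n%:Z * P + W)%:~R / Q%:R + n%:R * beta).

Let r n : nat := `|((n%:Z * P + W) %% Q%:Z)%Z|%N.

Lemma residue_lt n : (r n < Q)%N.
Proof.
have qz : Q%:Z != 0 by rewrite eqz_nat -lt0n.
have := modz_ge0 (n%:Z * P + W) qz.
have : ((n%:Z * P + W) %% Q%:Z)%Z < Q%:Z by apply: ltz_pmod; rewrite ltz_nat.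
by rewrite /r; case: (_ %% _)%Z.
Qed.

(** While the accumulated motion n beta Q is at most delta <= 1/2 of a cell, the point stays in the
    cell to the right of its lattice point. *)
Lemma frac_residue n : n%:R * beta * Q%:R <= delta ->
  frac (z n) = (r n)%:R / Q%:R + n%:R * beta.
Proof.
move=> nd; have d1 : delta <= 2^-1 := delta1; have bp : 0 < beta := beta0.
have Q0' : 0 < Q%:R :> R by rewrite ltr0n.
have qz : Q%:Z != 0 by rewrite eqz_nat -lt0n.
pose Z := n%:Z * P + W.
have modE : (r n)%:R = Z%:~R - (Z %/ Q%:Z)%Z%:~R * Q%:R :> R.
  have h : (`|(Z %% Q%:Z)%Z|%N%:Z) = (Z %% Q%:Z)%Z by rewrite gez0_abs// modz_ge0.
  rewrite -[LHS]/(`|(Z %% Q%:Z)%Z|%N%:Z%:~R) h.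
  have e : Z%:~R = (Z %/ Q%:Z)%Z%:~R * Q%:R + (Z %% Q%:Z)%Z%:~R :> R.
    by rewrite {1}(divz_eq Z Q%:Z) (rmorphD (intmul 1)) (rmorphM (intmul 1)).
  by rewrite e addrC addKr.
have n0 : 0 <= n%:R * beta by rewrite mulr_ge0// ltW.
have rQ : (r n)%:R + 1 <= Q%:R :> R by rewrite natr1 ler_nat residue_lt.
have -> : (r n)%:R / Q%:R + n%:R * beta = ((r n)%:R + n%:R * beta * Q%:R) / Q%:R.
  by field; rewrite gt_eqF.
rewrite zE -/Z.
have -> : Z%:~R / Q%:R + n%:R * beta = (Z %/ Q%:Z)%Z%:~R + ((r n)%:R + n%:R * beta * Q%:R) / Q%:R.
  by rewrite modE; field; rewrite gt_eqF.
rewrite frac_lattice//; apply/andP; split; first by rewrite addr_ge0// mulr_ge0.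
by apply: lt_le_trans rQ; rewrite ltrD2l; apply: (le_lt_trans nd); apply: (le_lt_trans delta1); lra.
Qed.

(* [r] runs once through all residues mod [Q], so Stirling's formula gives the sums over a block; the term
   [r = 0] is close to the singularity on one side only, whence the opposite half logarithms. *)
Lemma block_ln_frac m : (0 < m)%N -> (m + Q)%:R * beta * Q%:R <= delta ->
  [/\ - 2^-1 * ln Q%:R + ln (Q%:R * m%:R * beta) <= \sum_(m <= n < m + Q) (ln (frac (z n)) + 1)
         <= - 2^-1 * ln Q%:R + 1 + delta * (1 + ln Q%:R) &
      2^-1 * ln Q%:R - 2 * delta * (1 + ln Q%:R) <= \sum_(m <= n < m + Q) (ln (1 - frac (z n)) + 1)
         <= 2^-1 * ln Q%:R + 1].
Proof.
move=> m0 md; have d1 : delta <= 2^-1 := delta1; have bp : 0 < beta := beta0.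
have Q0' : 0 < Q%:R :> R by rewrite ltr0n.
have m0' : 0 < m%:R :> R by rewrite ltr0n.
have nd n : (m <= n < m + Q)%N -> n%:R * beta * Q%:R <= delta.
  move=> /andP[_ nm]; apply: le_trans md; rewrite ler_pM2r// ler_pM2r// ler_nat.
  exact: ltnW.
have npos n : (m <= n < m + Q)%N -> 0 < n%:R :> R.
  by move=> /andP[mn _]; rewrite ltr0n; exact: leq_trans mn.
have /andP[s1 s2] := @ln_fact_bounds R Q Q0.
have sum1 : \sum_(m <= n < m + Q) 1 = Q%:R :> R by rewrite sumr_const_nat addKn.
have d0 : 0 < delta by apply: lt_le_trans md; rewrite !mulr_gt0// ltr0n addn_gt0 m0.
have H : \sum_(1 <= i < Q.+1) (i%:R)^-1 <= 1 + ln Q%:R :> R.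
  by rewrite big_add1; exact: harmonic_sum_le.
have sE : \sum_(1 <= i < Q) ln (i%:R / Q%:R : R) = \sum_(1 <= i < Q.+1) ln (i%:R / Q%:R).
  by rewrite big_nat_recr//= divff ?gt_eqF// ln1 addr0.
have H' : \sum_(1 <= i < Q) (i%:R)^-1 <= 1 + ln Q%:R :> R.
  by apply: le_trans H; rewrite big_nat_recr//= lerDl invr_ge0.
have split0 (u : nat -> R) : \sum_(m <= n < m + Q) u (r n) = u 0%N + \sum_(1 <= i < Q) u i.
  by rewrite /r (@sum_residues _ u Q P W m Q0 cop) big_ltn.
split; rewrite big_split/= sum1; apply/andP; split.
(* Residue 0 is bounded by its position at time [m], and ln(m beta) = ln(Q m beta) - ln Q. The other
   residues give + (ln Q)/2, and this - ln Q turns it into - (ln Q)/2. *)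
- pose u i : R := if i == 0%N then ln (m%:R * beta) else ln (i%:R / Q%:R).
  suff : \sum_(m <= n < m + Q) u (r n) <= \sum_(m <= n < m + Q) ln (frac (z n)).
    rewrite split0 {1}/u eqxx.
    rewrite (_ : \sum_(1 <= i < Q) u i = \sum_(1 <= i < Q) ln (i%:R / Q%:R)); last first.
      by apply: eq_big_nat => i /andP[i1 _]; rewrite /u gtn_eqF.
    rewrite sE -mulrA (lnM (x := Q%:R)) ?posrE ?mulr_gt0//; lra.
  apply: ler_sum_nat => n hn; rewrite frac_residue ?nd// /u.
  have nb : 0 < n%:R * beta by rewrite mulr_gt0// npos.
  case: ifPn => [/eqP ->|rn].
    have mb : 0 < m%:R * beta by rewrite mulr_gt0.
    rewrite mul0r add0r ler_ln ?posrE//.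
    by rewrite ler_pM2r// ler_nat; case/andP: hn.
  have rp : 0 < (r n)%:R / Q%:R :> R by rewrite divr_gt0// ltr0n lt0n.
  by rewrite ler_ln ?posrE ?addr_gt0// lerDl ltW.
(* The motion multiplies i/Q by at most 1 + delta/i, and the harmonic sum yields delta (1 + ln Q);
   for residue 0 the point is still within 1/Q. *)
- pose u i : R := if i == 0%N then - ln Q%:R else ln (i%:R / Q%:R) + delta * (i%:R)^-1.
  suff : \sum_(m <= n < m + Q) ln (frac (z n)) <= \sum_(m <= n < m + Q) u (r n).
    rewrite split0 {1}/u eqxx.
    rewrite (_ : \sum_(1 <= i < Q) u i = \sum_(1 <= i < Q) (ln (i%:R / Q%:R) + delta * (i%:R)^-1)); last first.
      by apply: eq_big_nat => i /andP[i1 _]; rewrite /u gtn_eqF.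
    rewrite big_split/= -mulr_sumr sE.
    have := ler_wpM2l (ltW d0) H'; lra.
  apply: ler_sum_nat => n hn; rewrite frac_residue ?nd// /u.
  have nb : 0 < n%:R * beta by rewrite mulr_gt0// npos.
  have := nd n hn; case: ifPn => [/eqP ->|rn] ndn.
    rewrite mul0r add0r -lnV ?posrE// ler_ln ?posrE ?invr_gt0//.
    by rewrite -[leRHS]mul1r ler_pdivlMr//; lra.
  have rp0 : 0 < (r n)%:R :> R by rewrite ltr0n lt0n.
  have rp : 0 < (r n)%:R / Q%:R :> R by rewrite divr_gt0.
  have -> : (r n)%:R / Q%:R + n%:R * beta = (r n)%:R / Q%:R * (1 + n%:R * beta * Q%:R / (r n)%:R).
    by field; rewrite !gt_eqF.
  have t0 : 0 <= n%:R * beta * Q%:R / (r n)%:R by rewrite divr_ge0// mulr_ge0// ltW.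
  rewrite lnM ?posrE ?ltr_wpDr// lerD2l; apply: (@le_trans _ _ (n%:R * beta * Q%:R / (r n)%:R)).
    by apply: le_ln1Dx; apply: lt_le_trans t0; rewrite ltrN10.
  by rewrite ler_wpM2r// invr_ge0 ltW.
- pose u i : R := ln ((Q - i)%:R / Q%:R) - 2 * delta * ((Q - i)%:R)^-1.
  suff : \sum_(m <= n < m + Q) u (r n) <= \sum_(m <= n < m + Q) ln (1 - frac (z n)).
    rewrite /r (@sum_residues _ u Q P W m Q0 cop) sumrB -mulr_sumr sum_ln_ratio_rev.
    have -> : \sum_(0 <= i < Q) ((Q - i)%:R)^-1 = \sum_(1 <= i < Q.+1) (i%:R)^-1 :> R.
      rewrite big_nat_rev/= add0n [RHS]big_add1/=.
      by apply: eq_big_nat => i /andP[_ iQ]; rewrite subKn.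
    have d20 : 0 <= 2 * delta by lra.
    have := ler_wpM2l d20 H; lra.
  apply: ler_sum_nat => n hn; have ndn := nd n hn; rewrite frac_residue// /u.
  have rl := residue_lt n; have rE : (Q - r n)%:R = Q%:R - (r n)%:R :> R by rewrite natrB// ltnW.
  have r1 : 1 <= (Q - r n)%:R :> R by rewrite ler1n subn_gt0.
  have nb : 0 < n%:R * beta * Q%:R by rewrite !mulr_gt0// npos.
  set y := (Q - r n)%:R in rE r1 *.
  have y0 : 0 < y by lra.
  have -> : 1 - ((r n)%:R / Q%:R + n%:R * beta) = y / Q%:R * (1 - n%:R * beta * Q%:R / y).
    have -> : (r n)%:R = Q%:R - y by rewrite rE; ring.
    by field; rewrite !gt_eqF.
  have t1 : n%:R * beta * Q%:R / y <= delta * y^-1 by rewrite ler_wpM2r// invr_ge0 ltW.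
  have t0 : 0 <= n%:R * beta * Q%:R / y by rewrite divr_ge0// ltW.
  have t2 : delta * y^-1 <= 2^-1.
    apply: le_trans delta1; rewrite -[leRHS]mulr1 ler_wpM2l ?(ltW d0)// invf_le1//.
  have t3 := @ln1Bx_ge (n%:R * beta * Q%:R / y) _.
  rewrite lnM ?posrE ?divr_gt0//; last by rewrite subr_gt0; lra.
  by rewrite lerD2l; apply: le_trans (t3 _); [lra|rewrite t0 (le_trans t1)].
- pose u i : R := ln ((Q - i)%:R / Q%:R).
  suff : \sum_(m <= n < m + Q) ln (1 - frac (z n)) <= \sum_(m <= n < m + Q) u (r n).
    rewrite /r (@sum_residues _ u Q P W m Q0 cop) sum_ln_ratio_rev; lra.
  apply: ler_sum_nat => n hn; have ndn := nd n hn; rewrite frac_residue// /u.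
  have rl := residue_lt n; have rE : (Q - r n)%:R = Q%:R - (r n)%:R :> R by rewrite natrB// ltnW.
  have r1 : 1 <= (Q - r n)%:R :> R by rewrite ler1n subn_gt0.
  have nb : 0 < n%:R * beta * Q%:R by rewrite !mulr_gt0// npos.
  set y := (Q - r n)%:R in rE r1 *.
  have -> : 1 - ((r n)%:R / Q%:R + n%:R * beta) = (y - n%:R * beta * Q%:R) / Q%:R.
    have -> : (r n)%:R = Q%:R - y by rewrite rE; ring.
    by field; rewrite !gt_eqF.
  rewrite ler_ln ?posrE ?divr_gt0//; [|lra|lra].
  by rewrite ler_pM2r ?invr_gt0//; lra.
Qed.

(** Every block but the first starts at some m > Q, where ln(Q m beta) >= - ln a2. In the first
    block m = 1 and the loss is larger by ln Q, which is paid only once. *)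
Lemma full_blocks (a2 : R) (b : nat) : 1 <= a2 -> 1 <= a2 * Q%:R * Q%:R * beta ->
  (b * Q).+1%:R * beta * Q%:R <= delta ->
  `|\sum_(1 <= n < (b * Q).+1) (ln (frac (z n)) + 1) + b%:R * (2^-1 * ln Q%:R)|
     <= b%:R * (1 + delta * (1 + ln Q%:R) + ln a2) + ln Q%:R /\
  `|\sum_(1 <= n < (b * Q).+1) (ln (1 - frac (z n)) + 1) - b%:R * (2^-1 * ln Q%:R)|
     <= b%:R * (1 + 2 * delta * (1 + ln Q%:R)).
Proof.
move=> a21 abeta.
have d1 : delta <= 2^-1 := delta1; have bp : 0 < beta := beta0.
have Q0' : 1 <= Q%:R :> R by rewrite ler1n.
have lQ0 : 0 <= ln Q%:R :> R by rewrite ln_ge0.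
have la0 : 0 <= ln a2 by rewrite ln_ge0.
have step m : (0 < m)%N -> (m + Q)%:R * beta * Q%:R <= delta ->
   (if m == 1%N then - ln a2 - ln Q%:R else if (Q < m)%N then - ln a2 else ln (Q%:R * m%:R * beta))
   <= ln (Q%:R * m%:R * beta).
  move=> m0 md; have m1 : 1 <= m%:R :> R by rewrite ler1n.
  have p : 0 < Q%:R * m%:R * beta by rewrite !mulr_gt0//; lra.
  case: ifPn => [/eqP mE|_].
    rewrite -lnV ?posrE; last lra.
    rewrite -ln_div ?posrE ?invr_gt0; [|lra|lra].
    have i0 : 0 < a2^-1 / Q%:R by rewrite divr_gt0 ?invr_gt0//; lra.
    rewrite ler_ln ?posrE// mE mulr1 ler_pdivrMr; last lra.
    rewrite -[leLHS]mul1r ler_pdivrMr; last lra.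
    by move: abeta; rewrite (_ : Q%:R * beta * _ * _ = a2 * Q%:R * Q%:R * beta)//; ring.
  case: ifPn => // mQ; rewrite -lnV ?posrE; last lra.
  rewrite ler_ln ?posrE ?invr_gt0//; last lra.
  rewrite -[leLHS]mul1r ler_pdivrMr; last lra.
  apply: (le_trans abeta); rewrite (_ : _ * a2 = a2 * Q%:R * m%:R * beta); last by ring.
  by rewrite ler_pM2r// ler_wpM2l ?mulr_ge0 ?ler_nat ?(ltnW mQ)//; lra.
have key c : (c * Q).+1%:R * beta * Q%:R <= delta ->
  [/\ - c%:R * (2^-1 * ln Q%:R + ln a2) - (if c == 0%N then 0 else ln Q%:R) <=
      \sum_(1 <= n < (c * Q).+1) (ln (frac (z n)) + 1),
      \sum_(1 <= n < (c * Q).+1) (ln (frac (z n)) + 1) <= c%:R * (- 2^-1 * ln Q%:R + 1 + delta * (1 + ln Q%:R)),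
      c%:R * (2^-1 * ln Q%:R - 2 * delta * (1 + ln Q%:R)) <= \sum_(1 <= n < (c * Q).+1) (ln (1 - frac (z n)) + 1) &
      \sum_(1 <= n < (c * Q).+1) (ln (1 - frac (z n)) + 1) <= c%:R * (2^-1 * ln Q%:R + 1)].
  elim: c => [|c IH] hc; first by rewrite mul0n !big_geq//= !mulr0n; split; lra.
  have hc' : ((c * Q).+1 + Q)%:R * beta * Q%:R <= delta by rewrite addSn -mulSnr.
  have {}IH : (c * Q).+1%:R * beta * Q%:R <= delta -> _ := IH.
  have [|i1 i2 i3 i4] := IH.
    apply: le_trans hc'; rewrite ler_pM2r; last lra.
    by rewrite ler_pM2r// ler_nat leq_addr.
  have [/andP[b1 b2] /andP[b3 b4]] := @block_ln_frac (c * Q).+1 isT hc'.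
  have b0 := step (c * Q).+1 isT hc'.
  have cat (F : nat -> R) : \sum_(1 <= n < (c.+1 * Q).+1) F n =
     \sum_(1 <= n < (c * Q).+1) F n + \sum_((c * Q).+1 <= n < (c * Q).+1 + Q) F n.
    by rewrite -big_cat_nat//= ?leq_addr// addSn -mulSnr.
  rewrite !cat -[c.+1%:R]natr1.
  have {}b0 : - ln a2 - (if c == 0%N then ln Q%:R else 0) <= ln (Q%:R * (c * Q).+1%:R * beta).
    move: b0; rewrite eqSS muln_eq0 (gtn_eqF Q0) orbF; case: ifP => [_|c0]; first lra.
    by rewrite ltnS leq_pmull ?lt0n ?c0// subr0.
  clear - i1 i2 i3 i4 b0 b1 b2 b3 b4.
  by move: i1 b0; case: (c == 0%N) => i1 b0 /=; split; lra.
move=> hb; have [k1 k2 k3 k4] := key b hb.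
have b0 : 0 <= b%:R :> R by [].
have d0 : 0 <= delta by apply: le_trans hb; rewrite !mulr_ge0// ltW.
have e1 : 0 <= b%:R * ln a2 by rewrite mulr_ge0.
have e2 : 0 <= b%:R * (delta * (1 + ln Q%:R)) by rewrite !mulr_ge0// addr_ge0.
have {}k1 : - b%:R * (2^-1 * ln Q%:R + ln a2) - ln Q%:R <= \sum_(1 <= n < (b * Q).+1) (ln (frac (z n)) + 1).
  by apply: le_trans k1; case: ifP => // _; lra.
clear - k1 k2 k3 k4 e1 e2 lQ0 b0.
by split; rewrite ler_norml; apply/andP; split; lra.
Qed.

End Block.
End Drift.

(** * Functions of bounded variation and the logarithmic singularity *)

Section Diff01.
Variable R : realType.
Local Notation irr := (@irrational R).
Local Notation frac := (@Pilot.Defs.frac R).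
Local Notation dnint := (@Pilot.Defs.dnint R).
Local Notation mu := (@lebesgue_measure R).
Local Notation I01 := (`[0%R, 1%R[%classic : set R).

(** Monotonicity and bounds are asked on the whole line because Riemann sums evaluate at the
    endpoint 1 too; [mono01_extend] supplies this by constants outside [0, 1). *)
Definition mono01 (g : R -> R) (M : R) :=
  {homo g : x y / x <= y} /\ forall x, 0 <= g x <= M.

Definition diff01 (h : R -> R) (M : R) := exists g1 g2,
  [/\ mono01 g1 M, mono01 g2 M & forall x, 0 <= x < 1 -> h x = g1 x - g2 x].

Lemma mono01_le g M M' : mono01 g M -> M <= M' -> mono01 g M'.
Proof.
by move=> [gm g0] MM; split=> // x; have /andP[-> h] := g0 x; exact: le_trans MM.
Qed.

Lemma mono01_extend (g : R -> R) (M : R) :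
  (forall x y, 0 <= x -> x <= y -> y < 1 -> g x <= g y) ->
  (forall x, 0 <= x < 1 -> 0 <= g x <= M) ->
  exists2 g', mono01 g' M & forall x, 0 <= x < 1 -> g' x = g x.
Proof.
move=> gm gM.
exists (fun x => if x < 0 then 0 else if x < 1 then g x else M); last first.
  by move=> x /andP[x0 x1]; rewrite ltNge x0/= x1.
have M0 : 0 <= M by have /andP[] := gM 0 (introT andP (conj (lexx _) ltr01)); apply: le_trans.
split=> [x y xy|x]; last first.
  case: ltP => x0; first by rewrite lexx.
  by case: ltP => x1; [apply: gM; rewrite x0|rewrite M0 lexx].
case: (ltP x 0) => x0.
  case: ltP => y0 //; case: ltP => y1 //.
  by have /andP[] : 0 <= g y <= M by apply: gM; rewrite y0.
rewrite [y < 0]ltNge (le_trans x0 xy)/=; case: (ltP x 1) => x1.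
  case: ltP => y1; first exact: gm.
  by have /andP[] : 0 <= g x <= M by apply: gM; rewrite x0.
by rewrite [y < 1]ltNge (le_trans x1 xy).
Qed.

Lemma measurable_mono01 g M (D : set R) : measurable D -> mono01 g M -> measurable_fun D g.
Proof. by move=> mD [gm _]; apply: nondecreasing_measurable => // x y; exact: gm. Qed.

Lemma mu_I01 : mu I01 = 1%E.
Proof. by rewrite lebesgue_measure_itv/= lte_fin ltr01 oppr0 adde0. Qed.

Lemma bounded_integrable (D : set R) (h : R -> R) (M : R) : measurable D -> D `<=` I01 ->
  measurable_fun D h -> (forall x, D x -> `|h x| <= M) -> mu.-integrable D (EFin \o h).
Proof.
move=> mD dom_sub mh hM; apply: measurable_bounded_integrable => //.
- apply: (@le_lt_trans _ _ (mu I01)); last by rewrite mu_I01 ltry.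
  by apply: le_measure; rewrite ?inE; [exact: mD|exact: measurable_itv|].
- by exists M; split; [exact: num_real|move=> x Mx y Dy; apply: (le_trans (hM _ Dy)); exact: ltW].
Qed.

Lemma mono01_integrable g M : mono01 g M -> mu.-integrable I01 (EFin \o g).
Proof.
move=> gM; apply: (@bounded_integrable _ _ M) => //.
- exact: (measurable_mono01 _ gM).
- by move=> x _; have [_ /(_ x)/andP[g0 g1]] := gM; rewrite ger0_norm.
Qed.

(** The integral lies between the left and the right Riemann sum, and these differ by g(1) - g(0) <=
    M. *)
Lemma mono01_riemann g M q : (0 < q)%N -> mono01 g M ->
  `|\sum_(0 <= m < q) g (m%:R / q%:R) - q%:R * Rintegral mu I01 g| <= M.
Proof.
move=> q0 gM; have [gm g0M] := gM.
have q0' : 0 < q%:R :> R by rewrite ltr0n.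
pose J n : set R := `[0%R, n%:R / q%:R[%classic.
have step n : ((g (n%:R / q%:R) / q%:R)%:E <=
   \int[mu]_(x in `[(n%:R / q%:R)%R, (n.+1%:R / q%:R)%R[) (g x)%:E <= (g (n.+1%:R / q%:R) / q%:R)%:E)%E.
  have muI : mu `[(n%:R / q%:R)%R, (n.+1%:R / q%:R)%R[ = (q%:R^-1)%:E.
    rewrite lebesgue_measure_itv/= lte_fin ltr_pM2r ?invr_gt0// ltr_nat ltnSn -EFinD.
    by congr (_%:E); rewrite -natr1; field; rewrite gt_eqF.
  have mI : measurable (`[(n%:R / q%:R)%R, (n.+1%:R / q%:R)%R[%classic : set R) by exact: measurable_itv.
  have c (r : R) : (\int[mu]_(x in `[(n%:R / q%:R)%R, (n.+1%:R / q%:R)%R[) r%:E)%E = (r / q%:R)%:E.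
    by rewrite integral_cst// EFinM; congr (_ * _)%E; exact: muI.
  rewrite -!c; apply/andP; split; apply: ge0_le_integral => //.
  - by move=> x _; rewrite lee_fin; have /andP[] := g0M (n%:R / q%:R).
  - by apply/measurable_EFinP; exact: (measurable_mono01 _ gM).
  - by move=> x /=; rewrite in_itv/= => /andP[nx _]; rewrite lee_fin; exact: gm.
  - by move=> x _; rewrite lee_fin; have /andP[] := g0M x.
  - by apply/measurable_EFinP; exact: (measurable_mono01 _ gM).
  - by move=> x /=; rewrite in_itv/= => /andP[_ xn]; rewrite lee_fin; apply: gm; exact: ltW.
have key n : (((\sum_(0 <= m < n) g (m%:R / q%:R)) / q%:R)%:E <= \int[mu]_(x in J n) (g x)%:E
   <= ((\sum_(1 <= m < n.+1) g (m%:R / q%:R)) / q%:R)%:E)%E.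
  elim: n => [|n /andP[IH1 IH2]].
    by rewrite /J !mul0r set_itvco0 integral_set0 !big_geq// mul0r lexx.
  have /andP[s1 s2] := step n.
  have nn : n%:R / q%:R <= n.+1%:R / q%:R :> R by rewrite ler_pM2r ?invr_gt0// ler_nat.
  have -> : J n.+1 = J n `|` `[(n%:R / q%:R)%R, (n.+1%:R / q%:R)%R[.
    by rewrite /J -itv_bndbnd_setU// bnd_simp// divr_ge0.
  have mJ : measurable (J n) by exact: measurable_itv.
  have mU : measurable_fun (J n `|` `[(n%:R / q%:R)%R, (n.+1%:R / q%:R)%R[) (EFin \o g).
    by apply/measurable_EFinP; apply: (measurable_mono01 _ gM); apply: measurableU; exact: measurable_itv.
  have U0 x : (J n `|` `[(n%:R / q%:R)%R, (n.+1%:R / q%:R)%R[) x -> (0 <= (EFin \o g) x)%E.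
    by move=> _; rewrite lee_fin; have /andP[] := g0M x.
  have Ud : [disjoint J n & `[(n%:R / q%:R)%R, (n.+1%:R / q%:R)%R[].
    apply/disj_setPS => x []; rewrite /J /= !in_itv/= => /andP[_ a] /andP[b _].
    by have := lt_le_trans a b; rewrite ltxx.
  rewrite (ge0_integral_setU mu (measurable_itv _) (measurable_itv _) mU U0 Ud).
  have -> : \sum_(0 <= m < n.+1) g (m%:R / q%:R) = \sum_(0 <= m < n) g (m%:R / q%:R) + g (n%:R / q%:R).
    by rewrite big_nat_recr.
  have -> : \sum_(1 <= m < n.+2) g (m%:R / q%:R) = \sum_(1 <= m < n.+1) g (m%:R / q%:R) + g (n.+1%:R / q%:R).
    by rewrite big_nat_recr.
  by rewrite !mulrDl !EFinD; apply/andP; split; exact: leeD.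
have := key q; rewrite /J divff ?gt_eqF// => /andP[k1 k2].
have iE : (\int[mu]_(x in I01) (g x)%:E)%E = (Rintegral mu I01 g)%:E.
  rewrite /Rintegral fineK//; exact: integrable_fin_num (mono01_integrable gM).
move: k1 k2; rewrite iE !lee_fin ler_pdivrMr// ler_pdivlMr// [_ * q%:R]mulrC => k1 k2.
have k3 : \sum_(1 <= m < q.+1) g (m%:R / q%:R) <= \sum_(0 <= m < q) g (m%:R / q%:R) + M.
  have -> : \sum_(1 <= m < q.+1) g (m%:R / q%:R) = \sum_(1 <= m < q) g (m%:R / q%:R) + g (q%:R / q%:R).
    by rewrite big_nat_recr.
  have -> : \sum_(0 <= m < q) g (m%:R / q%:R) = g (0%:R / q%:R) + \sum_(1 <= m < q) g (m%:R / q%:R).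
    by rewrite big_ltn.
  have /andP[_ h1] := g0M (q%:R / q%:R); have /andP[h2 _] := g0M (0%:R / q%:R).
  lra.
move: k1 k2 k3; rewrite ler_norml.
move: (\sum_(1 <= m < q.+1) _) (\sum_(0 <= m < q) _) (q%:R * _) => a b c {step key iE J} k1 k2 k3.
by apply/andP; split; lra.
Qed.

Lemma diff01_integrable h M : diff01 h M -> mu.-integrable I01 (EFin \o h).
Proof.
move=> [g1 [g2 [m1 m2 hE]]].
apply: (@eq_integrable _ _ _ mu I01 _ ((EFin \o g1) \- (EFin \o g2))%E) => //.
  by move=> x; rewrite inE/= in_itv/= => /hE ->; rewrite EFinB.
by apply: integrableB => //; [exact: mono01_integrable m1|exact: mono01_integrable m2].
Qed.

Lemma diff01_RintegralE h M g1 g2 : mono01 g1 M -> mono01 g2 M ->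
  (forall x, 0 <= x < 1 -> h x = g1 x - g2 x) ->
  Rintegral mu I01 h = Rintegral mu I01 g1 - Rintegral mu I01 g2.
Proof.
move=> m1 m2 hE; rewrite -RintegralB//; [|exact: mono01_integrable m1|exact: mono01_integrable m2].
by apply: eq_Rintegral => x; rewrite inE/= in_itv/= => /hE.
Qed.

Lemma diff01_riemann h M q : (0 < q)%N -> diff01 h M ->
  `|\sum_(0 <= m < q) h (m%:R / q%:R) - q%:R * Rintegral mu I01 h| <= 2 * M.
Proof.
move=> q0 [g1 [g2 [m1 m2 hE]]]; rewrite (diff01_RintegralE m1 m2 hE).
have -> : \sum_(0 <= m < q) h (m%:R / q%:R) =
  \sum_(0 <= m < q) g1 (m%:R / q%:R) - \sum_(0 <= m < q) g2 (m%:R / q%:R).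
  rewrite -sumrB; apply: eq_big_nat => m /andP[_ mq]; apply: hE.
  by rewrite divr_ge0//= ltr_pdivrMr ?ltr0n// mul1r ltr_nat.
have := mono01_riemann q0 m1; have := mono01_riemann q0 m2.
by rewrite !ler_norml => /andP[? ?] /andP[? ?]; apply/andP; split; lra.
Qed.

(** The constant 8 is 2 * 3 from Denjoy-Koksma for the two monotone parts plus 2 from replacing the
    lattice sum by the integral. *)
Lemma diff01_denjoy_koksma al k x0 h M : irr al -> 0 <= al < 1 -> diff01 h M ->
  `|\sum_(1 <= n < (cfq al k).+1) (h (frac (x0 + n%:R * al)) - Rintegral mu I01 h)| <= 8 * M.
Proof.
move=> ial al01 hM; have [g1 [g2 [m1 m2 hE]]] := hM.
have q0 := @cfq_gt0 _ al k ial.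
rewrite sumrB sumr_const_nat subSS subn0 -[Rintegral _ _ _ *+ _]mulr_natl.
have := diff01_riemann q0 hM.
have hS (F : nat -> R) (a b : nat) : (forall n, 0 <= F n < 1) ->
    \sum_(a <= n < b) h (F n) = \sum_(a <= n < b) g1 (F n) - \sum_(a <= n < b) g2 (F n).
  by move=> F01; rewrite -sumrB; apply: eq_bigr => n _; exact: hE.
rewrite (hS (fun n => frac (x0 + n%:R * al))); last by move=> n; rewrite frac_ge0 frac_lt1.
have -> : \sum_(0 <= m < cfq al k) h (m%:R / (cfq al k)%:R) =
  \sum_(0 <= m < cfq al k) g1 (m%:R / (cfq al k)%:R) - \sum_(0 <= m < cfq al k) g2 (m%:R / (cfq al k)%:R).
  rewrite -sumrB; apply: eq_big_nat => m /andP[_ mq]; apply: hE.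
  by rewrite divr_ge0//= ltr_pdivrMr ?ltr0n// mul1r ltr_nat.
have := @denjoy_koksma R al k x0 g1 M ial al01 (fun x y _ xy _ => m1.1 x y xy) (fun x _ => m1.2 x).
have := @denjoy_koksma R al k x0 g2 M ial al01 (fun x y _ xy _ => m2.1 x y xy) (fun x _ => m2.2 x).
by rewrite !ler_norml => /andP[? ?] /andP[? ?] /andP[? ?]; apply/andP; split; lra.
Qed.

Lemma diff01D h1 h2 M1 M2 : diff01 h1 M1 -> diff01 h2 M2 -> diff01 (fun x => h1 x + h2 x) (M1 + M2).
Proof.
move=> [a1 [b1 [ma1 mb1 e1]]] [a2 [b2 [ma2 mb2 e2]]].
have add f1 f2 : mono01 f1 M1 -> mono01 f2 M2 -> mono01 (fun x => f1 x + f2 x) (M1 + M2).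
  move=> [m1 l1] [m2 l2]; split=> [x y xy|x]; first by apply: lerD; [exact: m1|exact: m2].
  have /andP[u1 u2] := l1 x; have /andP[u3 u4] := l2 x.
  by rewrite addr_ge0//= lerD.
exists (fun x => a1 x + a2 x), (fun x => b1 x + b2 x); split; [exact: add|exact: add|].
by move=> x x01; rewrite e1// e2//; ring.
Qed.

Lemma diff01Z h M c : diff01 h M -> diff01 (fun x => c * h x) (`|c| * M).
Proof.
move=> [a [b [ma mb e]]].
have sc f d : 0 <= d -> mono01 f M -> mono01 (fun x => d * f x) (d * M).
  move=> d0 [m l]; split=> [x y xy|x]; first by rewrite ler_wpM2l// m.
  by have /andP[u1 u2] := l x; rewrite mulr_ge0//= ler_wpM2l.
have [c0|c0] := leP 0 c.
  rewrite (ger0_norm c0).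
  exists (fun x => c * a x), (fun x => c * b x); split; [exact: sc|exact: sc|].
  by move=> x x01; rewrite e//; ring.
have c0' : 0 <= - c by lra.
rewrite (ltr0_norm c0).
exists (fun x => - c * b x), (fun x => - c * a x); split; [exact: sc|exact: sc|].
by move=> x x01; rewrite e//; ring.
Qed.

End Diff01.

Section BoundedVariation.
Variable R : realType.
Local Notation irr := (@irrational R).
Local Notation frac := (@Pilot.Defs.frac R).
Local Notation dnint := (@Pilot.Defs.dnint R).
Local Notation mu := (@lebesgue_measure R).
Local Notation I01 := (`[0%R, 1%R[%classic : set R).

Lemma dnint_ge0 x : 0 <= dnint x.
Proof. by rewrite /dnint le_min frac_ge0 subr_ge0 ltW// frac_lt1. Qed.

Lemma dnint_le_half x : dnint x <= 2^-1.
Proof. by rewrite /dnint ge_min; case: (leP (frac x) 2^-1) => //= h; lra. Qed.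

Lemma dnint_le (k : int) x : dnint x <= `|x - k%:~R|.
Proof.
have f0 := frac_ge0 x; have f1 := frac_lt1 x; have xE := floorE x.
rewrite /dnint ge_min; have [kf|kf] := leP k (Num.floor x).
  have : k%:~R <= (Num.floor x)%:~R :> R by rewrite ler_int.
  by move=> h; apply/orP; left; rewrite ger0_norm; lra.
have : (Num.floor x)%:~R + 1 <= k%:~R :> R by rewrite -intrD1 ler_int; lia.
by move=> h; apply/orP; right; rewrite ler0_norm; lra.
Qed.

Lemma dnint_attained x : exists k : int, dnint x = `|x - k%:~R|.
Proof.
have f0 := frac_ge0 x; have f1 := frac_lt1 x; have xE := floorE x.
rewrite /dnint; have [h|h] := leP (frac x) (1 - frac x).
  by exists (Num.floor x); rewrite {2}xE addrC addKr ger0_norm.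
exists (Num.floor x + 1); rewrite {2}xE intrD ler0_norm; lra.
Qed.

Lemma dnint_lipschitz x y : dnint y <= dnint x + `|y - x|.
Proof.
have [k ->] := dnint_attained x; apply: (le_trans (dnint_le k y)).
have -> : y - k%:~R = (x - k%:~R) + (y - x) by ring.
exact: ler_normD.
Qed.

(** Jordan decomposition t = V - (V - t) with V the total variation from 0, both parts raised by |t
    0| + t 0 to be nonnegative. V is bounded as [BV_01] is uniform in the right end [b < 1]. *)
Lemma BV_diff01 (t : R -> R) : BV_01 t -> exists M, diff01 t M.
Proof.
move=> [M HM].
have M0 : 0 <= M.
  apply: (HM 0 _ 0); first by rewrite lexx ltr01.
  by rewrite variationsxx.
have TVM x : 0 <= x < 1 -> (total_variation 0 x t <= M%:E)%E.
  move=> x01; apply: ge_ereal_sup => _ [v vv <-].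
  by rewrite lee_fin; apply: HM vv.
have TVfin x : 0 <= x < 1 -> total_variation 0 x t = (fine (total_variation 0 x t))%:E.
  move=> x01; rewrite fineK// ge0_fin_numE ?total_variation_ge0//; last by case/andP: x01.
  by apply: le_lt_trans (TVM x x01) _; rewrite ltry.
pose V x := fine (total_variation 0 x t).
have V0M x : 0 <= x < 1 -> 0 <= V x <= M.
  move=> x01; rewrite -!lee_fin -/(V x) /V -TVfin// TVM// andbT.
  by apply: total_variation_ge0; case/andP: x01.
have VD x y : 0 <= x -> x <= y -> y < 1 -> `|t y - t x| <= V y - V x.
  move=> x0 xy y1; have y01 : 0 <= y < 1 by rewrite (le_trans x0 xy).
  have x01 : 0 <= x < 1 by rewrite x0 (le_lt_trans xy).
  have := total_variationD t x0 xy; rewrite (TVfin y)// (TVfin x)// -/(V y) -/(V x).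
  have := total_variation_ge t xy; case: (total_variation x y t) => [r| |]//=.
  by rewrite lee_fin -EFinD => h -[->]; rewrite addrAC subrr add0r.
have V00 : V 0 = 0 by rewrite /V total_variationxx.
pose c := `|t 0|.
have c0 : 0 <= c by exact: normr_ge0.
have tc : - c <= t 0 <= c by rewrite -ler_norml.
have [||g1 m1 e1] := @mono01_extend R (fun x => V x + (c + t 0)) (2 * M + 2 * c).
- move=> x y x0 xy y1; have := VD x y x0 xy y1; rewrite ler_norml; lra.
- move=> x x01; have /andP[h1 h2] := V0M x x01; apply/andP; split; lra.
have [||g2 m2 e2] := @mono01_extend R (fun x => V x - t x + (c + t 0)) (2 * M + 2 * c).
- move=> x y x0 xy y1; have := VD x y x0 xy y1; rewrite ler_norml => /andP[h1 h2]; lra.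
- move=> x x01; have /andP[h1 h2] := V0M x x01; have /andP[x0 x1] := x01.
  have := VD 0 x (lexx _) x0 x1; rewrite V00 subr0 ler_norml => /andP[h3 h4].
  apply/andP; split; lra.
exists (2 * M + 2 * c), g1, g2; split => // x x01.
by rewrite e1// e2//; ring.
Qed.

(** As [dnint] is 1-Lipschitz and at most 1/2, the function has Lipschitz constant 2, and adding 2 x
    makes it nondecreasing. *)
Lemma diff01_ln_dnint (x1 : R) : diff01 (fun x => ln (1 - dnint (x - x1))) 4.
Proof.
have ln_diff (u v : R) : 0 <= u <= 2^-1 -> 0 <= v <= 2^-1 -> ln (1 - u) <= ln (1 - v) + 2 * `|u - v|.
  move=> /andP[u0 u1] /andP[v0 v1]; have [uv|uv] := leP v u.
    have h : ln (1 - u) <= ln (1 - v) by rewrite ler_ln ?posrE; lra.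
    by apply: (le_trans h); rewrite lerDl mulr_ge0.
  have -> : 1 - u = (1 - v) * (1 + (v - u) / (1 - v)) by field; lra.
  have p : 0 <= (v - u) / (1 - v) by rewrite divr_ge0; lra.
  rewrite lnM ?posrE; [|lra|by rewrite ltr_wpDr].
  rewrite lerD2l distrC gtr0_norm; last lra.
  apply: (@le_trans _ _ ((v - u) / (1 - v))).
    by apply: le_ln1Dx; apply: lt_le_trans p; rewrite ltrN10.
  by rewrite ler_pdivrMr; [nra|lra].
have dh x : 0 <= dnint (x - x1) <= 2^-1 by rewrite dnint_ge0 dnint_le_half.
have lb x : - 1 <= ln (1 - dnint (x - x1)) <= 0.
  have /andP[d0 d1] := dh x; apply/andP; split.
    apply: (@le_trans _ _ (- (2 * dnint (x - x1)))); first lra.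
    by apply: ln1Bx_ge; rewrite d0.
  by apply: ln_le0; lra.
have lip x y : x <= y -> ln (1 - dnint (x - x1)) <= ln (1 - dnint (y - x1)) + 2 * (y - x).
  move=> xy; apply: (le_trans (ln_diff _ _ (dh x) (dh y))).
  rewrite lerD2l ler_pM2l// ler_norml.
  have := dnint_lipschitz (x - x1) (y - x1); have := dnint_lipschitz (y - x1) (x - x1).
  have e1 : y - x1 - (x - x1) = y - x by ring.
  have e2 : x - x1 - (y - x1) = - (y - x) by ring.
  by rewrite e1 e2 normrN ger0_norm; [move=> ? ?; apply/andP; split; lra|lra].
have [||g1 m1 e1] := @mono01_extend R (fun x => ln (1 - dnint (x - x1)) + 2 * x + 1) 4.
- move=> x y x0 xy y1; have := lip x y xy; lra.
- move=> x /andP[x0 x1']; have /andP[h1 h2] := lb x; apply/andP; split; lra.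
have [||g2 m2 e2] := @mono01_extend R (fun x => 2 * x + 1) 4.
- by move=> x y x0 xy y1; lra.
- by move=> x /andP[x0 x1']; apply/andP; split; lra.
by exists g1, g2; split => // x x01; rewrite e1// e2//; ring.
Qed.

(* [h] is nondecreasing except for one drop, at [s]. *)
Lemma diff01_one_drop (h : R -> R) (H s : R) :
  (forall x, 0 <= x < 1 -> - H <= h x <= 0) ->
  (forall x y, 0 <= x -> x <= y -> y < 1 -> (s <= x) = (s <= y) -> h x <= h y) ->
  diff01 h (2 * H).
Proof.
move=> hH hm.
have H0 : 0 <= H.
  have /andP[] := hH 0 (introT andP (conj (lexx _) ltr01)); lra.
have jm x y : x <= y -> ((s <= x)%R : nat)%:R * H <= ((s <= y)%R : nat)%:R * H :> R.
  move=> xy; apply: ler_wpM2r => //; rewrite ler_nat.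
  by case: (leP s x) => sx; rewrite ?(le_trans sx xy).
have j01 x : 0 <= ((s <= x)%R : nat)%:R * H <= H.
  by case: (s <= x); rewrite ?mul1r ?mul0r ?lexx ?H0.
have [||g1 m1 e1] := @mono01_extend R (fun x => h x + H + ((s <= x)%R : nat)%:R * H) (2 * H).
- move=> x y x0 xy y1; have [e|e] := eqVneq (s <= x) (s <= y).
    by have := hm x y x0 xy y1 e; rewrite e; lra.
  have x01 : 0 <= x < 1 by rewrite x0 (le_lt_trans xy).
  have y01 : 0 <= y < 1 by rewrite y1 (le_trans x0).
  have /andP[? ?] := hH x x01; have /andP[? ?] := hH y y01.
  have /andP[? ?] := j01 x.
  move: e; case: (leP s x) => sx; first by rewrite (le_trans sx xy).
  by case: (leP s y) => sy //= _; rewrite mul1r mul0r; lra.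
- by move=> x x01; have /andP[? ?] := hH x x01; have /andP[? ?] := j01 x; apply/andP; split; lra.
have [||g2 m2 e2] := @mono01_extend R (fun x => H + ((s <= x)%R : nat)%:R * H) (2 * H).
- by move=> x y _ xy _; rewrite lerD2l jm.
- by move=> x _; have /andP[? ?] := j01 x; apply/andP; split; lra.
by exists g1, g2; split => // x x01; rewrite e1// e2//; ring.
Qed.

Lemma frac_sub (x1 x : R) : 0 <= x < 1 ->
  frac (x - x1) = x - frac x1 + (~~ (frac x1 <= x) : nat)%:R.
Proof.
move=> /andP[x0 x1']; have f0 := frac_ge0 x1; have f1 := frac_lt1 x1; have xE := floorE x1.
case: leP => h /=.
  apply: (@frac_eq _ (- Num.floor x1)); last by rewrite mulr0n; apply/andP; split; lra.
  by rewrite mulrNz {1}xE mulr0n; ring.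
apply: (@frac_eq _ (- Num.floor x1 - 1)); last by apply/andP; split; lra.
by rewrite intrB mulrNz {1}xE; ring.
Qed.

End BoundedVariation.

(** * One-sided logarithms: truncation, lattice sums and integrals *)

Section SideDist.
Variable R : realType.
Local Notation irr := (@irrational R).
Local Notation frac := (@Pilot.Defs.frac R).
Local Notation dnint := (@Pilot.Defs.dnint R).
Local Notation mu := (@lebesgue_measure R).
Local Notation I01 := (`[0%R, 1%R[%classic : set R).

Variables (x1 : R) (d : nat) (w : int).
Hypotheses (d0 : (0 < d)%N) (x1E : x1 = w%:~R / d%:R).

(* distance to the singularity measured from the right ([true]) or from the left ([false]) *)
Definition side_dist (b : bool) (x : R) : R :=
  if b then frac (x - x1) else 1 - frac (x - x1).

(** Cutting off at distance 1/q gives a [diff01] function of size O(ln q), to which Denjoy-Koksma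
    applies, without changing values at points at distance at least 1/q. *)
Definition trunc_log_dist b (q : nat) (x : R) : R := ln (Num.max (side_dist b x) q%:R^-1).

Lemma side_dist01 b x : 0 <= side_dist b x <= 1.
Proof.
have := frac_ge0 (x - x1); have := frac_lt1 (x - x1).
by case: b => /= ? ?; apply/andP; split; lra.
Qed.

Lemma trunc_log_dist_bound b q x : (0 < q)%N -> - ln q%:R <= trunc_log_dist b q x <= 0.
Proof.
move=> q0; have q0' : 0 < q%:R :> R by rewrite ltr0n.
have q1 : 1 <= q%:R :> R by rewrite ler1n.
have i0 : 0 < q%:R^-1 :> R by rewrite invr_gt0.
have /andP[p0 p1] := side_dist01 b x.
rewrite /trunc_log_dist -lnV ?posrE// ler_ln ?posrE// ?lt_max ?i0 ?orbT// le_max lexx orbT /=.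
by apply: ln_le0; rewrite ge_max p1 invf_le1.
Qed.

Lemma trunc_log_dist_diff01 b q : (0 < q)%N -> diff01 (trunc_log_dist b q) (3 * ln q%:R).
Proof.
move=> q0; have q0' : 0 < q%:R :> R by rewrite ltr0n.
have q1 : 1 <= q%:R :> R by rewrite ler1n.
have i0 : 0 < q%:R^-1 :> R by rewrite invr_gt0.
have l0 : 0 <= ln q%:R :> R by rewrite ln_ge0.
have mono c x y : side_dist c x <= side_dist c y -> trunc_log_dist c q x <= trunc_log_dist c q y.
  move=> h; rewrite ler_ln ?posrE ?lt_max ?i0 ?orbT//.
  by rewrite ge_max !le_max h lexx orbT.
have fm x y : 0 <= x -> x <= y -> y < 1 -> (frac x1 <= x) = (frac x1 <= y) ->
    frac (x - x1) <= frac (y - x1).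
  move=> x0 xy y1 e; rewrite !frac_sub; last 2 first.
  - by rewrite y1 (le_trans x0).
  - by rewrite x0 (le_lt_trans xy).
  by rewrite e; lra.
case: b.
  have [| |g1 [g2 [m1 m2 e]]] := @diff01_one_drop R (trunc_log_dist true q) (ln q%:R) (frac x1).
  - by move=> x _; exact: trunc_log_dist_bound.
  - by move=> x y x0 xy y1' e; apply: mono; exact: fm.
  exists g1, g2; split => //; [apply: (mono01_le m1)|apply: (mono01_le m2)]; lra.
(* The distance from the left decreases apart from one upward jump, so its logarithm is negated and
   lowered by ln q to fit [diff01_one_drop]; undoing the shift costs the third ln q. *)
have [| |g1 [g2 [m1 m2 e]]] := @diff01_one_drop R (fun x => - trunc_log_dist false q x - ln q%:R) (ln q%:R) (frac x1).
- by move=> x _; have := trunc_log_dist_bound false x q0; lra.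
- move=> x y x0 xy y1' e; rewrite lerD2r lerN2; apply: mono => /=.
  by rewrite lerD2l lerN2; exact: fm.
exists (fun x => g2 x + 0), (fun x => g1 x + ln q%:R); split.
- by split=> [x y xy|x]; have [gm gM] := m2; [rewrite lerD2r; exact: gm|have /andP[? ?] := gM x; apply/andP; split; lra].
- by split=> [x y xy|x]; have [gm gM] := m1; [rewrite lerD2r; exact: gm|have /andP[? ?] := gM x; apply/andP; split; lra].
- by move=> x x01; have := e x x01; lra.
Qed.

(** As [d] divides [q], the point [x1] lies on the lattice of step 1/q, the distances run through
    multiples of 1/q, and Stirling's bound evaluates the sum. *)
Lemma trunc_log_dist_sum b q : (0 < q)%N -> (d %| q)%N ->
  `|\sum_(0 <= m < q) trunc_log_dist b q (m%:R / q%:R) + q%:R| <= ln q%:R + 1.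
Proof.
move=> q0 /dvdnP[c qE].
have q0' : 0 < q%:R :> R by rewrite ltr0n.
have q1 : 1 <= q%:R :> R by rewrite ler1n.
have l0 : 0 <= ln q%:R :> R by rewrite ln_ge0.
have qz : q%:Z != 0 by rewrite eqz_nat -lt0n.
pose W := - (c%:Z * w).
have x1q : x1 = - W%:~R / q%:R.
  have d0' : 0 < d%:R :> R by rewrite ltr0n.
  have c0' : 0 < c%:R :> R by move: q0; rewrite qE muln_gt0 ltr0n => /andP[].
  rewrite /W mulrNz opprK (rmorphM (intmul 1)) qE natrM x1E /=; field.
  by rewrite !gt_eqF.
have cop : coprimez 1 q%:Z by rewrite /coprimez gcd1z.
pose r n : nat := `|((n%:Z * 1 + W) %% q%:Z)%Z|%N.
have rq n : (r n < q)%N.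
  have := modz_ge0 (n%:Z * 1 + W) qz.
  have : ((n%:Z * 1 + W) %% q%:Z)%Z < q%:Z by apply: ltz_pmod; rewrite ltz_nat.
  by rewrite /r; case: (_ %% _)%Z.
have fr n : frac (n%:R / q%:R - x1) = (r n)%:R / q%:R.
  pose Z := n%:Z * 1 + W.
  have modE : (r n)%:R = Z%:~R - (Z %/ q%:Z)%Z%:~R * q%:R :> R.
    have h : (`|(Z %% q%:Z)%Z|%N%:Z) = (Z %% q%:Z)%Z by rewrite gez0_abs// modz_ge0.
    rewrite -[LHS]/(`|(Z %% q%:Z)%Z|%N%:Z%:~R) h.
    have e : Z%:~R = (Z %/ q%:Z)%Z%:~R * q%:R + (Z %% q%:Z)%Z%:~R :> R.
      by rewrite {1}(divz_eq Z q%:Z) (rmorphD (intmul 1)) (rmorphM (intmul 1)).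
    by rewrite e addrC addKr.
  have -> : n%:R / q%:R - x1 = (Z %/ q%:Z)%Z%:~R + (r n)%:R / q%:R.
    have ZE : Z%:~R = n%:R + W%:~R :> R by rewrite /Z mulr1 (rmorphD (intmul 1)).
    by rewrite modE x1q ZE; field; rewrite gt_eqF.
  by rewrite frac_lattice// ltr_nat rq andbT.
have /andP[s1 s2] := @ln_fact_bounds R q q0.
pose u i : R := if b then ln (Num.max (i%:R / q%:R) q%:R^-1) else ln ((q - i)%:R / q%:R).
have -> : \sum_(0 <= m < q) trunc_log_dist b q (m%:R / q%:R) = \sum_(0 <= i < q) u i.
  rewrite -(@sum_residues _ u q 1 W 0 q0 cop) add0n; apply: eq_big_nat => n _.
  rewrite /trunc_log_dist /side_dist /u; case: (b); first by rewrite fr.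
  have rl := rq n; have rE : (q - r n)%:R = q%:R - (r n)%:R :> R by rewrite natrB// ltnW.
  have r1 : 1 <= (q - r n)%:R :> R by rewrite ler1n subn_gt0.
  rewrite -/(r n) fr (_ : 1 - _ = (q - r n)%:R / q%:R); last by rewrite rE; field; rewrite gt_eqF.
  by congr ln; apply/max_idPl; rewrite -[leLHS]mul1r ler_wpM2r// invr_ge0 ltW.
rewrite /u; case: (b) => {u}.
  have -> : \sum_(0 <= i < q) ln (Num.max (i%:R / q%:R) q%:R^-1) =
     - ln q%:R + \sum_(1 <= m < q.+1) ln (m%:R / q%:R) :> R.
    have -> : \sum_(1 <= m < q.+1) ln (m%:R / q%:R) = \sum_(1 <= m < q) ln (m%:R / q%:R) :> R.
      by rewrite big_nat_recr//= divff ?gt_eqF// ln1 addr0.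
    rewrite big_ltn// mul0r; congr (_ + _).
      by rewrite -lnV ?posrE//; congr ln; apply/max_idPr; rewrite invr_ge0 ltW.
    apply: eq_big_nat => i /andP[i1 _]; congr ln; apply/max_idPl.
    have i1' : 1 <= i%:R :> R by rewrite ler1n.
    by rewrite -[leLHS]mul1r ler_wpM2r// invr_ge0 ltW.
  by rewrite ler_norml; apply/andP; split; lra.
by rewrite sum_ln_ratio_rev ler_norml; apply/andP; split; lra.
Qed.

(** The integral is read off from the lattice sum: 7 is 2 * 3 for the Riemann error of a [diff01]
    function of size 3 ln q, plus 1 for the error of the sum. *)
Lemma trunc_log_dist_int b q : (0 < q)%N -> (d %| q)%N ->
  `|Rintegral mu I01 (trunc_log_dist b q) + 1| <= (7 * ln q%:R + 1) / q%:R.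
Proof.
move=> q0 dq; have q0' : 0 < q%:R :> R by rewrite ltr0n.
have := trunc_log_dist_sum b q0 dq.
have := diff01_riemann q0 (trunc_log_dist_diff01 b q0).
rewrite ler_pdivlMr//.
have -> : `|Rintegral mu I01 (trunc_log_dist b q) + 1| * q%:R =
   `|q%:R * Rintegral mu I01 (trunc_log_dist b q) + q%:R|.
  by rewrite -{1}(gtr0_norm q0') -normrM; congr (`| _ |); ring.
by rewrite !ler_norml => /andP[? ?] /andP[? ?]; apply/andP; split; lra.
Qed.

End SideDist.

Section SideDistIntegrals.
Variable R : realType.
Local Notation frac := (@Pilot.Defs.frac R).
Local Notation mu := (@lebesgue_measure R).
Local Notation I01 := (`[0%R, 1%R[%classic : set R).

Lemma ln_over_id_small (eps : R) : 0 < eps ->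
  exists q0 : nat, forall q : nat, (q0 <= q)%N -> (0 < q)%N -> (7 * ln q%:R + 1) / q%:R <= eps.
Proof.
move=> e0; exists (Num.truncn ((15 / eps) ^+ 2)).+1 => q qq q1.
have q0' : 0 < q%:R :> R by rewrite ltr0n.
have q1' : 1 <= q%:R :> R by rewrite ler1n.
have [s s1 s2] : exists2 s : R, 1 <= s & s ^+ 2 = q%:R.
  exists (Num.sqrt q%:R); last by rewrite sqr_sqrtr// ltW.
  by rewrite -[leLHS]sqrtr1 ler_sqrt.
have s0 : 0 < s by lra.
have ls : ln s <= s by exact: ln_le_id.
have lq : ln q%:R <= 2 * s by rewrite -s2 expr2 lnM ?posrE//; lra.
have hq : (15 / eps) ^+ 2 <= s ^+ 2.
  rewrite s2; apply/ltW/(lt_le_trans (truncnS_gt _)); by rewrite ler_nat.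
have hs : 15 / eps <= s by rewrite -(ler_pXn2r (n := 2))// ?nnegrE ?divr_ge0// ltW.
have hs' : 15 <= s * eps by rewrite -ler_pdivrMr.
rewrite ler_pdivrMr//; have := ler_wpM2l (ltW s0) hs'.
have -> : s * (s * eps) = eps * q%:R by rewrite -s2; ring.
lra.
Qed.

Variables (x1 : R) (d : nat) (w : int).
Hypotheses (d0 : (0 < d)%N) (x1E : x1 = w%:~R / d%:R).

(** At the singularity the distance from the right is 0, where [ln] takes the value 0, and the
    truncations do not converge to it; this one point is removed. *)
Let D : set R := I01 `\ frac x1.
Let L b (x : R) := ln (side_dist x1 b x).
Let T b q := trunc_log_dist x1 b q.

Lemma side_dist_gt0 b x : D x -> 0 < side_dist x1 b x.
Proof.
move=> [/=]; rewrite in_itv/= => x01 xs.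
have f0 := frac_ge0 (x - x1); have f1 := frac_lt1 (x - x1).
case: b => /=; last lra.
rewrite lt_neqAle f0 andbT eq_sym; apply/eqP => h; apply: xs; move: h.
have s1 := frac_lt1 x1; move/andP: x01 => [x0 x1'].
by rewrite frac_sub ?x0//; case: leP => /= h; rewrite ?mulr0n ?mulr1n => ?; lra.
Qed.

Lemma measurable_side_dist b : measurable_fun I01 (side_dist x1 b).
Proof.
have [| |] := @diff01_one_drop R (fun x => frac (x - x1) - 1) 1 (frac x1).
- by move=> x _; have := frac_ge0 (x - x1); have := frac_lt1 (x - x1); move=> ? ?; apply/andP; split; lra.
- move=> x y x0 xy y1 e; rewrite !frac_sub; last 2 first.
  - by rewrite y1 (le_trans x0).
  - by rewrite x0 (le_lt_trans xy).
  by rewrite e; lra.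
move=> g1 [g2 h].
have := @diff01_integrable R (fun x => frac (x - x1) - 1) _ (ex_intro _ g1 (ex_intro _ g2 h)).
move=> /integrableP[/measurable_EFinP mf _].
case: b.
  rewrite (_ : side_dist x1 true = (fun x => (frac (x - x1) - 1) + 1)); last first.
    by apply/funext => x /=; rewrite subrK.
  by apply: measurable_funD => //; exact: measurable_cst.
rewrite (_ : side_dist x1 false = (fun x => - (frac (x - x1) - 1))); last first.
  by apply/funext => x /=; ring.
exact: measurableT_comp.
Qed.

Lemma measurable_log_dist b : measurable_fun I01 (L b).
Proof. exact: measurableT_comp (@measurable_ln R) (measurable_side_dist b). Qed.

Lemma measurable_dom : measurable D.
Proof. by apply: measurableD; [exact: measurable_itv|exact: measurable_set1]. Qed.

Lemma dom_sub : D `<=` I01. Proof. by move=> x []. Qed.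

Lemma log_dist_le0 b x : L b x <= 0.
Proof. by apply: ln_le0; have /andP[] := side_dist01 x1 b x. Qed.

Lemma trunc_ge_log b q x : (0 < q)%N -> D x -> L b x <= T b q x.
Proof.
move=> q0 Dx; have p := side_dist_gt0 b Dx.
by rewrite ler_ln ?posrE ?lt_max ?p// le_max lexx.
Qed.

Lemma trunc_eq_log b q x : (0 < q)%N -> q%:R^-1 <= side_dist x1 b x -> T b q x = L b x.
Proof. by move=> q0 h; congr ln; apply/max_idPl. Qed.

Lemma trunc_nonincr b p q x : (0 < p)%N -> (p <= q)%N -> T b q x <= T b p x.
Proof.
move=> p0 pq; have q0 : (0 < q)%N by lia.
have p0' : 0 < p%:R :> R by rewrite ltr0n.
have q0' : 0 < q%:R :> R by rewrite ltr0n.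
rewrite ler_ln ?posrE ?lt_max ?invr_gt0 ?p0' ?q0' ?orbT//.
rewrite ge_max !le_max lexx /=; apply/orP; right.
by rewrite lef_pV2 ?posrE// ler_nat.
Qed.

Lemma measurable_trunc b q : (0 < q)%N -> measurable_fun I01 (T b q).
Proof.
move=> q0; have /integrableP[/measurable_EFinP] := diff01_integrable (trunc_log_dist_diff01 x1 b q0).
by [].
Qed.

Lemma integral_trunc_log_dist b q : (0 < q)%N ->
  (\int[mu]_(x in D) (- T b q x)%:E = (- Rintegral mu I01 (T b q))%:E)%E.
Proof.
move=> q0.
have i1 := diff01_integrable (trunc_log_dist_diff01 x1 b q0).
have m1 := measurable_trunc b q0.
have mN : measurable_fun I01 (fun x => - T b q x) by exact: measurableT_comp.
rewrite integral_setD1; last 2 first.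
- exact: measurable_dom.
- by apply/measurable_EFinP; apply: measurable_funS mN => //; exact: dom_sub.
rewrite /Rintegral EFinN fineK; last exact: integrable_fin_num i1.
transitivity (\int[mu]_(x in I01) - (T b q x)%:E)%E; first by apply: eq_integral => x _; rewrite EFinN.
by rewrite integralN//; exact: integrable_add_def i1.
Qed.

(** Monotone convergence along the multiples of [d], where [trunc_log_dist_int] gives the integrals
    of the truncations up to a vanishing error. *)
Lemma integral_neg_log_dist b : (\int[mu]_(x in D) (- L b x)%:E = 1)%E.
Proof.
pose q k := (d * k.+1)%N.
have q0 k : (0 < q k)%N by rewrite muln_gt0 d0.
have mD := measurable_dom.
pose phi k (x : R) : \bar R := (- T b (q k) x)%:E.
have mphi k : measurable_fun D (phi k).
  apply/measurable_EFinP; apply: measurableT_comp => //.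
  by apply: measurable_funS (measurable_trunc b (q0 k)) => //; exact: dom_sub.
have phi0 k x : D x -> (0 <= phi k x)%E.
  by move=> _; rewrite lee_fin oppr_ge0; have /andP[] := trunc_log_dist_bound x1 b x (q0 k).
have phinc x : D x -> {homo phi^~ x : n m / (n <= m)%N >-> (n <= m)%E}.
  move=> _ n m nm; rewrite lee_fin lerN2; apply: trunc_nonincr => //.
  by rewrite leq_mul2l ltnS nm orbT.
have lim x : D x -> limn (phi^~ x) = (- L b x)%:E.
  move=> Dx; apply/cvg_lim => //; apply: cvg_near_cst.
  have p := side_dist_gt0 b Dx.
  exists (Num.truncn (side_dist x1 b x)^-1) => // k /= hk.
  rewrite /phi trunc_eq_log//.
  have h : (side_dist x1 b x)^-1 <= (q k)%:R.
    apply/ltW/(lt_le_trans (truncnS_gt _)); rewrite ler_nat /q.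
    apply: (@leq_trans k.+1); first by rewrite ltnS.
    by rewrite leq_pmull.
  by rewrite -[leRHS]invrK lef_pV2 ?posrE ?ltr0n ?invr_gt0.
have E : (\int[mu]_(x in D) (- L b x)%:E)%E = limn (fun k => \int[mu]_(x in D) phi k x)%E.
  rewrite -(monotone_convergence mu mD mphi phi0 phinc).
  by apply: eq_integral => x; rewrite inE => /lim ->.
have bd k : `|(- Rintegral mu I01 (T b (q k))) - 1| <= (7 * ln (q k)%:R + 1) / (q k)%:R.
  rewrite -normrN opprB addrC opprK; rewrite [X in `|X|]addrC.
  by have := @trunc_log_dist_int R x1 d w d0 x1E b (q k) (q0 k) (dvdn_mulr _ (dvdnn d)); rewrite addrC.
have nondec : {homo (fun k => \int[mu]_(x in D) phi k x)%E : n m / (n <= m)%N >-> (n <= m)%E}.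
  move=> n m nm; apply: ge0_le_integral => //.
  - exact: phi0.
  - exact: mphi.
  - exact: mphi.
  - by move=> x Dx; exact: (phinc x Dx n m nm).
have small (eps : R) : 0 < eps -> exists k, forall m, (k <= m)%N -> (7 * ln (q m)%:R + 1) / (q m)%:R <= eps.
  move=> e0; have [k hk] := ln_over_id_small e0; exists k => m km; apply: hk => //.
  by rewrite /q; nia.
rewrite E; apply/eqP; rewrite eq_le; apply/andP; split.
  apply: lime_le; first exact: ereal_nondecreasing_is_cvgn.
  apply: nearW => k; rewrite integral_trunc_log_dist// lee_fin; apply/ler_addgt0Pr => eps e0.
  have [m hm] := small eps e0.
  have := nondec k (maxn k m) (leq_maxl _ _); rewrite !integral_trunc_log_dist// lee_fin => h.
  have := bd (maxn k m); have := hm (maxn k m) (leq_maxr _ _).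
  by rewrite ler_norml => ? /andP[? ?]; lra.
apply/lee_addgt0Pr => eps e0.
have [m hm] := small eps e0.
have h : (\int[mu]_(x in D) phi m x <= limn (fun k => \int[mu]_(x in D) phi k x))%E.
  rewrite (cvg_lim _ (ereal_nondecreasing_cvgn nondec))//.
  by apply: ereal_sup_ubound; exists m.
apply: (@le_trans _ _ ((\int[mu]_(x in D) phi m x) + eps%:E)%E); last by rewrite leeD2r.
rewrite integral_trunc_log_dist// -EFinD lee_fin; have := bd m; have := hm m (leqnn m).
by rewrite ler_norml => ? /andP[? ?]; lra.
Qed.

Lemma log_dist_integrable b : mu.-integrable I01 (EFin \o L b).
Proof.
have mL := measurable_log_dist b.
apply/integrableP; split; first exact/measurable_EFinP.
rewrite -(@integral_setD1 R _ (frac x1)); last 2 first.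
- exact: measurable_dom.
- apply: measurableT_comp => //; apply/measurable_EFinP.
  by apply: measurable_funS mL => //; exact: dom_sub.
rewrite (_ : (\int[mu]_(x in _) _)%E = (\int[mu]_(x in D) (- L b x)%:E)%E).
  by rewrite integral_neg_log_dist ltry.
by apply: eq_integral => x _; rewrite /= ler0_norm// log_dist_le0.
Qed.

Lemma Rintegral_log_dist b : Rintegral mu I01 (L b) = - 1.
Proof.
have mL := measurable_log_dist b.
have iL := log_dist_integrable b.
have H : (\int[mu]_(x in I01) - (L b x)%:E = 1)%E.
  rewrite -(integral_neg_log_dist b) integral_setD1//; first exact: measurable_dom.
  apply/measurable_EFinP; apply: measurableT_comp => //.
  by apply: measurable_funS mL => //; exact: dom_sub.
rewrite /Rintegral -[X in fine X]oppeK -integralN ?H//.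
exact: integrable_add_def iL.
Qed.

(** Split |L| <= |T| + (T - L) with T the truncation: |T| <= ln q, and T - L is nonnegative off the
    singularity, so its integral over [A] is at most the one over [0, 1), the integral of T plus
    1. *)
Lemma log_dist_integral_le b (A : set R) q : measurable A -> A `<=` I01 -> (0 < q)%N -> (d %| q)%N ->
  (\int[mu]_(x in A) `|L b x|%:E <= (ln q%:R)%:E * mu A + ((7 * ln q%:R + 1) / q%:R)%:E)%E.
Proof.
move=> mA AI q0 dq.
have mL := measurable_log_dist b.
have mT := measurable_trunc b q0.
have iT := diff01_integrable (trunc_log_dist_diff01 x1 b q0).
have iL := log_dist_integrable b.
have l0 : 0 <= ln q%:R :> R by rewrite ln_ge0// ler1n.
have mAD : measurable (A `\ frac x1) by apply: measurableD => //; exact: measurable_set1.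
have ADD : A `\ frac x1 `<=` D by move=> x [/AI ? ?]; split.
have ADI : A `\ frac x1 `<=` I01 by move=> x [/AI].
have mv : measurable_fun I01 (fun x => T b q x - L b x) by exact: measurable_funB.
rewrite -(@integral_setD1 R _ (frac x1)); last 2 first.
- exact: mAD.
- by apply/measurable_EFinP; apply: measurableT_comp => //; apply: measurable_funS mL.
apply: (@le_trans _ _ (\int[mu]_(x in A `\ frac x1) ((ln q%:R)%:E + (T b q x - L b x)%:E))%E).
  apply: ge0_le_integral => //.
  - by apply/measurable_EFinP; apply: measurableT_comp => //; apply: measurable_funS mL.
  - by apply: emeasurable_funD => //; apply/measurable_EFinP; apply: measurable_funS mv.
  - move=> x xA; rewrite -EFinD lee_fin ler0_norm ?log_dist_le0//.
    by have /andP[] := trunc_log_dist_bound x1 b x q0; rewrite -/(T b q x); lra.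
rewrite ge0_integralD//; last 2 first.
- by move=> x /ADD Dx; rewrite lee_fin subr_ge0 trunc_ge_log.
- by apply/measurable_EFinP; apply: measurable_funS mv.
apply: leeD.
  rewrite integral_cst//; apply: lee_pmul => //.
  by apply: le_measure; rewrite ?inE; [exact: mAD|exact: mA|move=> x []].
apply: (@le_trans _ _ (\int[mu]_(x in D) (T b q x - L b x)%:E)%E).
  apply: ge0_subset_integral => //; first exact: measurable_dom.
  - by apply/measurable_EFinP; apply: measurable_funS mv => //; exact: dom_sub.
  - by move=> x Dx; rewrite lee_fin subr_ge0 trunc_ge_log.
rewrite integral_setD1; last 2 first.
- exact: measurable_dom.
- by apply/measurable_EFinP; apply: measurable_funS mv => //; exact: dom_sub.
have -> : (\int[mu]_(x in I01) (T b q x - L b x)%:E = (Rintegral mu I01 (T b q) - Rintegral mu I01 (L b))%:E)%E.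
  rewrite -RintegralB// /Rintegral fineK//.
  exact: integrable_fin_num (integrableB _ iT iL).
rewrite Rintegral_log_dist lee_fin opprK.
by apply: le_trans (@trunc_log_dist_int R x1 d w d0 x1E b q q0 dq); exact: ler_norm.
Qed.

End SideDistIntegrals.

(** * Logarithmic sums along the orbit *)

Section OrbitLogSums.
Variable R : realType.
Local Notation irr := (@irrational R).
Local Notation frac := (@Pilot.Defs.frac R).
Local Notation dnint := (@Pilot.Defs.dnint R).
Local Notation mu := (@lebesgue_measure R).
Local Notation I01 := (`[0%R, 1%R[%classic : set R).

Lemma side_dist_periodic b x : side_dist 0 b (frac x) = side_dist 0 b x :> R.
Proof.
rewrite /side_dist !subr0; suff -> : frac (frac x) = frac x by [].
by apply: (@frac_eq _ 0); rewrite ?add0r// frac_ge0 frac_lt1.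
Qed.

(** The summand is centred by + 1, as the logarithm has integral -1. The constant 31 is 8 * 3 from
    Denjoy-Koksma plus 7 from the integral of the truncation. *)
Lemma trunc_block_sum al k b (y : R) q : irr al -> 0 <= al < 1 -> (0 < q)%N -> (cfq al k <= q)%N ->
  `|\sum_(1 <= n < (cfq al k).+1) (trunc_log_dist 0 b q (y + n%:R * al) + 1)| <= 31 * ln q%:R + 1.
Proof.
move=> ial al01 q0 kq.
have q0' : 0 < q%:R :> R by rewrite ltr0n.
have l0 : 0 <= ln q%:R :> R by rewrite ln_ge0// ler1n.
have h1 := @diff01_denjoy_koksma R al k y _ _ ial al01 (trunc_log_dist_diff01 (0 : R) b q0).
have e0 : (0 : R) = 0%:~R / 1%:R by rewrite mul0r.
have := @trunc_log_dist_int R 0 1 0 isT e0 b q q0 (dvd1n q).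
set I := Rintegral _ _ _ in h1 * => h2.
have -> : \sum_(1 <= n < (cfq al k).+1) (trunc_log_dist 0 b q (y + n%:R * al) + 1) =
  \sum_(1 <= n < (cfq al k).+1) (trunc_log_dist 0 b q (frac (y + n%:R * al)) - I) + (cfq al k)%:R * (I + 1).
  have -> : (cfq al k)%:R * (I + 1) = \sum_(1 <= n < (cfq al k).+1) (I + 1).
    by rewrite sumr_const_nat subSS subn0 mulr_natl.
  rewrite -big_split; apply: eq_bigr => n _.
  rewrite (_ : trunc_log_dist 0 b q (frac _) = trunc_log_dist 0 b q (y + n%:R * al)).
    by rewrite /=; ring.
  by rewrite /trunc_log_dist side_dist_periodic.
apply: (le_trans (ler_normD _ _)).
have h3 : `|(cfq al k)%:R * (I + 1)| <= 7 * ln q%:R + 1.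
  rewrite normrM normr_nat; apply: (@le_trans _ _ (q%:R * ((7 * ln q%:R + 1) / q%:R))).
    by apply: ler_pM => //; rewrite ler_nat.
  by rewrite mulrC divfK// gt_eqF.
lra.
Qed.

Variables (al : R) (K v : nat) (u : int) (delta : R).
Hypotheses (ial : irr al) (al01 : 0 <= al < 1) (v0 : (0 < v)%N) (vQ : (v %| cfq al K)%N)
  (delta1 : delta <= 2^-1).

Let Q := cfq al K.
Let a := cfa al K.+1.
Let z (n : nat) : R := u%:~R / v%:R + n%:R * al.
(** The factor (-1)^K makes the motion off the lattice point to the right for both parities, so the
    block estimates apply to [zz]; for odd [K] this reflection exchanges the two one-sided
    distances. *)
Let bt : R := (-1) ^+ K * cferr al K.
Let zz (n : nat) : R := (-1) ^+ K * z n.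
Let P : int := (-1) ^+ K * (cfnum al K)%:Z.
Let W : int := (-1) ^+ K * (u * (Q %/ v)%N%:Z).
(** Its inverse bounds all distances to the singularity from below: [bt] exceeds 1/(Q (q_(K+1) +
    Q)), and q_(K+1) + Q <= (a + 2) Q. *)
Let qh := ((a + 2) * Q * Q)%N.

Lemma Q_gt0 : (0 < Q)%N. Proof. exact: cfq_gt0. Qed.

Lemma qh_gt0 : (0 < qh)%N.
Proof. by rewrite /qh !muln_gt0 Q_gt0 addn2. Qed.

Lemma zzE n : zz n = (n%:Z * P + W)%:~R / Q%:R + n%:R * bt.
Proof.
have Q0' : 0 < Q%:R :> R by rewrite ltr0n Q_gt0.
have v0' : 0 < v%:R :> R by rewrite ltr0n.
have QE : Q%:R = (Q %/ v)%N%:R * v%:R :> R by rewrite -natrM divnK.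
have c0 : 0 < (Q %/ v)%N%:R :> R by move: Q0'; rewrite QE pmulr_lgt0.
rewrite (rmorphD (intmul 1)) (rmorphM (intmul 1)) /P /W !(rmorphM (intmul 1)) /= !(rmorphXn (intmul 1)) /=.
rewrite (rmorphN1 (intmul 1)) /zz /z /bt /cferr -/Q.
have -> : u%:~R / v%:R = u%:~R * (Q %/ v)%N%:R / Q%:R :> R.
  by rewrite QE; field; rewrite !gt_eqF.
by field; rewrite gt_eqF.
Qed.

Lemma coprimez_PQ : coprimez P Q%:Z.
Proof.
rewrite /coprimez /gcdz /P abszM abszX /= exp1n mul1n.
by have := coprimez_cfnum al K; rewrite /coprimez /gcdz.
Qed.

Lemma bt_bounds : [/\ 0 < bt, bt * (Q%:R * (cfq al K.+1)%:R) <= 1 &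
  1 <= (a + 2)%:R * Q%:R * Q%:R * bt].
Proof.
have Q0' : 0 < Q%:R :> R by rewrite ltr0n Q_gt0.
have q1 : 0 < (cfq al K.+1)%:R :> R by rewrite ltr0n cfq_gt0.
have /andP[h1 h2] := @cferr_bound R al K ial al01.
rewrite -/bt -/Q in h1 h2.
have h3 : 0 < Q%:R * ((cfq al K.+1)%:R + Q%:R) :> R by rewrite mulr_gt0// addr_gt0.
have b0 : 0 < bt by apply: lt_trans h1; rewrite invr_gt0.
split => //.
  by rewrite -ler_pdivlMr ?mulr_gt0// div1r ltW.
have h4 : 1 <= bt * (Q%:R * ((cfq al K.+1)%:R + Q%:R)).
  by rewrite -ler_pdivrMr// div1r ltW.
apply: (le_trans h4); rewrite mulrC ler_pM2r// -mulrA mulrCA ler_pM2l//.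
rewrite -!natrM -natrD ler_nat cfqS -/Q -/a.
have h5 : (cfq_prev al K <= Q)%N by rewrite /Q cfq_prevE cfqE; have [] := wden_le (digits_gt0 K ial).
by rewrite mulnDl -addnA leq_add2l mul2n -addnn leq_add2r.
Qed.

(** Residue 0 occurs once among the first Q times, and that point is at distance n bt <= Q bt <=
    1/q_(K+1). *)
Lemma close_return : exists n, (0 < n <= Q)%N /\ dnint (z n) <= (cfq al K.+1)%:R^-1.
Proof.
have Q0 := Q_gt0; have Q0' : 0 < Q%:R :> R by rewrite ltr0n.
have q1 : 0 < (cfq al K.+1)%:R :> R by rewrite ltr0n cfq_gt0.
have [b0 b1 _] := bt_bounds.
have [n n1 nr] : exists2 n, (0 < n <= Q)%N & ((n%:Z * P + W) %% Q%:Z = 0)%Z.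
  have := @sum_residues nat (fun r => (r == 0%N) : nat) Q P W 1 Q0 coprimez_PQ.
  move=> h0; have h : \sum_(1 <= n < 1 + Q) (`|((n%:Z * P + W) %% Q%:Z)%Z|%N == 0%N : nat) = 1%N.
    rewrite h0; case: (Q) Q0 => // j _; rewrite big_nat_recl//= big1//.
  have [[n n1 nr]|no] := pselect (exists2 n, (1 <= n < 1 + Q)%N & `|((n%:Z * P + W) %% Q%:Z)%Z|%N == 0%N).
    by exists n; [rewrite -ltnS -add1n|apply/eqP; rewrite -absz_eq0].
  move: h; rewrite big_nat big1// => n nn.
  by case: eqP => // /eqP e; case: no; exists n.
exists n; split => //; have /andP[n0 nQ] := n1.
have zE : zz n = ((n%:Z * P + W) %/ Q%:Z)%Z%:~R + n%:R * bt.
  rewrite zzE {1}(divz_eq (n%:Z * P + W) Q%:Z) nr addr0 (rmorphM (intmul 1)) /=.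
  by rewrite mulfK// gt_eqF.
move: zE; set m := (_ %/ _)%Z => zE.
apply: (le_trans (dnint_le ((-1) ^+ K * m) (z n))).
have -> : z n - ((-1) ^+ K * m)%:~R = (-1) ^+ K * (n%:R * bt).
  rewrite (rmorphM (intmul 1)) /= (rmorphXn (intmul 1)) /= (rmorphN1 (intmul 1)).
  have -> : n%:R * bt = zz n - m%:~R by rewrite zE; ring.
  by rewrite mulrBr; congr (_ - _); rewrite /zz mulrA -exprMn mulrNN mulr1 expr1n mul1r.
have nb0 : 0 <= n%:R * bt by rewrite mulr_ge0// ltW.
rewrite normrM normrX normrN1 expr1n mul1r ger0_norm//.
apply: (@le_trans _ _ (Q%:R * bt)); first by rewrite ler_pM2r// ler_nat.
by rewrite -[leRHS]mul1r ler_pdivlMr//; apply: le_trans b1; rewrite [leRHS]mulrCA mulrA.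
Qed.

(** On the right the motion n bt >= bt keeps the point off the singularity. On the left at least
    half a cell, 1/(2Q), remains because n bt Q <= delta <= 1/2. *)
Lemma side_dist_ge n c : (0 < n)%N -> n%:R <= delta * (cfq al K.+1)%:R ->
  side_dist 0 c (z n) = side_dist 0 (c (+) odd K) (zz n) /\
  (qh%:R)^-1 <= side_dist 0 c (z n).
Proof.
move=> n0 nd.
have d1 : delta <= 2^-1 := delta1.
have Q0 := Q_gt0; have Q0' : 0 < Q%:R :> R by rewrite ltr0n.
have Q1' : 1 <= Q%:R :> R by rewrite ler1n.
have n1 : 1 <= n%:R :> R by rewrite ler1n.
have q1 : 0 < (cfq al K.+1)%:R :> R by rewrite ltr0n cfq_gt0.
have [b0 b1 b2] := bt_bounds.
have nbd : n%:R * bt * Q%:R <= delta.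
  have -> : n%:R * bt * Q%:R = n%:R * (bt * Q%:R) by ring.
  apply: (@le_trans _ _ (delta * (cfq al K.+1)%:R * (bt * Q%:R))).
    by rewrite ler_pM2r// mulr_gt0.
  have -> : delta * (cfq al K.+1)%:R * (bt * Q%:R) = delta * (bt * (Q%:R * (cfq al K.+1)%:R)) by ring.
  rewrite -[leRHS]mulr1 ler_wpM2l//.
  by have : 0 < delta * (cfq al K.+1)%:R; [lra|rewrite pmulr_lgt0// => /ltW].
have fr := @frac_residue R Q P W bt delta zz Q0 b0 delta1 zzE n nbd.
have rl := @residue_lt Q P W Q0 n.
move: fr rl; set r := `|_|%N => fr rl.
have nb0 : 0 < n%:R * bt by rewrite mulr_gt0//; lra.
have f0 : 0 < frac (zz n) by rewrite fr ltr_wpDl// divr_ge0.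
have f1 := frac_lt1 (zz n).
have swap : side_dist 0 c (z n) = side_dist 0 (c (+) odd K) (zz n).
  rewrite /side_dist !subr0 /zz -signr_odd; case: (boolP (odd K)) => [oK|eK] /=.
    have fz : frac (z n) = 1 - frac (zz n).
      apply: (@frac_eq _ (- Num.floor (zz n) - 1)); last by apply/andP; split; lra.
      have := floorE (zz n); rewrite {1}/zz -signr_odd oK expr1 mulN1r => h.
      by rewrite intrB mulrNz; lra.
    have zE : -1 * z n = zz n by rewrite /zz -signr_odd oK expr1.
    rewrite expr1 zE fz.
    by case: c => /=; [|rewrite opprB addrC subrK].
  by rewrite expr0 mul1r addbF.
split=> //; rewrite swap.
have h0 : 0 < (a + 2)%:R * Q%:R * Q%:R :> R by rewrite !mulr_gt0// ltr0n addn2.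
have qhE : qh%:R = (a + 2)%:R * Q%:R * Q%:R :> R by rewrite /qh !natrM.
have lo : qh%:R^-1 <= frac (zz n).
  rewrite fr; apply: (@le_trans _ _ bt).
    by rewrite qhE -[leLHS]mul1r ler_pdivrMr// mulrC.
  have : bt <= n%:R * bt by rewrite ler_peMl// ltW.
  have : 0 <= r%:R / Q%:R :> R by rewrite divr_ge0.
  lra.
have hi : qh%:R^-1 <= 1 - frac (zz n).
  rewrite fr; have rE : r%:R + 1 <= Q%:R :> R by rewrite natr1 ler_nat.
  have -> : 1 - (r%:R / Q%:R + n%:R * bt) = (Q%:R - r%:R - n%:R * bt * Q%:R) / Q%:R.
    by field; rewrite gt_eqF.
  apply: (@le_trans _ _ (2^-1 / Q%:R)); last by rewrite ler_pM2r ?invr_gt0//; lra.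
  rewrite -invfM lef_pV2 ?posrE ?mulr_gt0//; last by rewrite qhE.
  have a2 : 2 <= (a + 2)%:R :> R by rewrite ler_nat leq_addl.
  rewrite qhE -mulrA; apply: ler_pM => //.
  by rewrite -[leLHS]mulr1 ler_pM2l.
by rewrite /side_dist !subr0; case: ifP.
Qed.

(** The floor(N/Q) complete blocks give the drift; the remaining N mod Q points are shorter than a
    period and are bounded through an Ostrowski expansion. The sign depends on [c (+) odd K] because
    of the reflection. *)
Lemma log_sum_drift N c : N.+1%:R <= delta * (cfq al K.+1)%:R ->
  `|\sum_(1 <= n < N.+1) (ln (side_dist 0 c (z n)) + 1)
     - (if c (+) odd K then -1 else 1) * ((N %/ Q)%N%:R * (2^-1 * ln Q%:R))|
  <= (N %/ Q)%N%:R * (1 + 2 * delta * (1 + ln Q%:R) + ln (a + 2)%:R) + ln Q%:R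
     + (31 * ln qh%:R + 1) * (sumn (digits al K))%:R.
Proof.
move=> Nd; have d1 : delta <= 2^-1 := delta1.
have Q0 := Q_gt0; have Q0' : 0 < Q%:R :> R by rewrite ltr0n.
have Q1' : 1 <= Q%:R :> R by rewrite ler1n.
have lQ0 : 0 <= ln Q%:R :> R by rewrite ln_ge0.
have q1 : 0 < (cfq al K.+1)%:R :> R by rewrite ltr0n cfq_gt0.
have d0 : 0 <= delta.
  have : 0 < delta * (cfq al K.+1)%:R by apply: lt_le_trans Nd; rewrite ltr0n.
  by rewrite pmulr_lgt0// => /ltW.
have [b0 b1 b2] := bt_bounds.
set b := (N %/ Q)%N.
have bN : (b * Q <= N)%N by exact: leq_trunc_div.
have nN n : (n <= N.+1)%N -> n%:R <= delta * (cfq al K.+1)%:R.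
  by move=> nn; apply: le_trans Nd; rewrite ler_nat.
have a21 : 1 <= (a + 2)%:R :> R by rewrite ler1n addn2.
have la0 : 0 <= ln (a + 2)%:R :> R by rewrite ln_ge0.
have hb : (b * Q).+1%:R * bt * Q%:R <= delta.
  have -> : (b * Q).+1%:R * bt * Q%:R = (b * Q).+1%:R * (bt * Q%:R) by ring.
  apply: (@le_trans _ _ (delta * (cfq al K.+1)%:R * (bt * Q%:R))).
    have p : 0 < bt * Q%:R by exact: mulr_gt0.
    by rewrite ler_pM2r//; apply: nN; rewrite ltnS.
  have -> : delta * (cfq al K.+1)%:R * (bt * Q%:R) = delta * (bt * (Q%:R * (cfq al K.+1)%:R)) by ring.
  by rewrite -[leRHS]mulr1 ler_wpM2l.
have [f1 f2] := @full_blocks R Q P W bt delta zz Q0 coprimez_PQ b0 delta1 zzE (a + 2)%:R b a21 b2 hb.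
have full : `|\sum_(1 <= n < (b * Q).+1) (ln (side_dist 0 c (z n)) + 1)
     - (if c (+) odd K then -1 else 1) * (b%:R * (2^-1 * ln Q%:R))|
     <= b%:R * (1 + 2 * delta * (1 + ln Q%:R) + ln (a + 2)%:R) + ln Q%:R.
  have -> : \sum_(1 <= n < (b * Q).+1) (ln (side_dist 0 c (z n)) + 1) =
     \sum_(1 <= n < (b * Q).+1) (ln (side_dist 0 (c (+) odd K) (zz n)) + 1).
    apply: eq_big_nat => n /andP[n0 nb].
    have nn : n%:R <= delta * (cfq al K.+1)%:R.
      by apply: nN; apply: leqW; apply: leq_trans bN; rewrite -ltnS.
    by have [-> _] := @side_dist_ge n c n0 nn.
  have bR : 0 <= b%:R :> R by [].
  have p1 : 0 <= b%:R * ln (a + 2)%:R :> R by rewrite mulr_ge0.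
  have p2 : 0 <= b%:R * (delta * (1 + ln Q%:R)) by rewrite !mulr_ge0// addr_ge0.
  case: (c (+) odd K); rewrite /side_dist.
    have -> : \sum_(1 <= n < (b * Q).+1) (ln (frac (zz n - 0)) + 1) = \sum_(1 <= n < (b * Q).+1) (ln (frac (zz n)) + 1).
      by apply: eq_bigr => n _; rewrite subr0.
    by rewrite mulN1r opprK; apply: (le_trans f1); lra.
  have -> : \sum_(1 <= n < (b * Q).+1) (ln (1 - frac (zz n - 0)) + 1) = \sum_(1 <= n < (b * Q).+1) (ln (1 - frac (zz n)) + 1).
    by apply: eq_bigr => n _; rewrite subr0.
  by rewrite mul1r; apply: (le_trans f2); lra.
(* All orbit points involved are at distance at least 1/qh, so the truncated logarithm may be
   substituted in the incomplete block. *)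
have splitS : \sum_(1 <= n < N.+1) (ln (side_dist 0 c (z n)) + 1) =
   \sum_(1 <= n < (b * Q).+1) (ln (side_dist 0 c (z n)) + 1) +
   \sum_(1 <= n < (N %% Q).+1) (trunc_log_dist 0 c qh (z (b * Q)%N + n%:R * al) + 1).
  rewrite (@big_cat_nat _ _ _ (b * Q).+1)//=; congr (_ + _).
  have NE : (N.+1 - b * Q = (N %% Q).+1)%N.
    have {1}-> : N = (b * Q + N %% Q)%N by exact: divn_eq.
    by rewrite -addnS addKn.
  rewrite -[X in \sum_(X <= _ < _) _]add1n big_addn NE.
  apply: eq_big_nat => n /andP[n0 nN'].
  have zE : z (b * Q)%N + n%:R * al = z (n + b * Q)%N by rewrite /z natrD; ring.
  rewrite zE /trunc_log_dist; congr (ln _ + _); apply/esym/max_idPl.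
  have nm : (n + b * Q <= N)%N by rewrite [leqRHS](divn_eq N Q) -/b addnC leq_add2l -ltnS.
  have nn : (n + b * Q)%N%:R <= delta * (cfq al K.+1)%:R by apply: nN; exact: leqW.
  have np : (0 < n + b * Q)%N by rewrite addn_gt0 n0.
  by have [] := @side_dist_ge (n + b * Q)%N c np nn.
rewrite splitS.
have part : `|\sum_(1 <= n < (N %% Q).+1) (trunc_log_dist 0 c qh (z (b * Q)%N + n%:R * al) + 1)|
   <= (31 * ln qh%:R + 1) * (sumn (digits al K))%:R.
  have lqh : 0 <= ln qh%:R :> R by rewrite ln_ge0// ler1n qh_gt0.
  apply: (@ostrowski_sum R al (fun x => trunc_log_dist 0 c qh x + 1) _ K ial); first lra.
    move=> k y kK; apply: trunc_block_sum => //; first exact: qh_gt0.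
    apply: (@leq_trans Q); first by apply: cfq_homo => //; exact: ltnW.
    by rewrite /qh leq_pmull// muln_gt0 addn2 Q0.
  by rewrite ltn_mod.
set X := \sum_(1 <= n < (b * Q).+1) _ in full *.
set Y := \sum_(1 <= n < (N %% Q).+1) _ in part *.
have -> : forall s : R, X + Y - s = (X - s) + Y by move=> s; ring.
by apply: (le_trans (ler_normD _ _)); exact: lerD.
Qed.

End OrbitLogSums.

(** * Splitting into two one-sided logarithms and a part of bounded variation *)

Section Decomposition.
Variable R : realType.
Local Notation irr := (@irrational R).
Local Notation frac := (@Pilot.Defs.frac R).
Local Notation dnint := (@Pilot.Defs.dnint R).
Local Notation mu := (@lebesgue_measure R).
Local Notation I01 := (`[0%R, 1%R[%classic : set R).

Lemma ratr_fraction (x : rat) : exists (w : int) (d : nat),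
  (0 < d)%N /\ ratr x = w%:~R / d%:R :> R.
Proof.
have [n d _] := ratP x; exists n, d.+1; split=> //.
by rewrite fmorph_div/= ratr_nat ratr_int.
Qed.

Lemma dnint_side (x1 x : R) : dnint (x - x1) = Num.min (side_dist x1 true x) (side_dist x1 false x).
Proof. by []. Qed.

Lemma digit_sum_real (al : R) K :
  \sum_(1 <= i < K.+1) ((cfa al i)%:R : R) = (sumn (digits al K))%:R.
Proof.
elim: K => [|K IH]; first by rewrite big_geq.
by rewrite digitsS sumn_rcons natrD -IH big_nat_recr.
Qed.

Lemma Kof_eq (al : R) K N : irr al -> (cfq al K <= N < cfq al K.+1)%N -> Kof al N = K.+1.
Proof.
move=> ial KN; rewrite /Kof; case: xgetP => [j _ /andP[h1 h2]|h]; last by exfalso; apply: (h K.+1); exact: KN.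
have /andP[k1 k2] := KN.
have hj : (j <= K.+1)%N.
  rewrite leqNgt; apply/negP => Kj; case: j Kj h1 {h2} => // j Kj h1; have h : (cfq al j <= N)%N := h1.
  by  have := leq_trans (leq_ltn_trans h k2) (@cfq_homo R al K.+1 j ial Kj); rewrite ltnn.
have hK : (K.+1 <= j)%N.
  rewrite leqNgt; apply/negP; rewrite ltnS => jK.
  by have := leq_trans h2 (leq_trans (@cfq_homo R al j K ial jK) k1); rewrite ltnn.
by apply/eqP; rewrite eqn_leq hj.
Qed.

(** Modulo 1 the set may wrap around, so it is covered by three intervals of length 2 g, around s, s
    - 1 and s + 1. *)
Lemma mu_near_set (x1 g : R) (A : set R) : measurable A -> 0 <= g -> A `<=` I01 ->
  (forall x, A x -> dnint (x - x1) < g) -> g <= 1 -> (mu A <= (6 * g)%:E)%E.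
Proof.
move=> mA g0 AI Ag g1; set s := frac x1.
have s0 : 0 <= s by exact: frac_ge0.
have s1 : s < 1 by exact: frac_lt1.
pose J (c : R) : set R := `]c - g, c + g[%classic.
have mJ c : measurable (J c) by exact: measurable_itv.
have muJ c : mu (J c) = (2 * g)%:E.
  rewrite lebesgue_measure_itv/= lte_fin; case: ltP => h; last first.
    by congr (_%:E); lra.
  by rewrite -EFinD; congr (_%:E); ring.
have sub : A `<=` J s `|` (J (s - 1) `|` J (s + 1)).
  move=> x Ax; have := Ag x Ax; have [k ->] := dnint_attained (x - x1).
  have := AI x Ax; rewrite /= in_itv/= => /andP[x0 x1'].
  have xE : x - x1 - k%:~R = x - s - (k + Num.floor x1)%:~R.
    by rewrite intrD /s /Pilot.Defs.frac; ring.
  rewrite xE; move: (k + _) => j; rewrite ltr_norml => /andP[h1 h2].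
  have j1 : (j < 2)%R by rewrite -(ltr_int R); lra.
  have j2 : (-2 < j)%R by rewrite -(ltr_int R); lra.
  have : j = 0 \/ j = 1 \/ j = -1 by clear -j1 j2; lia.
  move: h1 h2 => + + [|[|]] jE; rewrite jE ?mulr0z ?mulr1z ?mulrN1z => h1 h2.
  - by left; rewrite /J /= in_itv/=; apply/andP; split; lra.
  - by right; right; rewrite /J /= in_itv/=; apply/andP; split; lra.
  - by right; left; rewrite /J /= in_itv/=; apply/andP; split; lra.
have mU : measurable (J (s - 1) `|` J (s + 1)) by apply: measurableU; exact: mJ.
apply: (@le_trans _ _ (mu (J s `|` (J (s - 1) `|` J (s + 1))))).
  by apply: le_measure; rewrite ?inE; [exact: mA|by apply: measurableU; [exact: mJ|exact: mU]|].
apply: (@le_trans _ _ (mu (J s) + mu (J (s - 1)%R `|` J (s + 1)%R))%E).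
  by apply: measureU2; [exact: mJ|exact: mU].
have -> : (6 * g)%:E = (mu (J s) + (mu (J (s - 1)%R) + mu (J (s + 1)%R)))%E.
  by rewrite !muJ -!EFinD; congr (_%:E); ring.
by rewrite leeD2l//; apply: measureU2; exact: mJ.
Qed.

Variables (f : R -> R) (x1 q : rat) (c1 c2 : R) (t : R -> R).
Hypothesis (hf : log_sing_fun f x1 c1 c2 t).

Let X1 : R := ratr x1.
Let A := c1 + c2.
Let B := c1.
(** The numbers {y} and 1 - {y} are ||y|| and 1 - ||y|| in some order, so ln ||y|| = ln {y} + ln (1
    - {y}) - ln (1 - ||y||). The last term is Lipschitz and joins [t]; the rest gives A = c1 + c2
    and B = c1. *)
Let th (x : R) : R := t x - c1 * ln (1 - dnint (x - X1)).

Lemma log_sing_decomp x :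
  f x = A * ln (side_dist X1 true x) + B * ln (side_dist X1 false x) + th x.
Proof.
have [_ _ _ _ /(_ x)[h1 h2]] := hf; rewrite -/X1 in h1 h2.
rewrite /th /side_dist; have f0 := frac_ge0 (x - X1); have f1 := frac_lt1 (x - X1).
have [e|e] := eqVneq (frac (x - X1)) 0.
  (* At the singularity [ln 0 = 0] and [ln 1 = 0], so both logarithms vanish and the formula reduces
     to f = t. *)
  rewrite (h2 e) /Pilot.Defs.dnint e subr0 ln0// ln1 min_l//.
  by rewrite subr0 ln1; ring.
have fp : 0 < frac (x - X1) by rewrite lt_neqAle eq_sym e.
rewrite (h1 e) /A /B /Pilot.Defs.dnint; move: (frac (x - X1)) fp f1 => y y0 y1.
case: (leP y (1 - y)) => h; first by ring.
by have -> : 1 - (1 - y) = y; ring.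
Qed.

Lemma th_periodic x : th (x + 1) = th x.
Proof.
have [_ _ tp _ _] := hf; rewrite /th tp; congr (_ - _ * ln (1 - _)).
by rewrite /Pilot.Defs.dnint addrAC (frac_addz 1).
Qed.

Lemma th_frac x : th (frac x) = th x.
Proof.
have natp n y : th (y + n%:R) = th y.
  by elim: n => [|n IH]; rewrite ?addr0// -natr1 addrA th_periodic.
have intp (k : int) y : th (y + k%:~R) = th y.
  case: k => n; first exact: natp.
  by rewrite NegzE mulrNz -[in RHS](subrK n.+1%:R y) natp.
by rewrite /Pilot.Defs.frac -mulrNz intp.
Qed.

Lemma th_diff01 : exists M, diff01 th M.
Proof.
have [_ _ _ /BV_diff01[M hM] _] := hf.
exists (M + `|- c1| * 4).
have := diff01D hM (diff01Z (- c1) (diff01_ln_dnint X1)).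
move=> [g1 [g2 [m1 m2 e]]]; exists g1, g2; split=> // x x01.
by rewrite -e// /th mulNr.
Qed.

Lemma th_bound M : diff01 th M -> forall x, `|th x| <= M.
Proof.
move=> [g1 [g2 [[_ m1] [_ m2] e]]] x; rewrite -th_frac e ?frac_ge0 ?frac_lt1//.
have /andP[? ?] := m1 (frac x); have /andP[? ?] := m2 (frac x).
by rewrite ler_norml; apply/andP; split; lra.
Qed.

Variables (w : int) (d : nat).
Hypotheses (d0 : (0 < d)%N) (X1E : X1 = w%:~R / d%:R).

Let L b (x : R) := ln (side_dist X1 b x).

Lemma AL_integrable c b : mu.-integrable I01 (EFin \o (fun x => c * L b x)).
Proof.
have iL := log_dist_integrable d0 X1E b.
apply: (@eq_integrable _ _ _ mu I01 _ (fun x => c%:E * (EFin \o L b) x)%E) => //.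
exact: integrableZl.
Qed.

Lemma log_part_integrable : mu.-integrable I01 (EFin \o (fun x => A * L true x + B * L false x)).
Proof.
apply: (@eq_integrable _ _ _ mu I01 _ ((EFin \o (fun x => (A * L true x)%R)) \+ (EFin \o (fun x => (B * L false x)%R)))%E) => //.
by apply: integrableD => //; exact: AL_integrable.
Qed.

Lemma th_integrable : mu.-integrable I01 (EFin \o th).
Proof. by have [M hM] := th_diff01; exact: diff01_integrable hM. Qed.

Lemma f_integrable : mu.-integrable I01 (EFin \o f).
Proof.
apply: (@eq_integrable _ _ _ mu I01 _ ((EFin \o (fun x => (A * L true x + B * L false x)%R)) \+ (EFin \o th))%E) => //.
  by move=> x _ /=; rewrite -EFinD log_sing_decomp.
by apply: integrableD => //; [exact: log_part_integrable|exact: th_integrable].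
Qed.

Lemma Rintegral_f0 : Rintegral mu I01 f = 0.
Proof. by have [_ h _ _ _] := hf; rewrite /Rintegral h. Qed.

(** Each logarithm has integral -1 and f has integral 0. Hence S_N(f) is a combination of three
    separately centred sums. *)
Lemma Rintegral_th : Rintegral mu I01 th = A + B.
Proof.
have := Rintegral_f0.
have -> : Rintegral mu I01 f = Rintegral mu I01 (fun x => (A * L true x + B * L false x) + th x).
  by apply: eq_Rintegral => x _; rewrite log_sing_decomp.
rewrite RintegralD//; [|exact: log_part_integrable|exact: th_integrable].
rewrite RintegralD//; [|exact: AL_integrable|exact: AL_integrable].
have ZL c b : Rintegral mu I01 (fun x => c * L b x) = - c.
  have iL := log_dist_integrable d0 X1E b.
  rewrite RintegralZl//; rewrite (Rintegral_log_dist d0 X1E b).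
  by rewrite mulrN1.
rewrite !ZL; lra.
Qed.

(** The truncation level q' is left free; it is taken later as d q_(K+1), comparable to 1/g. *)
Lemma intA_bound (g : R) (q' : nat) M : 0 <= g <= 1 -> (0 < q')%N -> (d %| q')%N -> diff01 th M ->
  `|Rintegral mu (I01 `&` [set x | dnint (x - X1) < g]) f| <=
  (`|A| + `|B|) * (ln q'%:R * (6 * g) + (7 * ln q'%:R + 1) / q'%:R) + M * (6 * g).
Proof.
move=> /andP[g0 g1] q0 dq hM.
set S := (I01 `&` _).
have M0 : 0 <= M by apply: le_trans (th_bound hM 0).
have SI : S `<=` I01 by move=> x [].
have mS : measurable S.
  have m1 := measurable_side_dist X1 true; have m2 := measurable_side_dist X1 false.
  have mm : measurable_fun I01 (fun x => Num.min (side_dist X1 true x) (side_dist X1 false x)) by exact: measurable_minr.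
  have := mm (measurable_itv _) (`]-oo, g[%classic) (measurable_itv _).
  by congr (measurable _); apply/seteqP; split=> x [xI /=]; rewrite in_itv/= => h; split.
have muS : (mu S <= (6 * g)%:E)%E.
  by apply: (@mu_near_set X1 g) => // x [].
have iS : mu.-integrable S (EFin \o f).
  apply: (@integrableS _ _ _ mu I01 S (EFin \o f)); [exact: measurable_itv|exact: mS|exact: SI|exact: f_integrable].
apply: (le_trans (le_normr_Rintegral _ iS)) => //.
have q0' : 1 <= q'%:R :> R by rewrite ler1n.
have l0 : 0 <= ln q'%:R :> R by rewrite ln_ge0.
pose E := ln q'%:R * (6 * g) + (7 * ln q'%:R + 1) / q'%:R.
have E0 : 0 <= E by rewrite /E addr_ge0// ?mulr_ge0// ?divr_ge0//; lra.
have LE b : (\int[mu]_(x in S) `|L b x|%:E <= E%:E)%E.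
  apply: (le_trans (log_dist_integral_le d0 X1E b mS SI q0 dq)).
  by rewrite /E EFinD leeD2r// EFinM; apply: lee_pmul => //; rewrite lee_fin.
have mL b : measurable_fun S (fun x => `|L b x|%:E).
  apply/measurable_EFinP; apply: measurableT_comp => //.
  by apply: (measurable_funS _ SI (measurable_log_dist X1 b)); exact: measurable_itv.
have mcL (c : R) b : measurable_fun S (fun x => (c%:E * `|L b x|%:E)%E) by exact: measurable_funeM (mL b).
have mLM : measurable_fun S (fun x => (`|B|%:E * `|L false x|%:E + M%:E)%E).
  by apply: emeasurable_funD; [exact: mcL|exact: measurable_cst].
have mf : measurable_fun S (fun x => `|f x|%:E).
  apply/measurable_EFinP; apply: measurableT_comp => //.
  by apply/measurable_EFinP; exact: (measurable_int _ iS).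
have key : (\int[mu]_(x in S) `|f x|%:E <= ((`|A| + `|B|) * E + M * (6 * g))%:E)%E.
  apply: (@le_trans _ _ (\int[mu]_(x in S) (`|A|%:E * `|L true x|%:E + (`|B|%:E * `|L false x|%:E + M%:E)))%E).
    apply: ge0_le_integral => //.
    - by apply: emeasurable_funD; [exact: mcL|exact: mLM].
    - move=> x _; rewrite -!EFinM -!EFinD lee_fin log_sing_decomp.
      apply: (le_trans (ler_normD _ _)); rewrite addrA; apply: lerD; last exact: th_bound.
      by apply: (le_trans (ler_normD _ _)); rewrite !normrM.
  have mL1 : measurable_fun S (fun x => `|L true x|%:E) := mL true.
  have mL2 : measurable_fun S (fun x => `|L false x|%:E) := mL false.
  rewrite ge0_integralD//; last 2 first.
  - exact: mcL.
  - by move=> x _; rewrite -EFinM -EFinD lee_fin addr_ge0// mulr_ge0.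
  rewrite ge0_integralD//; last exact: (mcL (`|B|) false).
  rewrite ge0_integralZl// ge0_integralZl//.
  have -> : (\int[mu]_(x in S) M%:E = M%:E * mu S)%E by exact: integral_cst.
  have -> : ((`|A| + `|B|) * E + M * (6 * g))%:E = (`|A|%:E * E%:E + (`|B|%:E * E%:E + M%:E * (6 * g)%:E))%E.
    by rewrite -!EFinM -!EFinD; congr (_%:E); ring.
  apply: leeD; first by apply: lee_pmul => //; apply: integral_ge0.
  by apply: leeD; apply: lee_pmul => //; apply: integral_ge0.
have fE : (Rintegral mu S (fun x => `|f x|))%:E = (\int[mu]_(x in S) `|f x|%:E)%E.
  rewrite /Rintegral fineK// ge0_fin_numE; last by apply: integral_ge0 => x _; rewrite lee_fin.
  by have /integrableP[_] := iS.
by move: key; rewrite -fE lee_fin.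
Qed.

End Decomposition.

(** * Density *)

(* [x = ln q_K], [a = a_{K+1}], [nb] is the number of full blocks of length [q_K], [sK] the sum of the first
   [K] digits; every error term is at most a small multiple of [nb * x]. *)
Lemma drift_dominates (R : realType) (c G M C2 k L del C x a nb sK lqh la S sf sumK NI : R) :
  0 < c -> 0 < G -> 0 <= M -> 0 <= C2 -> 0 < k <= 1 -> 0 <= del <= 2^-1 -> 16 * G * del = c ->
  16 * (3 * G + M) * C = c * k -> 8 * (101 * G + 32 * M + C2) <= c * (k * L) -> 2 <= L ->
  L <= a -> L <= 2 * x -> L * la <= 2 * x -> lqh <= 3 * x -> 0 <= sK -> L * sK <= a ->
  k * a <= nb -> 0 <= sumK <= 2 * a -> sf <= 3 * G * x + M -> NI <= C2 * x ->
  `|S - c * (nb * (2^-1 * x))| <= G * (nb * (1 + 2 * del * (1 + x) + la) + x + (31 * lqh + 1) * sK)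
     + 8 * M * sumK ->
  C * sf * sumK + NI <= S.
Proof.
move=> c0 G0 M0 C20 /andP[k0 k1] /andP[d0 d1] dE CE LE L2 La Lx Lla lq sK0 LsK knb /andP[s0 s1] sfb NIb.
have L0 : 0 < L by lra.
have x1 : 1 <= x by lra.
have x0 : 0 < x by lra.
have GM0 : 0 < 3 * G + M by lra.
have d2 : 2 * del <= 1 by lra.
have a0 : 0 < a by lra.
have nb0 : 0 < nb by apply: lt_le_trans knb; exact: mulr_gt0.
have [y yE] : exists y, y = nb * x by exists (nb * x).
have y0 : 0 < y by rewrite yE mulr_gt0.
have [i i0 iE] : exists2 i, 0 < i & L * i = 1 by exists L^-1; rewrite ?invr_gt0// divff// gt_eqF.
have [j j0 jE] : exists2 j, 0 < j & k * j = 1 by exists k^-1; rewrite ?invr_gt0// divff// gt_eqF.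
have j1 : 1 <= j by rewrite -jE ler_piMl// ltW.
(* With i = 1/L and j = 1/k, E is the drift scale nb x divided by k L: the unit in which all
   negligible errors are measured. *)
have [E EE] : exists E, E = i * j * y by exists (i * j * y).
have E0 : 0 < E by rewrite EE !mulr_gt0.
have iyE : i * y <= E by rewrite EE mulrAC ler_peMr// mulr_ge0 ?ltW.
have anb : a <= nb * j by have := ler_wpM2r (ltW j0) knb; rewrite mulrAC jE mul1r.
have t1 : nb <= 2 * E.
  have : nb * (L * i) <= nb * (2 * x * i) by rewrite ler_pM2l// ler_pM2r.
  by rewrite iE; have := iyE; rewrite yE; clear; lra.
have t2 : nb * la <= 2 * E.
  have : nb * (L * la * i) <= nb * (2 * x * i) by rewrite ler_pM2l// ler_pM2r.
  have -> : nb * (L * la * i) = nb * la * (L * i) by ring.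
  by rewrite iE; have := iyE; rewrite yE; clear; lra.
have t3 : x <= E.
  have h : L * i <= nb * j * i by rewrite ler_pM2r// (le_trans La).
  have : 1 * x <= nb * j * i * x by rewrite ler_pM2r// -iE.
  by rewrite EE yE; clear; lra.
have sKb : sK <= nb * j * i.
  have : L * sK * i <= nb * j * i by rewrite ler_pM2r// (le_trans LsK).
  have -> : L * sK * i = sK * (L * i) by ring.
  by rewrite iE mulr1.
have t4 : (31 * lqh + 1) * sK <= 94 * E.
  apply: (@le_trans _ _ (94 * x * sK)); first by apply: ler_wpM2r => //; clear - lq x1; lra.
  have : 94 * x * sK <= 94 * x * (nb * j * i) by rewrite ler_pM2l// mulr_gt0.
  by rewrite EE yE; clear; lra.
have t5 : a <= 2 * E.
  apply: (le_trans anb).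
  have : nb * j * (L * i) <= nb * j * (2 * x * i) by rewrite ler_pM2l ?mulr_gt0// ler_pM2r.
  by rewrite iE EE yE; clear; lra.
have C0 : 0 < C.
  by have : 0 < 16 * (3 * G + M) * C; [rewrite CE mulr_gt0|rewrite pmulr_rgt0// mulr_gt0].
have t7 : C * sf * sumK <= c / 8 * y.
  apply: (@le_trans _ _ (C * ((3 * G + M) * x) * sumK)).
    apply: ler_wpM2r => //; rewrite ler_pM2l//; apply: (le_trans sfb).
    by have := ler_wpM2l M0 x1; clear; lra.
  have h : 0 <= C * ((3 * G + M) * x) by apply: mulr_ge0; [exact: ltW|apply: mulr_ge0; exact: ltW].
  apply: (@le_trans _ _ (C * ((3 * G + M) * x) * (2 * (nb * j)))).
    by apply: ler_wpM2l => //; clear - s1 anb; lra.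
  have -> : C * ((3 * G + M) * x) * (2 * (nb * j)) = (16 * (3 * G + M) * C) * j * (y / 8).
    by rewrite yE; field.
  rewrite CE; have -> : c * k * j * (y / 8) = c * (k * j) * y / 8 by field.
  by rewrite jE; clear; lra.
(* In units of E, 101 = 2 + 2 + 2 + 1 + 94 collects the terms with G, and 32 = 8 * 4 the smooth sum.
   The drift is c y / 2; C sup|f| sumK, the delta term and these errors take at most c y / 8
   each. *)
have t9 : 8 * (101 * G + 32 * M + C2) * E <= c * y.
  apply: (le_trans (ler_wpM2r (ltW E0) LE)).
  have -> : c * (k * L) * E = c * y * (k * j) * (L * i) by rewrite EE; ring.
  by rewrite iE jE; clear; lra.
have g1 := ler_wpM2l (ltW G0) t1.
have g2 := ler_wpM2l (ltW G0) t2.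
have g3 := ler_wpM2l (ltW G0) t3.
have g4 := ler_wpM2l (ltW G0) t4.
have g5 : M * sumK <= M * (4 * E) by apply: ler_wpM2l => //; clear - s1 t5; lra.
have g6 : C2 * x <= C2 * E by exact: ler_wpM2l.
have g7 : G * (nb * (2 * del * (1 + x))) = 2 * del * (G * nb) + c / 8 * y.
  by rewrite -dE yE; field.
have g8 : 2 * del * (G * nb) <= G * nb.
  have gn : 0 <= G * nb by rewrite mulr_ge0 ?ltW.
  by have := ler_wpM2r gn d2; rewrite mul1r.
have cy0 : 0 < c * y by exact: mulr_gt0.
rewrite ler_norml => /andP[h _].
have e1 : G * (nb * (1 + 2 * del * (1 + x) + la) + x + (31 * lqh + 1) * sK) =
  G * nb + G * (nb * (2 * del * (1 + x))) + G * (nb * la) + G * x + G * ((31 * lqh + 1) * sK) by ring.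
rewrite e1 g7 in h.
have e2 : c * (nb * (2^-1 * x)) = c * y / 2 by rewrite yE; field.
rewrite e2 in h.
clear - h g1 g2 g3 g4 g5 g6 g8 t7 t9 NIb cy0; lra.
Qed.

Section Density.
Variable R : realType.

Lemma upper_density_ge (S : set nat) (r : R) :
  (forall M0, exists M, [/\ (M0 <= M)%N, (0 < M)%N & r * M%:R <= (count_upto S M)%:R]) ->
  (r%:E <= upper_density R S)%E.
Proof.
move=> h; rewrite /upper_density /limn_esup /limf_esup; apply: le_ereal_inf_tmp => _ [V [M0 _ VM] <-].
have [M [M0M M1 hr]] := h M0.
apply: (@le_trans _ _ ((count_upto S M)%:R / M%:R : R)%:E).
  by rewrite lee_fin ler_pdivlMr// ltr0n.
by apply: ereal_sup_ubound; exists M => //; exact: VM.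
Qed.

Lemma count_upto_ge (S : set nat) (m M : nat) : (forall N, (m < N <= M)%N -> S N) ->
  (M - m <= count_upto S M)%N.
Proof.
elim: M => [|M IH] h; first by rewrite sub0n.
rewrite /count_upto big_nat_recr//=; have := IH _.
have [mM|mM] := leqP M.+1 m; first by have /eqP -> : (M.+1 - m == 0)%N by rewrite subn_eq0.
rewrite subSn// => h'.
have -> : `[< S M.+1 >] = true by apply/asboolP; apply: h; rewrite mM leqnn.
by rewrite addn1 ltnS; apply: h' => N /andP[N1 N2]; apply: h; rewrite N1 leqW.
Qed.

(** Counting up to the last integer with N + 1 <= X loses about e X; the second [e] absorbs the
    rounding. *)
Lemma upper_density_window (S : set nat) (e : R) : 0 < e <= 2^-1 ->
  (forall X0 : R, exists2 X : R, X0 <= X & forall N : nat, e * X <= N%:R -> N.+1%:R <= X -> S N) ->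
  ((1 - 2 * e)%:E <= upper_density R S)%E.
Proof.
move=> /andP[e0 e1] h; apply: upper_density_ge => M0.
have [X hX HX] := h ((M0%:R + 3) + 5 / e).
have i0 : 0 < e^-1 by rewrite invr_gt0.
have eX : 5 <= e * X.
  rewrite mulrC -ler_pdivrMr//; apply: le_trans hX; rewrite lerDr.
  by rewrite addr_ge0.
have X3 : M0%:R + 3 <= X by apply: le_trans hX; rewrite lerDl mulr_ge0// ltW.
have M00 : 0 <= M0%:R :> R by [].
have X0 : 0 <= X by lra.
have /andP[T1 T2] := truncn_itv X0; set T := Num.truncn X in T1 T2.
have eX0 : 0 <= e * X by lra.
have /andP[t1 t2] := truncn_itv eX0; set t := Num.truncn (e * X) in t1 t2.
have Tn : (M0.+2 <= T)%N.
  by rewrite -ltnS -(ltr_nat R); apply: le_lt_trans T2; apply: le_trans X3; rewrite -!natr1; lra.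
have TE : T.-1.+1 = T by rewrite prednK// (leq_trans _ Tn).
exists T.-1; split.
- by rewrite -ltnS TE ltnW.
- by rewrite -ltnS TE (leq_trans _ Tn).
have cb : (T.-1 - t <= count_upto S T.-1)%N.
  apply: count_upto_ge => N /andP[tN NT]; apply: HX.
    by apply: ltW; apply: (lt_le_trans t2); rewrite ler_nat.
  by apply: le_trans T1; rewrite ler_nat -TE ltnS.
have cb' : T.-1%:R - t%:R <= (count_upto S T.-1)%:R :> R.
  by rewrite lerBlDr -natrD ler_nat addnC -leq_subLR.
apply: le_trans cb'.
have TR : T%:R = T.-1%:R + 1 :> R by rewrite natr1 TE.
rewrite -natr1 TR in T2; move: T2; move: (T.-1%:R : R) => s T2.
have : e * X <= e * (s + 2) by rewrite ler_pM2l//; lra.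
lra.
Qed.

End Density.

Section GoodIndex.
Variable R : realType.
Local Notation irr := (@irrational R).

(** Since K > 0 the digit sum is at least 1, so L <= a; then a^L <= q_K and ln (a + 2) <= 2 ln a
    give the logarithmic bounds. *)
Lemma good_index_bounds (al : R) K v L b : irr al -> (0 < K)%N -> (1 < L)%N -> good_index v L b al K ->
  let x := ln (cfq al K)%:R : R in let a := cfa al K.+1 in let sK := sumn (digits al K) in
  [/\ (L <= a)%N, L%:R <= 2 * x, L%:R * ln (a + 2)%:R <= 2 * x,
      ln ((a + 2) * cfq al K * cfq al K)%:R <= 3 * x & (sK <= a)%N].
Proof.
move=> ial K0 L1 [_ _ Ls aL] x a sK.
have Q0 := @cfq_gt0 R al K ial.
have sK1 : (0 < sK)%N.
  have := digits_gt0 K ial; rewrite /sK; case: K K0 {Ls aL x a sK Q0} => // K _.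
  by rewrite digitsS all_rcons sumn_rcons addn_gt0 => /andP[->]; rewrite orbT.
have La : (L <= a)%N by apply: leq_trans Ls; rewrite leq_pmulr.
have sKa : (sK <= a)%N by apply: leq_trans Ls; rewrite leq_pmull// ltnW.
have a1 : (1 < a)%N by exact: leq_trans La.
have a0' : 0 < a%:R :> R by rewrite ltr0n ltnW.
have h : L%:R * ln a%:R <= x.
  rewrite mulr_natl -lnXn// -natrX ler_ln ?ler_nat// posrE ltr0n//.
  by rewrite expn_gt0 ltnW.
have l2 := ln2_ge R.
have la : 2^-1 <= ln a%:R :> R by apply: (le_trans l2); rewrite ler_ln ?ler_nat// posrE.
have L0 : 0 <= L%:R :> R by [].
have L2 : 2 <= L%:R :> R by rewrite ler_nat.
have h2 : L%:R * 2^-1 <= L%:R * ln a%:R :> R by exact: ler_wpM2l.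
have la2 : ln (a + 2)%:R <= 2 * ln a%:R :> R.
  have -> : 2 * ln a%:R = ln (a * a)%:R :> R by rewrite natrM lnM ?posrE//; ring.
  rewrite ler_ln ?posrE ?ltr0n ?addn2// ?muln_gt0 ?(ltnW a1)// ler_nat -addn2.
  by rewrite (leq_trans (leq_add (leqnn a) a1))// addnn -mul2n leq_mul2r a1 orbT.
have h3 : L%:R * ln (a + 2)%:R <= L%:R * (2 * ln a%:R) :> R by exact: ler_wpM2l.
have lap : 0 <= ln (a + 2)%:R :> R by rewrite ln_ge0// ler1n addn2.
have h4 : 2 * ln (a + 2)%:R <= L%:R * ln (a + 2)%:R :> R by exact: ler_wpM2r.
have lq : ln ((a + 2) * cfq al K * cfq al K)%:R = ln (a + 2)%:R + x + x.
  by rewrite !natrM !lnM ?posrE ?mulr_gt0// ?ltr0n ?addn2.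
by split=> //; rewrite ?lq; lra.
Qed.

Lemma cfq_unbounded (al Y : R) : irr al -> exists K0, forall K, (K0 <= K)%N -> Y <= (cfq al K)%:R.
Proof.
move=> ial; exists (Num.truncn Y).+1.*2 => K hK.
have Y1 : Y < (Num.truncn Y).+1%:R by exact: truncnS_gt.
apply: (le_trans (ltW Y1)); rewrite ler_nat.
apply: leq_trans (@cfq_homo R al _ _ ial hK); apply: leq_trans (cfq_exp2 _ ial).
by rewrite ltnW// ltn_expl.
Qed.

End GoodIndex.

(** * Estimates at a fixed time and the choice of constants *)

Section LogarithmicSums.
Variable R : realType.
Local Notation irr := (@irrational R).
Local Notation frac := (@Pilot.Defs.frac R).
Local Notation dnint := (@Pilot.Defs.dnint R).
Local Notation mu := (@lebesgue_measure R).
Local Notation I01 := (`[0%R, 1%R[%classic : set R).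

Variables (f th : R -> R) (X1 q0 A B M : R) (d : nat).
Hypotheses (d0 : (0 < d)%N)
  (fE : forall x, f x = A * ln (side_dist X1 true x) + B * ln (side_dist X1 false x) + th x)
  (thF : forall x, th (frac x) = th x) (hM : diff01 th M) (thb : forall x, `|th x| <= M)
  (thI : Rintegral mu I01 th = A + B) (fI : Rintegral mu I01 f = 0)
  (intAb : forall (g : R) (q' : nat), 0 <= g <= 1 -> (0 < q')%N -> (d %| q')%N ->
    `|Rintegral mu (I01 `&` [set x | dnint (x - X1) < g]) f| <=
    (`|A| + `|B|) * (ln q'%:R * (6 * g) + (7 * ln q'%:R + 1) / q'%:R) + M * (6 * g)).
Variables (v : nat) (u : int).
Hypotheses (v0 : (0 < v)%N) (qE : q0 - X1 = u%:~R / v%:R).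

Let G : R := `|A| + `|B|.

Section FixedTime.
Variables (al : R) (K : nat) (delta : R).
Hypotheses (ial : irr al) (al01 : 0 <= al < 1) (vQ : (v %| cfq al K)%N) (delta1 : delta <= 2^-1).
Variable N : nat.
Hypotheses (Nd : N.+1%:R <= delta * (cfq al K.+1)%:R).

Let Q := cfq al K.
Let q1 := cfq al K.+1.
Let a := cfa al K.+1.
Let qh := ((a + 2) * Q * Q)%N.

Lemma side_dist_orbit c n :
  side_dist X1 c (n%:R * al + q0) = side_dist 0 c (u%:~R / v%:R + n%:R * al).
Proof. by rewrite /side_dist subr0 -qE; have -> : n%:R * al + q0 - X1 = q0 - X1 + n%:R * al by ring. Qed.

Lemma orbit_lt n : (n <= N)%N -> n%:R <= delta * (cfq al K.+1)%:R.
Proof. by move=> nN; apply: le_trans Nd; rewrite ler_nat leqW. Qed.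

Lemma N_lt_q1 : (N < q1)%N.
Proof.
have q10 : 0 < (cfq al K.+1)%:R :> R by rewrite ltr0n cfq_gt0.
rewrite -(ler_nat R); apply: (le_trans Nd); rewrite -[leRHS]mul1r ler_pM2r//.
by have d1 : delta <= 2^-1 := delta1; lra.
Qed.

Lemma qh0 : (0 < qh)%N. Proof. exact: qh_gt0 ial. Qed.

Lemma gmin_ge : qh%:R^-1 <= gmin al q0 X1 N.
Proof.
have qh1 : 1 <= qh%:R :> R by rewrite ler1n qh0.
rewrite /gmin big_nat; elim/big_ind: _ => [||n /andP[n0 nN]].
- by rewrite invf_le1// (lt_le_trans _ qh1).
- by move=> x y hx hy; rewrite le_min hx.
rewrite dnint_side le_min !side_dist_orbit.
have h c := @side_dist_ge R al K v u delta ial al01 v0 vQ delta1 n c n0 (orbit_lt nN).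
by apply/andP; split; [have [] := h true|have [] := h false].
Qed.

Hypothesis NQ : (cfq al K <= N)%N.

Lemma gmin_le : gmin al q0 X1 N <= q1%:R^-1.
Proof.
have [n [/andP[n0 nQ] h]] := close_return u ial al01 v0 vQ.
apply: (@bigmin_inf_seq _ _ _ _ _ n) => //; first by rewrite mem_index_iota n0 ltnS (leq_trans nQ).
by have -> : n%:R * al + q0 - X1 = u%:~R / v%:R + n%:R * al by rewrite -qE; ring.
Qed.

Lemma gmin01 : 0 <= gmin al q0 X1 N <= 1.
Proof.
have g1 := gmin_ge; have g2 := gmin_le.
apply/andP; split; first by apply: le_trans g1; rewrite invr_ge0.
by apply: (le_trans g2); rewrite invf_le1 ?ler1n ?ltr0n cfq_gt0.
Qed.

Lemma sup_far : sup [set `|f x| | x in I01 `\` AN al q0 X1 N] <= G * ln qh%:R + M.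
Proof.
have qh1 : 1 <= qh%:R :> R by rewrite ler1n qh0.
have l0 : 0 <= ln qh%:R :> R by rewrite ln_ge0.
have M0 : 0 <= M by apply: le_trans (thb 0).
have G0 : 0 <= G by rewrite /G addr_ge0.
have b0 : 0 <= G * ln qh%:R + M by rewrite addr_ge0// mulr_ge0.
have [->|/set0P ne] := eqVneq [set `|f x| | x in I01 `\` AN al q0 X1 N] set0; first by rewrite sup0.
apply: ge_sup => // _ [x [xI xA] <-].
have gx : qh%:R^-1 <= dnint (x - X1).
  apply: (le_trans gmin_ge); rewrite leNgt; apply/negP => h; exact: xA.
have lb c : `|ln (side_dist X1 c x)| <= ln qh%:R.
  have s1 : qh%:R^-1 <= side_dist X1 c x.
    by move: gx; rewrite dnint_side le_min => /andP[]; case: c.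
  have /andP[s0 s2] := side_dist01 X1 c x.
  have p0 : 0 < qh%:R^-1 :> R by rewrite invr_gt0 (lt_le_trans _ qh1).
  rewrite ler0_norm ?ln_le0// lerNl -lnV ?posrE ?(lt_le_trans _ qh1)//.
  by rewrite ler_ln ?posrE// (lt_le_trans p0).
rewrite fE; apply: (le_trans (ler_normD _ _)); apply: lerD; last exact: thb.
apply: (le_trans (ler_normD _ _)); rewrite !normrM /G mulrDl.
by apply: lerD; apply: ler_wpM2l.
Qed.

(** The bound includes a_(K+1) but has no logarithmic factor, which makes it negligible against
    a_(K+1) ln q_K. *)
Lemma smooth_sum :
  `|\sum_(1 <= n < N.+1) (th (n%:R * al + q0) - (A + B))| <= 8 * M * (sumn (digits al K.+1))%:R.
Proof.
have M0 : 0 <= M by apply: le_trans (thb 0).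
have h (k : nat) (x0 : R) : (k < K.+1)%N ->
    `|\sum_(1 <= n < (cfq al k).+1) (th (x0 + n%:R * al) - (A + B))| <= 8 * M.
  move=> _; have := @diff01_denjoy_koksma R al k x0 _ _ ial al01 hM.
  by rewrite thI; under eq_bigr do rewrite thF.
have M8 : 0 <= 8 * M by rewrite mulr_ge0.
have := @ostrowski_sum R al (fun x => th x - (A + B)) (8 * M) K.+1 ial M8 h N q0 N_lt_q1.
by under eq_bigr do rewrite (addrC q0).
Qed.

(** The two one-sided sums drift by the same amount in opposite directions, so only A - B = c2
    survives: this is where asymmetry enters. *)
Lemma SN_drift :
  `|SN f al q0 N - (if odd K then 1 else -1) * (A - B) * ((N %/ Q)%N%:R * (2^-1 * ln Q%:R))|
  <= G * ((N %/ Q)%N%:R * (1 + 2 * delta * (1 + ln Q%:R) + ln (a + 2)%:R) + ln Q%:R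
     + (31 * ln qh%:R + 1) * (sumn (digits al K))%:R) + 8 * M * (sumn (digits al K.+1))%:R.
Proof.
have h c := @log_sum_drift R al K v u delta ial al01 v0 vQ delta1 N c Nd.
have hs := smooth_sum.
set T := \sum_(1 <= n < N.+1) (th (n%:R * al + q0) - (A + B)) in hs.
pose S c := \sum_(1 <= n < N.+1) (ln (side_dist 0 c (u%:~R / v%:R + n%:R * al)) + 1).
have SE : SN f al q0 N = A * S true + B * S false + T.
  rewrite /SN fI mulr0 subr0 /S !mulr_sumr -!big_split /=; apply: eq_bigr => n _.
  by rewrite fE !side_dist_orbit; ring.
have ht := h true; have hf := h false; rewrite -/(S true) -/(S false) in ht hf.
rewrite -/Q -/a -/qh in ht hf.
rewrite SE; move: ht hf hs; set E := (_ + _ + _ * _).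
set m := (_ * (2^-1 * _)).
have -> : A * S true + B * S false + T - (if odd K then 1 else -1) * (A - B) * m =
  A * (S true - (if true (+) odd K then -1 else 1) * m) +
  B * (S false - (if false (+) odd K then -1 else 1) * m) + T.
  by case: (odd K) => /=; ring.
move=> ht hf hs.
apply: (le_trans (ler_normD _ _)); apply: lerD => //.
apply: (le_trans (ler_normD _ _)); rewrite !normrM /G mulrDl.
by apply: lerD; apply: ler_wpM2l.
Qed.

(** With q' = d q_(K+1) both N g and N/q' are at most 1, whence 13 = 6 + 7. *)
Lemma far_integral :
  N%:R * `|Rintegral mu (I01 `&` AN al q0 X1 N) f| <=
    G * (13 * ln (d * q1)%:R + 1) + 6 * M.
Proof.
have M0 : 0 <= M by apply: le_trans (thb 0).
have G0 : 0 <= G by rewrite /G addr_ge0.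
have q10 : (0 < q1)%N by rewrite cfq_gt0.
have dq0 : (0 < d * q1)%N by rewrite muln_gt0 d0.
have h := intAb gmin01 dq0 (dvdn_mulr _ (dvdnn d)).
have l0 : 0 <= ln (d * q1)%:R :> R by rewrite ln_ge0// ler1n.
have N0 : 0 <= N%:R :> R by [].
have Nq : N%:R <= q1%:R :> R by rewrite ler_nat ltnW// N_lt_q1.
have Nq' : N%:R <= (d * q1)%:R :> R by apply: (le_trans Nq); rewrite ler_nat leq_pmull.
have Ng : N%:R * gmin al q0 X1 N <= 1.
  apply: (@le_trans _ _ (N%:R * q1%:R^-1)); first by apply: ler_wpM2l => //; exact: gmin_le.
  by rewrite ler_pdivrMr ?mul1r// ltr0n.
have Ni : N%:R / (d * q1)%:R <= 1 :> R by rewrite ler_pdivrMr ?mul1r// ltr0n.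
apply: (le_trans (ler_wpM2l N0 h)).
move: l0 Ng Ni; rewrite -/G; move: (gmin _ _ _ _) => g; move: ((d * q1)%:R^-1) => i.
move: (ln _) => l l0 Ng Ni.
have -> : N%:R * (G * (l * (6 * g) + (7 * l + 1) * i) + M * (6 * g)) =
  G * (6 * l * (N%:R * g) + (7 * l + 1) * (N%:R * i)) + 6 * M * (N%:R * g) by ring.
have h1 : 6 * l * (N%:R * g) <= 6 * l * 1 by apply: ler_wpM2l => //; lra.
have h2 : (7 * l + 1) * (N%:R * i) <= (7 * l + 1) * 1 by apply: ler_wpM2l => //; lra.
have h3 : 6 * M * (N%:R * g) <= 6 * M * 1 by apply: ler_wpM2l => //; lra.
apply: lerD; last by lra.
by apply: ler_wpM2l => //; lra.
Qed.

End FixedTime.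

Section Dominance.
Variables (k delta C : R) (L : nat).
(** The bound of [far_integral] in units of x = ln q_K: ln q_(K+1) <= 2 x and x >= 1 turn 13 ln (d
    q_(K+1)) + 1 into at most (13 ln d + 27) x. *)
Let C2 := G * (13 * ln d%:R + 27) + 6 * M.
Let c := `|A - B|.
Hypotheses (c0 : 0 < c) (k01 : 0 < k <= 1) (delta1 : 0 <= delta <= 2^-1) (Gd : 16 * G * delta = c)
  (CE : 16 * (3 * G + M) * C = c * k) (LE : 8 * (101 * G + 32 * M + C2) <= c * (k * L%:R))
  (L1 : (1 < L)%N) (kL : 1 <= k * L%:R).

(** [sg] selects one of the two sets, and [b] is the parity giving the drift this sign. The lower
    end 2 k q_(K+1) of the window ensures k a complete blocks: 2 k a - 1 >= k a because k a >= 1. *)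
Lemma drift_wins (al sg : R) K b N : irr al -> 0 <= al < 1 -> (0 < K)%N -> good_index v L b al K ->
  sg * ((if b then 1 else -1) * (A - B)) = c -> `|sg| = 1 ->
  2 * k * (cfq al K.+1)%:R <= N%:R -> N.+1%:R <= delta * (cfq al K.+1)%:R ->
  C * sup [set `|f x| | x in I01 `\` AN al q0 X1 N] * \sum_(1 <= i < (Kof al N).+1) ((cfa al i)%:R : R)
    + N%:R * `|Rintegral mu (I01 `&` AN al q0 X1 N) f| <= sg * SN f al q0 N.
Proof.
move=> ial al01 K0 gi sgE sg1 kN Nd.
have [Kb vQ LsK _] := gi.
have [La Lx Lla lq sKa] := good_index_bounds ial K0 L1 gi.
have [d00 d1] := andP delta1; have [k0 k1] := andP k01.
have Q0 := @cfq_gt0 R al K ial.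
have Q0' : 0 < (cfq al K)%:R :> R by rewrite ltr0n.
set a := cfa al K.+1 in La Lla lq sKa LsK *; set Q := cfq al K in vQ Lx Lla lq Q0 Q0' *.
have L2 : 2 <= L%:R :> R by rewrite ler_nat.
have La' : L%:R <= a%:R :> R by rewrite ler_nat.
have ka1 : 1 <= k * a%:R by apply: (le_trans kL); rewrite ler_pM2l.
have q1E : cfq al K.+1 = (a * Q + cfq_prev al K)%N := cfqS al K.
have prevQ : (cfq_prev al K <= Q)%N by rewrite /Q cfq_prevE cfqE; have [] := wden_le (digits_gt0 K ial).
have q1l : a%:R * Q%:R <= (cfq al K.+1)%:R :> R by rewrite -natrM ler_nat q1E leq_addr.
have kaQ : 2 * (k * a%:R) * Q%:R <= N%:R.
  apply: le_trans kN; have -> : 2 * (k * a%:R) * Q%:R = 2 * k * (a%:R * Q%:R) by ring.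
  by rewrite ler_pM2l ?mulr_gt0.
have NQ : (Q <= N)%N.
  rewrite -(ler_nat R); apply: le_trans kaQ; rewrite -[leLHS]mul1r ler_pM2r//; lra.
have Nq1 := @N_lt_q1 al K delta ial d1 N Nd.
have KN : Kof al N = K.+1 by apply: Kof_eq ial _; rewrite NQ.
rewrite KN digit_sum_real.
have M0 : 0 <= M by apply: le_trans (thb 0).
have G0 : 0 < G.
  rewrite lt_neqAle eq_sym; apply/andP; split; last by rewrite /G addr_ge0.
  by apply/eqP => g; move: c0; rewrite -Gd g mulr0 mul0r ltxx.
have sf := @sup_far al K delta ial al01 vQ d1 N Nd.
have NI := @far_integral al K delta ial al01 vQ d1 N Nd NQ.
have dr := @SN_drift al K delta ial al01 vQ d1 N Nd.
rewrite -/G -/Q -/a Kb in sf NI dr.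
have ld0 : 0 <= ln d%:R :> R by rewrite ln_ge0// ler1n.
set x := ln Q%:R in Lx Lla lq dr *.
have x1 : 1 <= x by lra.
have sE : (sumn (digits al K.+1))%:R = (sumn (digits al K))%:R + a%:R :> R.
  by rewrite digitsS sumn_rcons natrD.
have sKa' : (sumn (digits al K))%:R <= a%:R :> R by rewrite ler_nat.
have nb : k * a%:R <= (N %/ Q)%N%:R.
  have : N%:R < ((N %/ Q)%N%:R + 1) * Q%:R :> R.
    by rewrite natr1 -natrM ltr_nat ltn_ceil.
  move=> /(le_lt_trans kaQ); rewrite ltr_pM2r//; lra.
have lap : 0 <= ln (a + 2)%:R :> R by rewrite ln_ge0// ler1n addn2.
have lap2 : 2 * ln (a + 2)%:R <= L%:R * ln (a + 2)%:R :> R by exact: ler_wpM2r.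
have lq1 : ln (d * cfq al K.+1)%:R <= ln d%:R + 2 * x.
  apply: (@le_trans _ _ (ln (d * ((a + 2) * Q))%:R)).
    rewrite ler_ln ?posrE ?ltr0n ?muln_gt0 ?d0 ?Q0 ?addn2 ?cfq_gt0//.
    rewrite ler_nat leq_mul2l; apply/orP; right; rewrite q1E mulSn addnC leq_add// mulSn.
    exact: leq_addl.
  rewrite natrM lnM ?posrE ?ltr0n ?muln_gt0 ?Q0 ?addn2// natrM lnM ?posrE ?ltr0n//.
  by rewrite addn2 in lap2 Lla; rewrite -/x; lra.
apply: (@drift_dominates R c G M C2 k L%:R delta C x a%:R (N %/ Q)%N%:R (sumn (digits al K))%:R
  (ln ((a + 2) * Q * Q)%:R) (ln (a + 2)%:R)) => //.
- by rewrite /C2 addr_ge0// mulr_ge0// ?ltW// ltr_wpDl// mulr_ge0.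
- by rewrite -natrM ler_nat.
- by rewrite sE; apply/andP; split; [rewrite addr_ge0|rewrite mulr_natl mulr2n lerD2r].
- apply: (le_trans sf); rewrite lerD2r.
  have -> : 3 * G * x = G * (3 * x) by ring.
  by rewrite ler_pM2l.
- apply: (le_trans NI); have -> : C2 * x = G * (13 * ln d%:R + 27) * x + 6 * M * x by rewrite /C2; ring.
  apply: lerD.
    rewrite -mulrA ler_pM2l//.
    have : ln d%:R * 1 <= ln d%:R * x by exact: ler_wpM2l.
    by lra.
  by rewrite -[leLHS]mulr1 ler_wpM2l// mulr_ge0.
apply: le_trans dr; rewrite -sgE.
have -> : sg * SN f al q0 N - sg * ((if b then 1 else -1) * (A - B)) * ((N %/ Q)%N%:R * (2^-1 * x)) =
  sg * (SN f al q0 N - (if b then 1 else -1) * (A - B) * ((N %/ Q)%N%:R * (2^-1 * x))) by ring.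
by rewrite normrM sg1 mul1r.
Qed.

End Dominance.

(** [C] and [L] are chosen before [al], as C(r) must not depend on alpha. *)
Lemma drift_density (r : R) : A != B -> 0 < r < 1 -> exists (C : R) (L : nat), 0 < C /\
  forall al : R, 0 <= al < 1 -> irr al ->
  (forall b K0, exists2 K, (K0 <= K)%N & good_index v L b al K) ->
  forall sg : R, `|sg| = 1 ->
  (r%:E <= upper_density R [set N : nat | (0 < N)%N /\
    (C * sup [set `|f x| | x in I01 `\` AN al q0 X1 N] * \sum_(1 <= i < (Kof al N).+1) ((cfa al i)%:R : R)
    + N%:R * `|Rintegral mu (I01 `&` AN al q0 X1 N) f| <= sg * SN f al q0 N)%R])%E.
Proof.
move=> AB /andP[r0 r1].
pose c : R := `|A - B|.
have c0 : 0 < c by rewrite normr_gt0 subr_eq0.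
have cG : c <= G by exact: ler_normB.
have G0 : 0 < G by exact: lt_le_trans cG.
have M0 : 0 <= M by apply: le_trans (thb 0).
have [delta dE] : exists dl, 16 * G * dl = c.
  by exists (c / (16 * G)); rewrite mulrC divfK// gt_eqF// mulr_gt0.
have G16 : 0 < 16 * G by rewrite mulr_gt0.
have del0 : 0 < delta by rewrite -(pmulr_rgt0 _ G16) dE.
have del1 : delta <= 2^-1 by rewrite -(ler_pM2l G16) dE; lra.
pose e : R := (1 - r) / 2.
have e0 : 0 < e by rewrite /e; lra.
have e1 : e <= 2^-1 by rewrite /e; lra.
(* The window starts at e delta q_(K+1) = 2 k q_(K+1), with half reserved for rounding down the
   number of blocks. *)
pose k : R := e * delta / 2.
have k0 : 0 < k by rewrite /k divr_gt0// mulr_gt0.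
have k1 : k <= 1.
  have : e * delta <= 1 * 1 by apply: ler_pM; lra.
  by rewrite /k; lra.
have GM : 0 < 16 * (3 * G + M) by lra.
have [C CE] : exists C, 16 * (3 * G + M) * C = c * k.
  by exists (c * k / (16 * (3 * G + M))); rewrite mulrC divfK// gt_eqF.
have C0 : 0 < C by rewrite -(pmulr_rgt0 _ GM) CE mulr_gt0.
pose C2 := G * (13 * ln d%:R + 27) + 6 * M.
(* The three summands provide L >= 2, k L >= 1 and the domination of the error constants. *)
pose Y := 2 + (k^-1 + `|8 * (101 * G + 32 * M + C2) / (c * k)|).
have [L YL] : exists L : nat, Y <= L%:R.
  by exists (Num.truncn Y).+1; rewrite ltW// truncnS_gt.
have ki : 0 < k^-1 by rewrite invr_gt0.
have n0 := normr_ge0 (8 * (101 * G + 32 * M + C2) / (c * k)).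
have L1 : (1 < L)%N by rewrite -(ler_nat R); apply: le_trans YL; rewrite /Y; lra.
have kL : 1 <= k * L%:R by rewrite mulrC -ler_pdivrMr// div1r; apply: le_trans YL; rewrite /Y; lra.
have LE : 8 * (101 * G + 32 * M + C2) <= c * (k * L%:R).
  have -> : c * (k * L%:R) = L%:R * (c * k) by ring.
  have ck0 : 0 < c * k by exact: mulr_gt0.
  rewrite -ler_pdivrMr//; apply: (le_trans (ler_norm _)).
  by apply: le_trans YL; rewrite /Y; lra.
exists C, L; split=> // al al01 ial gi sg sg1.
have [b bE] : exists b : bool, sg * ((if b then 1 else -1) * (A - B)) = c.
  have : sg = 1 \/ sg = -1.
    by case: (lerP 0 sg) sg1 => h; [rewrite ger0_norm//; left|rewrite ltr0_norm// => <-; right; rewrite opprK].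
  rewrite /c; case: (lerP 0 (A - B)) => h [->|->]; [exists true|exists false|exists false|exists true] => /=;
    rewrite ?(ger0_norm h) ?(ltr0_norm h); ring.
have -> : r = 1 - 2 * e by rewrite /e; field.
apply: upper_density_window; first by rewrite e0.
move=> X0; have [K0 hK0] := cfq_unbounded (X0 / delta) ial.
have [K KK0 gK] := gi b (maxn 1 K0).
have /andP[K1 K2] : (1 <= K)%N && (K0 <= K)%N by rewrite -geq_max.
exists (delta * (cfq al K.+1)%:R).
  by rewrite [leRHS]mulrC -ler_pdivrMr//; apply: hK0; apply: leqW; exact: K2.
move=> N h1 h2.
have q10 : 0 < (cfq al K.+1)%:R :> R by rewrite ltr0n cfq_gt0.
split.
  by rewrite -(ltr0n R); apply: lt_le_trans h1; apply: mulr_gt0 => //; exact: mulr_gt0.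
apply: (@drift_wins k delta C L c0 _ _ dE CE LE L1 kL al sg K b N) => //.
- by rewrite k0.
- by rewrite (ltW del0).
- by apply: le_trans h1; rewrite le_eqVlt; apply/orP; left; apply/eqP; rewrite /k; field.
Qed.

End LogarithmicSums.

Theorem theorem1p7 (R : realType) (f : R -> R) (x1 q : rat) :
  asym_log_sing f x1 ->
  exists C : R -> R, (forall r : R, 0 < r < 1 -> 0 < C r) /\
  {ae (@lebesgue_measure R), forall alpha : R,
     0 <= alpha < 1 -> @irrational R alpha ->
     forall r : R, 0 < r < 1 ->
       let A := AN alpha (ratr q) (ratr x1) in
       let supf (N : nat) :=
         sup [set `|f x| | x in `[0%R, 1%R[%classic `\` A N] in
       let intA (N : nat) : R :=
         `|Rintegral lebesgue_measure (`[0%R, 1%R[%classic `&` A N) f| in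
       let sumK (N : nat) := \sum_(1 <= i < (Kof alpha N).+1) ((cfa alpha i)%:R : R) in
       (r%:E <= upper_density R [set N : nat | (0 < N)%N /\
          (SN f alpha (ratr q) N >= C r * supf N * sumK N + N%:R * intA N)%R])%E /\
       (r%:E <= upper_density R [set N : nat | (0 < N)%N /\
          (SN f alpha (ratr q) N <= - (C r * supf N * sumK N) - N%:R * intA N)%R])%E}.
Proof.
move=> [c1 [c2 [t [hf c20]]]].
have [w [d [d0 X1E]]] := ratr_fraction R x1.
(* Two denominators are used: [d] of x1 for the integrals, and [v] of q - x1, which must divide q_K,
   for the orbit. *)
have [u [v [v0 qE]]] := ratr_fraction R (q - x1).
rewrite rmorphB/= in qE.
have [M hM] := th_diff01 hf.
have AB : c1 + c2 != c1 by rewrite -subr_eq0 addrC addKr.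
have dd (r : R) : exists CL : R * nat, 0 < r < 1 -> 0 < CL.1 /\
  forall al : R, 0 <= al < 1 -> @irrational R al ->
  (forall b K0, exists2 K, (K0 <= K)%N & good_index v CL.2 b al K) ->
  forall sg : R, `|sg| = 1 ->
  (r%:E <= upper_density R [set N : nat | (0 < N)%N /\
    (CL.1 * sup [set `|f x| | x in `[0%R, 1%R[%classic `\` AN al (ratr q) (ratr x1) N]
       * \sum_(1 <= i < (Kof al N).+1) ((cfa al i)%:R : R)
    + N%:R * `|Rintegral lebesgue_measure (`[0%R, 1%R[%classic `&` AN al (ratr q) (ratr x1) N) f|
     <= sg * SN f al (ratr q) N)%R])%E.
  have [r01|nr] := boolP (0 < r < 1); last by exists (0, 0%N).
  have [C [L CL]] := @drift_density R f _ (ratr x1) (ratr q) (c1 + c2) c1 M d d0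
    (log_sing_decomp hf) (th_frac hf) hM (th_bound hf hM) (Rintegral_th hf d0 X1E)
    (Rintegral_f0 hf) (fun g q' g01 q0 dq => intA_bound hf d0 X1E g01 q0 dq hM) v u v0 qE r AB r01.
  by exists (C, L).
have [CL hCL] := choice dd.
exists (fun r => (CL r).1); split; first by move=> r r01; have [] := hCL r r01.
(* The exceptional set depends on [v] alone, so it is the same for all r. *)
have := @ae_good_index R v v0; apply: negligibleS => al /=.
apply: contra_not => good al01 ial r r01.
have {good}good : forall b K0, exists2 K, (K0 <= K)%N & good_index v (CL r).2 b al K.
  by move=> b K0; exact: (good al01 ial (CL r).2 b K0).
have [_ h] := hCL r r01; split.
  have := h al al01 ial good 1 (normr1 R); congr (_ <= upper_density R _)%E.
  by apply/funext => N /=; rewrite mul1r.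
have := h al al01 ial good (-1) (normrN1 R); congr (_ <= upper_density R _)%E.
by apply/funext => N /=; rewrite mulN1r lerNr opprD.
Qed.
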